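(* Let $\{\bm{w}^k\}_{k\ge 1}$ be generated by perturbed iterate SGD with numerical error, i.e. $\bm{w}^1\in\mathbb{R}^d$ and $$\bm{w}^{k+1}=\bm{w}^k-\frac{\hat{\eta}_k\psi_k}{M}\sum_{i=1}^M\widehat{\nabla} F(\bm{w}^k+\hat{\bm{u}}^k,\bm{\xi}^{k,i},\bm{b}^{k,i})+\hat{\bm{e}}^k ,\qquad k\ge 1,$$ in the setting described in the context, with deterministic $\alpha_k>0$ and $\hat\eta_k>0$ and random $\psi_k\ge 0$. Assume: (A) (gradient error) There exist constants $c_1,c_2>0$ and $K\in\mathbb{N}$ such that for all $k\ge K$, almost surely, $$\langle \mathbb{E}[\widehat{\nabla} F(\bm{w}^k+\hat{\bm{u}}^k,\bm{\xi},\bm{b}^k)\mid\mathcal{F}_{k-1}],\nabla f_{\alpha_k}(\bm{w}^k)\rangle\geq c_1 \|\nabla f_{\alpha_k}(\bm{w}^k)\|^2_2,\qquad \mathbb{E}[\|\widehat{\nabla} F(\bm{w}^k+\hat{\bm{u}}^k,\bm{\xi},\bm{b}^k)\|^2_2\mid\mathcal{F}_{k-1}]\leq c_2Q .$$ (B) (step sizes) (1) For every $k\in\mathbb{N}$ there are $\mathcal{F}_{k-1}$-measurable random variables $0\le\Psi^L_k\le\Psi^U_k<\infty$ with $\mathbb{P}(\Psi^L_k\leq\psi_k\leq\Psi^U_k\mid\mathcal{F}_{k-1})=1$ almost surely; (2) there are constants $0<\underline{\Psi}^U\le\overline{\Psi}^U<\infty$ with $\mathbb{P}(\underline{\Psi}^U\leq\Psi^U_k\leq\overline{\Psi}^U)=1$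 for all $k\in\mathbb{N}$; (3) $\Delta_k:=\Psi^U_k-\Psi^L_k$ converges to $0$ almost surely uniformly (for every $\epsilon>0$ there is $K\in\mathbb{N}$ such that $\Delta_k\le\epsilon$ almost surely for all $k\ge K$). (C) (arithmetic error) There exist a constant $c_3>0$ and $K\in\mathbb{N}$ such that for all $k\ge K$, almost surely, $\mathbb{E}[\hat{\bm{e}}^k\mid\mathcal{F}_{k-1},\mathcal{G}_k]=\bm{0}$ and $\mathbb{E}[\|\hat{\bm{e}}^k\|^2_2\mid\mathcal{F}_{k-1}]\leq c_3\hat{\eta}^2_k$. (D) There exist a constant $c_4>0$ and $K\in\mathbb{N}$ such that for all $k\geq K$, $\Delta_k\leq c_4\frac{\hat{\eta}_k}{\alpha_k}$ almost surely. (E) $\{\alpha_k\}$ is non-increasing, $\lim_{k\to\infty}\alpha_k=0$, and $$\sum_{k=1}^{\infty}\alpha_k^d\hat{\eta}_k=\infty,\qquad \sum_{k=1}^{\infty}\alpha_k^{d-1}\hat{\eta}^2_k<\infty .$$ Then, almost surely, there exists a subsequence of indices $\{k_i\}$ such that $$\lim_{i\rightarrow \infty} \|\nabla f_{\alpha_{k_i}}(\bm{w}^{k_i})\|_2=0,$$ and for every accumulation point $\bm{w}^*$ of $\{\bm{w}^{k_i}\}$, $\operatorname{dist}(\bm{0},\partial f(\bm{w}^* ))=0$.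
   Context: Loss function. $d,n,s\in\mathbb{N}$; $\bm{\xi}$ is an $\mathbb{R}^n$-valued random vector on a probability space $(\Omega,\mathcal{F},P)$. $F:\mathbb{R}^d\times\mathbb{R}^n\to\mathbb{R}$ is such that $F(\cdot,\bm{\xi})$ is continuous for each $\bm{\xi}\in\mathbb{R}^n$ and $F(\bm{w},\cdot)$ is Borel measurable for each $\bm{w}\in\mathbb{R}^d$. There is a measurable $L_0:\mathbb{R}^n\to\mathbb{R}$ such that for almost all $\bm{\xi}$, $|F(\bm{w},\bm{\xi})-F(\bm{w}',\bm{\xi})|\le L_0(\bm{\xi})\|\bm{w}-\bm{w}'\|_2$ for all $\bm{w},\bm{w}'\in\mathbb{R}^d$, and $Q:=\mathbb{E}[L_0(\bm{\xi})^2]<\infty$. The loss is $f:=\mathbb{E}[F(\cdot,\bm{\xi})]:\mathbb{R}^d\to\mathbb{R}_{\ge 0}$ (assumed real-valued and non-negative); it is Lipschitz continuous with constant $L_0:=\mathbb{E}[L_0(\bm{\xi})]$. Smoothing. For $\alpha>0$, $B^\infty_\alpha:=\{\bm{x}\in\mathbb{R}^d:\|\bm{x}\|_\infty\le\alpha\}$, $U(B^\infty_\alpha)$ is the uniform distribution on it, and $f_\alpha(\bm{w}):=\mathbb{E}[f(\bm{w}+\bm{u})]$ with $\bm{u}\sim U(B^\infty_\alpha)$. It is known that $f_\alpha$ is differentiable and $\nabla f_\alpha$ is $\alpha^{-1}\sqrt{d}L_0$-Lipschitz continuous. Clarke subdifferential. For locally Lipschitz $h:\mathbb{R}^d\to\mathbb{R}$,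 $\partial h(\bm{w})=\operatorname{co}\{\bm{v}:\exists\,\bm{w}^k\to\bm{w},\ h \text{ differentiable at each } \bm{w}^k,\ \nabla h(\bm{w}^k)\to\bm{v}\}$, where $\operatorname{co}$ is the convex hull. $\operatorname{dist}$ is Euclidean distance to a set. Algorithm. $M\in\mathbb{N}$ is the mini-batch size and $\bm{w}^1$ is a given initial point. $\widehat{\nabla} F:\mathbb{R}^d\times\mathbb{R}^n\times\mathbb{R}^s\to\mathbb{R}^d$ is a Borel measurable function (an approximate stochastic gradient). At iteration $k$: $\hat{\bm{u}}^k\in\mathbb{R}^d$ is a sample from a deterministic (pre-specified) probability distribution $\widehat{P}^k$; $\bm{\xi}^{k,1},\dots,\bm{\xi}^{k,M}$ are samples of $\bm{\xi}$; $\bm{b}^{k,1},\dots,\bm{b}^{k,M}$ are samples of a discrete random vector $\bm{b}^k\in\mathbb{R}^s$, denoted $\bm{b}^k\sim U(V^k)$, each of whose components is uniformly distributed on a finite set; the sampling of $\hat{\bm{u}}^k,\{\bm{\xi}^{k,i}\},\{\bm{b}^{k,i}\}$ is done independently (of each other and of the past). $\hat\eta_k>0$ and $\alpha_k>0$ are deterministic, $\psi_k\ge0$ is a random variable, and $\hat{\bm{e}}^k\in\mathbb{R}^d$ is a random vector. $\mathcal{F}_k:=\sigma(\hat{\bm{u}}^j,\{\bm{\xi}^{j,i}\},\{\bm{b}^{j,i}\},\psi_j,\hat{\bm{e}}^j: j\in\{1,\dots,k\})$ (with $\mathcal{F}_0$ trivial) and $\mathcal{G}_k:=\sigma(\hat{\bm{u}}^k,\{\bm{\xi}^{k,i}\},\{\bm{b}^{k,i}\},\psi_k)$.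 In (A), $\hat{\bm{u}}^k\sim\widehat P^k$, $\bm{b}^k\sim U(V^k)$ and $\bm{\xi}$ denote generic such samples, independent of each other and of $\mathcal{F}_{k-1}$. *)

(* Defs.v *)
From HB Require Import structures.
From mathcomp Require Import all_boot all_order all_algebra finmap.
From mathcomp Require Import all_classical all_reals all_analysis.
From mathcomp Require Import measurable_realfun.

Set Implicit Arguments.
Unset Strict Implicit.
Unset Printing Implicit Defensive.

Import Order.TTheory GRing.Theory Num.Theory.
Import numFieldNormedType.Exports.

Local Open Scope classical_set_scope.
Local Open Scope ring_scope.

Fact borel_mx_display : measure_display.
Proof. exact: default_measure_display. Qed.

(* Borel sigma-algebra of 'M[R]_(m, n), in particular of R^d = 'rV[R]_d. *)
HB.instance Definition _ (R : realType) (m n : nat) :=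
  isMeasurable.Build borel_mx_display 'M[R]_(m, n)
    (@sigma_algebra0 _ setT open) (@sigma_algebraC _ open)
    (@sigma_algebra_bigcup _ setT open).

Section borel_matrix.
Context {R : realType}.

Lemma measurable_mx_open m n (A : set 'M[R]_(m, n)) : open A -> measurable A.
Proof. exact: sub_gen_smallest. Qed.

Lemma measurable_mx_closed m n (A : set 'M[R]_(m, n)) :
  closed A -> measurable A.
Proof.
by move=> cA; rewrite -[A]setCK; apply: measurableC; apply: measurable_mx_open;
   exact: closed_openC.
Qed.

Lemma continuous_mx_measurable m n (f : 'M[R]_(m, n) -> R) :
  continuous f -> measurable_fun setT f.
Proof.
move=> /continuousP cf; apply: (measurability _ (RGenOpens.measurableE R)).
move=> _ [_ [a [b ->] <-]]; rewrite setTI.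
by apply: measurable_mx_open; apply: cf; exact: interval_open.
Qed.

Lemma measurable_coord m n i j :
  measurable_fun setT (fun x : 'M[R]_(m, n) => x i j).
Proof. by apply: continuous_mx_measurable => x; exact: coord_continuous. Qed.

Lemma measurable_fun_mxP d (T : measurableType d) m n (f : T -> 'M[R]_(m, n)) :
  measurable_fun setT f <->
  forall i j, measurable_fun setT (fun x => f x i j : R).
Proof.
split=> [mf i j|mf]; first exact: measurableT_comp (measurable_coord i j) mf.
apply: (@measurability _ _ _ _ _ _ (@open 'M[R]_(m, n))) => // _ [A oA <-].
rewrite setTI.
pose B (c : 'M[rat]_(m, n) * nat) : set 'M[R]_(m, n) :=
  [set x | forall i j, `|ratr (c.1 i j) - x i j| < c.2.+1%:R^-1].
have AE : A = \bigcup_(c in [set c | B c `<=` A]) B c.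
  apply/seteqP; split=> [x Ax|x [c cA] /cA //].
  have [e /= e0 xeA] := (nbhs_ballP _ _).1 (open_nbhs_nbhs (conj oA Ax)).
  have e20 : 0 < e / 2 by rewrite divr_gt0.
  have [N Ne] : exists N, N.+1%:R^-1 < e / 2.
    exists (Num.truncn (e / 2)^-1).
    by rewrite invf_plt ?posrE// truncnS_gt.
  have q_ i j : exists q : rat, `|ratr q - x i j| < N.+1%:R^-1.
    have N0 : 0 < N.+1%:R^-1 :> R by rewrite invr_gt0.
    have xN : x i j < x i j + N.+1%:R^-1 by rewrite ltrDl.
    have [q] := rat_in_itvoo xN.
    rewrite in_itv/= => /andP[xq qx]; exists q.
    by rewrite gtr0_norm ?subr_gt0// ltrBlDl.
  exists (\matrix_(i, j) projT1 (cid (q_ i j)), N) => /=; last first.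
    by move=> i j /=; rewrite mxE; case: cid.
  move=> y By; apply: xeA; split=> // i j; have := By i j.
  rewrite /= mxE; case: cid => q /= qx qy.
  rewrite /ball/= (splitr e).
  rewrite (le_lt_trans (ler_distD (ratr q) _ _))//.
  by rewrite ltrD// ?(lt_trans _ Ne)// distrC.
rewrite AE preimage_bigcup bigcup_mkcond.
apply: countable_bigcupT_measurable => // c; case: ifPn => // _.
rewrite (_ : _ @^-1` _ = \bigcap_(ij in [set: 'I_m * 'I_n])
    ((fun x => f x ij.1 ij.2) @^-1` [set y | `|ratr (c.1 ij.1 ij.2) - y| < c.2.+1%:R^-1])); last first.
  by apply/seteqP; split=> [x /= fx [i j] _ /=|x /= fx i j]; [exact: fx|exact: (fx (i, j))].
apply: fin_bigcap_measurable => // -[i j] _ /=.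
rewrite -[X in measurable X]setTI; apply: (mf i j) => //.
rewrite (_ : [set y | _] = ball (ratr (c.1 i j) : R) c.2.+1%:R^-1)//.
by apply: open_measurable; exact: ball_open.
Qed.

End borel_matrix.

Section lebesgue_box.
Context {R : realType}.

Definition cons_rV d (p : measurableTypeR R * 'rV[R]_d) : 'rV[R]_(1 + d) :=
  row_mx (p.1)%:M p.2.

Definition uncons_rV d (v : 'rV[R]_(1 + d)) : measurableTypeR R * 'rV[R]_d :=
  (lsubmx v 0 0, rsubmx v).

Lemma cons_rV_l d p : @cons_rV d p 0 (lshift d 0) = p.1.
Proof. by rewrite /cons_rV row_mxEl mxE eqxx. Qed.

Lemma cons_rV_r d p j : @cons_rV d p 0 (rshift 1 j) = p.2 0 j.
Proof. by rewrite /cons_rV row_mxEr. Qed.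

Lemma uncons_rVK d : cancel (@uncons_rV d) (@cons_rV d).
Proof.
move=> v; rewrite /cons_rV/= -[RHS]hsubmxK; congr row_mx.
by rewrite -mx11_scalar.
Qed.

Lemma cons_rVK d : cancel (@cons_rV d) (@uncons_rV d).
Proof.
by move=> [x v]; rewrite /uncons_rV /cons_rV/= row_mxKl row_mxKr mxE eqxx.
Qed.

Lemma measurable_cons_rV d : measurable_fun setT (@cons_rV d).
Proof.
apply/measurable_fun_mxP => i j; rewrite /cons_rV ord1.
case: (splitP j) => k jk.
  have -> : j = lshift d k by exact/val_inj.
  rewrite (_ : (fun _ => _) = fst); first exact: measurable_fst.
  by apply/funext => -[x v] /=; rewrite row_mxEl [k]ord1 mxE eqxx.
have -> : j = rshift 1 k by exact/val_inj.
rewrite (_ : (fun _ => _) = (fun v : 'rV[R]_d => v 0 k) \o snd).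
  exact: measurableT_comp (measurable_coord _ _) measurable_snd.
by apply/funext => -[x v] /=; rewrite row_mxEr.
Qed.

Lemma measurable_uncons_rV d : measurable_fun setT (@uncons_rV d).
Proof.
apply/measurable_fun_pairP; split => /=.
  rewrite (_ : _ \o _ = fun v : 'rV[R]_(1 + d) => v 0 (lshift d 0)).
    exact: measurable_coord.
  by apply/funext => v /=; rewrite mxE.
apply/measurable_fun_mxP => i j.
rewrite (_ : (fun _ => _) = fun v : 'rV[R]_(1 + d) => v i (rshift 1 j)).
  exact: measurable_coord.
by apply/funext => v /=; rewrite mxE.
Qed.

Section step.
Local Open Scope ereal_scope.
Context (d : nat) (mu : {sigma_finite_measure set 'rV[R]_d -> \bar R}).

Definition lebesgue_step : set 'rV[R]_(1 + d) -> \bar R :=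
  pushforward (lebesgue_measure \x mu) (@cons_rV d).

Let mcons A : measurable A -> measurable (@cons_rV d @^-1` A).
Proof.
by move=> mA; rewrite -[X in measurable X]setTI; exact: measurable_cons_rV.
Qed.

Let lebesgue_step0 : lebesgue_step set0 = 0.
Proof. by rewrite /lebesgue_step /pushforward preimage_set0 measure0. Qed.

Let lebesgue_step_ge0 A : 0 <= lebesgue_step A.
Proof. by rewrite /lebesgue_step /pushforward; apply: measure_ge0. Qed.

Let lebesgue_step_sigma_additive : semi_sigma_additive lebesgue_step.
Proof.
move=> F mF tF mUF; rewrite /lebesgue_step /pushforward preimage_bigcup.
apply: measure_semi_sigma_additive.
- by move=> n; exact: mcons.
- apply/trivIsetP => /= i j _ _ ij; rewrite -preimage_setI.
  by move/trivIsetP : tF => /(_ _ _ _ _ ij) ->//; rewrite preimage_set0.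
- by rewrite -preimage_bigcup; exact: mcons.
Qed.

HB.instance Definition _ := isMeasure.Build _ _ _ lebesgue_step
  lebesgue_step0 lebesgue_step_ge0 lebesgue_step_sigma_additive.

Let lebesgue_step_sigma_finite : sigma_finite setT lebesgue_step.
Proof.
have /sigma_finiteP[F [TF ndF Foo]] := sigma_finiteT (@lebesgue_measure R).
have /sigma_finiteP[G [TG ndG Goo]] := sigma_finiteT mu.
exists (fun n => @uncons_rV d @^-1` (F n `*` G n)).
  apply/seteqP; split=> // v _; rewrite -preimage_bigcup /=.
  have [n _ Fn] : (\bigcup_i F i) (uncons_rV v).1 by rewrite -TF.
  have [k _ Gk] : (\bigcup_i G i) (uncons_rV v).2 by rewrite -TG.
  exists (maxn n k) => //; split.
    by move: Fn; exact/subsetPset/ndF/leq_maxl.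
  by move: Gk; exact/subsetPset/ndG/leq_maxr.
move=> n; have [? ?] := Foo n; have [? ?] := Goo n; split.
  rewrite -[X in measurable X]setTI; apply: measurable_uncons_rV => //.
  exact: measurableX.
rewrite /lebesgue_step /pushforward (_ : _ @^-1` _ = F n `*` G n); last first.
  rewrite -comp_preimage (_ : _ \o _ = id)//.
  by apply/funext => y; exact: cons_rVK.
by rewrite product_measure1E// lte_mul_pinfty// ge0_fin_numE.
Qed.

HB.instance Definition _ :=
  Measure_isSigmaFinite.Build _ _ _ lebesgue_step lebesgue_step_sigma_finite.

End step.

(* Lebesgue measure on R^d: the product measure on R * R^(d-1), carried over
   to row vectors; R^0 is a point of mass 1. *)
Fixpoint lebesgue_rV d : {sigma_finite_measure set 'rV[R]_d -> \bar R} :=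
  if d is d'.+1 then lebesgue_step (lebesgue_rV d') else \d_(0 : 'rV[R]_0).

(* The norm of 'rV[R]_d is the sup norm. *)
Definition box d (alpha : R) : set 'rV[R]_d := [set x : 'rV[R]_d | `|x| <= alpha].
Arguments box : clear implicits.

Lemma box_coord d (alpha : R) (x : 'rV[R]_d) : 0 <= alpha ->
  box d alpha x <-> forall j, `|x 0 j| <= alpha.
Proof.
move=> a0; rewrite /box/= /Num.norm/= mx_normrE; split=> [/bigmax_leP[_ xa] j|xa].
  exact: (xa (0, j)).
by apply/bigmax_leP; split=> // -[i j] _ /=; rewrite (ord1 i); exact: xa.
Qed.

Lemma measurable_box d alpha : measurable (box d alpha).
Proof.
apply: measurable_mx_closed.
rewrite (_ : box _ _ = (fun x : 'rV[R]_d => `|x|) @^-1` [set y | y <= alpha])//.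
apply: closed_comp; last exact: closed_le.
by move=> x _; exact: norm_continuous.
Qed.

Lemma lebesgue_rV_box d (alpha : R) : 0 <= alpha ->
  lebesgue_rV d (box d alpha) = ((2 * alpha) ^+ d)%:E.
Proof.
move=> a0; elim: d => [|d IH].
  by rewrite /= diracE mem_set// /box/= normr0.
rewrite /= /lebesgue_step /pushforward.
rewrite (_ : _ @^-1` _ = `[- alpha, alpha]%classic `*` box d alpha).
  rewrite product_measure1E//; last exact: measurable_box.
  have itvE : @lebesgue_measure R `[- alpha, alpha]%classic = (2 * alpha)%:E.
    rewrite lebesgue_measure_itv/= lte_fin; have [aa|aa] := ltP (- alpha) alpha.
      by rewrite -EFinD opprK mulr_natl mulr2n.
    by rewrite (_ : alpha = 0) ?mulr0//; apply/eqP; rewrite eq_le a0 andbT;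
       rewrite -oppr_ge0 (le_trans _ aa).
  by rewrite exprS EFinM; exact: (f_equal2 mule itvE IH).
apply/seteqP; split=> -[x v] /=.
  move=> /(@box_coord d.+1 _ _ a0) xv; split.
    have := xv (@lshift 1 d 0).
    by rewrite [X in `|X|](cons_rV_l (x, v)) in_itv/= -ler_norml.
  apply/box_coord => // j; have := xv (@rshift 1 d j).
  by rewrite [X in `|X|](cons_rV_r (x, v)).
rewrite in_itv/= -ler_norml => -[xa /(box_coord _ a0) va].
apply/(@box_coord d.+1 _ _ a0) => j.
case: (@splitP 1 d j) => k jk.
  have -> : j = @lshift 1 d 0 by apply/val_inj; rewrite /= jk [k]ord1.
  by rewrite [X in `|X|](cons_rV_l (x, v)).
have -> : j = @rshift 1 d k by exact/val_inj.
by rewrite [X in `|X|](cons_rV_r (x, v)); exact: va.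
Qed.

Let ge0_inv_box d alpha : (0 <= (fine (lebesgue_rV d (box d alpha)))^-1)%R.
Proof. by rewrite invr_ge0 fine_ge0. Qed.

(* U(B) for B = box d alpha: normalised restriction of Lebesgue measure. *)
Definition uniform_box d alpha : set 'rV[R]_d -> \bar R :=
  mscale (NngNum (@ge0_inv_box d alpha))
    (mrestr (lebesgue_rV d) (@measurable_box d alpha)).
Arguments uniform_box : clear implicits.

HB.instance Definition _ d alpha := Measure.on (uniform_box d alpha).

Lemma uniform_boxT d (alpha : R) : 0 < alpha ->
  uniform_box d alpha setT = 1%E.
Proof.
move=> a0; rewrite /uniform_box /mscale/= /mrestr/= setTI lebesgue_rV_box ?ltW//.
by rewrite -EFinM mulVf// gt_eqF// exprn_gt0// mulr_gt0.
Qed.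

End lebesgue_box.

Arguments box {R} d alpha.
Arguments uniform_box {R} d alpha.

Section euclidean.
Context {R : realType} {d : nat}.
Implicit Types (x y : 'rV[R]_d) (h : 'rV[R]_d -> R) (A : set 'rV[R]_d).

Definition dotv x y : R := \sum_i x 0 i * y 0 i.

Definition norm2 x : R := Num.sqrt (\sum_i x 0 i ^+ 2).

Definition grad h x : 'rV[R]_d := \row_i 'D_(delta_mx 0 i) h x.

(* Takes the value +oo on the empty set. *)
Definition dist2 x A : \bar R := ereal_inf [set (norm2 (x - y))%:E | y in A].

Definition convex_hull A : set 'rV[R]_d :=
  smallest (@convex_set R 'rV[R]_d) A.

Definition clarke h x : set 'rV[R]_d :=
  convex_hull [set v | exists xs : nat -> 'rV[R]_d,
    [/\ xs @ \oo --> x, forall k, differentiable h (xs k) &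
        grad h (xs k) @[k --> \oo] --> v]].

Definition smoothing (alpha : R) h x : R :=
  \int[uniform_box d alpha]_(u in setT) h (x + u).

End euclidean.

Section probability.
Context {dO : measure_display} {O : measurableType dO} {R : realType}.
Context (P : probability O R).
Local Open Scope ereal_scope.

Definition same_law {d' : measure_display} {T : measurableType d'}
    (X Y : {RV P >-> T}) : Prop :=
  forall A, measurable A -> distribution P X A = distribution P Y A.

Definition uniform_on (V : {fset R}) (X : O -> R) : Prop :=
  V != fset0 /\
  forall v, P (X @^-1` [set v]) = ((v \in V)%:R / #|` V|%:R)%:E.

(* Mutual independence of the set systems listed in Gs. *)
Definition independent (Gs : seq (set (set O))) : Prop :=
  forall (J : {set 'I_(size Gs)}) (A : 'I_(size Gs) -> set O),
    (forall i, i \in J -> (nth set0 Gs i) (A i)) ->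
    P (\bigcap_(i in [set` J]) A i) = \prod_(i in J) P (A i).

Definition measurable_wrt (G : set (set O)) {d' : measure_display}
    {T : measurableType d'} (X : O -> T) : Prop :=
  g_sigma_algebra_preimage X `<=` G.

(* Y is a version of E[X | G]; to be used for a sub-sigma-algebra G and an X
   that is nonnegative or integrable. *)
Definition is_cond_exp (G : set (set O)) (X Y : O -> \bar R) : Prop :=
  measurable_wrt G Y /\
  forall A, G A -> \int[P]_(o in A) Y o = \int[P]_(o in A) X o.

Definition is_cond_exp_rV (G : set (set O)) {d : nat} (X Y : O -> 'rV[R]_d) : Prop :=
  forall j, P.-integrable setT (fun o => (X o 0 j)%:E) /\
    is_cond_exp G (fun o => (X o 0 j)%:E) (fun o => (Y o 0 j)%:E).

End probability.

(* G_k is [current k] and F_k is [past k]. Iterations are numbered from 1: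
   the index 0 of every sequence is unused and [past 0] is trivial. *)
Section filtrations.
Context {dO : measure_display} {O : measurableType dO} {R : realType}.
Context {P : probability O R} {d n s M : nat}.
Variables (u : nat -> {RV P >-> 'rV[R]_d}).
Variables (xis : nat -> 'I_M -> {RV P >-> 'rV[R]_n}).
Variables (bs : nat -> 'I_M -> {RV P >-> 'rV[R]_s}).
Variables (psi : nat -> {RV P >-> R}) (e : nat -> {RV P >-> 'rV[R]_d}).

Definition current (k : nat) : set (set O) :=
  <<s g_sigma_algebra_preimage (u k) `|`
      \bigcup_i g_sigma_algebra_preimage (xis k i) `|`
      \bigcup_i g_sigma_algebra_preimage (bs k i) `|`
      g_sigma_algebra_preimage (psi k) >>.

Definition past (k : nat) : set (set O) :=
  <<s \bigcup_(j in [set j | (1 <= j <= k)%N])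
        (current j `|` g_sigma_algebra_preimage (e j)) >>.

End filtrations.

(* Main.v *)
Require Import Defs.
From HB Require Import structures.
From mathcomp Require Import all_boot all_order all_algebra finmap.
From mathcomp Require Import all_classical all_reals all_analysis.
From mathcomp Require Import measurable_realfun ring lra.

(** The quantity [X k = alpha k ^+ d * smoothing (alpha k) f (w k)] is an almost
    supermartingale, and the proof reads off from it that the weighted squares
    of the gradients are summable.

    Two properties of the smoothing are used. First, [alpha ^+ d * smoothing
    alpha f w] is, up to the factor [2 ^+ d], the integral of [f] over the cube
    of radius [alpha] about [w]; as [f] is nonnegative, it grows with [alpha]
    ([smoothing_scaled_le]). Replacing [alpha k] by the smaller [alpha k.+1] thus
    only decreases [X], which explains the weights [alpha k ^+ d] in the
    hypotheses on the step sizes. Second, the smoothing satisfies Taylor's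
    formula of order one with a remainder bounded by a multiple of
    [`|v| ^+ 2 / alpha] ([smoothing_quadratic]).

    Insert the update into Taylor's formula and take the mean given the past.
    The arithmetic error is centred. The drawn samples have, jointly with the
    past, the law of the generic samples, so the gradient error hypotheses apply
    to them ([sample_exchange]). The random factor [psi k] differs from
    [PsiU k] by at most a multiple of [eta k / alpha k], so trading one for the
    other costs as much as the second order terms. The result
    ([iteration_descent]) is, for constants [c, C > 0],
[[
  E[X k.+1 | past] + c * alpha k ^+ d * eta k * norm2 (gradient) ^+ 2
    <= X k + C * alpha k ^+ d.-1 * eta k ^+ 2.
]]
    Integrated over the event [X k0 <= N] of the past and summed over
    [k >= k0], this bounds the integral of the series of weighted squared
    gradients on that event; letting [N] grow, the series converges almost
    surely ([almost_sure_summability]). The weights [alpha k ^+ d * eta k] have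
    an infinite sum, so the gradients are arbitrarily small at arbitrarily late
    times, which gives the subsequence ([stationary_subsequence]).

    It remains to see that an accumulation point [ws] is stationary
    ([clarke_stationary]). If the Clarke subdifferential at [ws] stayed away from
    [0], some vector [v] would have a scalar product at least [del > 0] with all
    limits of gradients of [f] at points tending to [ws] ([convex_separation]),
    hence at least [del / 2] with the gradient of [f] at every point of
    differentiability near [ws] ([separated_near]). By Rademacher's theorem
    ([rademacher]) the gradient of the smoothing is the mean of the gradient of
    [f] over a cube, so it too would have a scalar product at least [del / 2]
    with [v] ([grad_smoothing_ge]), and could not tend to [0].

    Rademacher's theorem is itself derived from the smoothness of averages over
    rectangles. Directional derivatives exist almost everywhere by the case of
    one variable ([lip1_ae_derivable]) and Fubini's theorem. Their integral over
    a box is a directional derivative of an average of [f], hence linear in the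
    direction ([integral_dirder]); since boxes determine a function up to a null
    set, the derivatives themselves are linear in the direction almost
    everywhere. *)

Set Implicit Arguments.
Unset Strict Implicit.
Unset Printing Implicit Defensive.

Import Order.TTheory GRing.Theory Num.Theory.
Import numFieldNormedType.Exports.

Local Open Scope classical_set_scope.
Local Open Scope ring_scope.

(** * Scalar product, Euclidean norm and sup norm *)

Lemma coord_le_norm {R : realType} m (v : 'rV[R]_m) i : `|v 0 i| <= `|v|.
Proof. by have [+ _] := @box_coord R m `|v| v (normr_ge0 v); apply; exact: lexx. Qed.

Section euclidean.
Context {R : realType} {d : nat}.
Local Notation V := 'rV[R]_d.
Implicit Types (x y z : V).

Lemma norm_delta_mx i : `|delta_mx 0 i : V| <= 1.
Proof.
rewrite /Num.norm/= mx_normrE; apply/bigmax_leP; split=> // -[a b] _ /=.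
by rewrite mxE; case: (_ && _); rewrite ?normr1 ?normr0.
Qed.

Lemma dotvZ_delta (s : R) i (x : V) : dotv (s *: delta_mx 0 i) x = s * x 0 i.
Proof.
rewrite /dotv (bigD1 i)//= big1 ?addr0; last first.
  by move=> j ji; rewrite !mxE (negbTE ji) andbF mulr0 mul0r.
by rewrite !mxE !eqxx mulr1.
Qed.

Lemma dotv_delta i (x : V) : dotv (delta_mx 0 i) x = x 0 i.
Proof. by rewrite -[X in dotv X]scale1r dotvZ_delta mul1r. Qed.

Lemma dotvZl (t : R) (v x : V) : dotv (t *: v) x = t * dotv v x.
Proof. by rewrite /dotv mulr_sumr; apply: eq_bigr => i _; rewrite mxE mulrA. Qed.

Lemma dotvC x y : dotv x y = dotv y x.
Proof. by apply: eq_bigr => i _; rewrite mulrC. Qed.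

Lemma dotvDl x y z : dotv (x + y) z = dotv x z + dotv y z.
Proof. by rewrite /dotv -big_split; apply: eq_bigr => i _; rewrite !mxE mulrDl. Qed.

Lemma dotvBl (x z D : V) : dotv (x - z) D = dotv x D - dotv z D.
Proof. by rewrite /dotv -sumrB; apply: eq_bigr => i _; rewrite !mxE mulrBl. Qed.

Lemma dotv_le (x D : V) : `|dotv x D| <= d%:R * `|D| * `|x|.
Proof.
rewrite (le_trans (ler_norm_sum _ _ _))//.
apply: (@le_trans _ _ (\sum_(i < d) (`|D| * `|x|))).
  by apply: ler_sum => i _; rewrite normrM mulrC ler_pM// coord_le_norm.
by rewrite sumr_const card_ord -[_ *+ d]mulr_natl -mulrA.
Qed.

Lemma norm2_ge0 x : 0 <= norm2 x.
Proof. exact: sqrtr_ge0. Qed.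

Lemma norm2_sqr x : norm2 x ^+ 2 = dotv x x.
Proof.
rewrite /norm2 sqr_sqrtr; first by apply: eq_bigr => i _; rewrite expr2.
by apply: sumr_ge0 => i _; rewrite sqr_ge0.
Qed.

Lemma norm2N x : norm2 (- x) = norm2 x.
Proof. by congr Num.sqrt; apply: eq_bigr => i _; rewrite mxE sqrrN. Qed.

Lemma norm_le_norm2 x : `|x| <= norm2 x.
Proof.
rewrite {1}/Num.norm/= mx_normrE; apply/bigmax_leP; split; first exact: norm2_ge0.
move=> [a i] _ /=; rewrite (ord1 a) -ler_sqr ?nnegrE ?norm2_ge0// norm2_sqr real_normK ?num_real//.
rewrite /dotv (bigD1 i)//= -expr2 lerDl sumr_ge0// => j _.
by rewrite -expr2 sqr_ge0.
Qed.

Lemma dotvv_le x : dotv x x <= d%:R * `|x| ^+ 2.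
Proof. by rewrite (le_trans (ler_norm _))// (le_trans (dotv_le _ _))// expr2 mulrA. Qed.

Lemma norm2_le x : norm2 x <= d%:R * `|x|.
Proof.
rewrite -ler_sqr ?nnegrE ?norm2_ge0 ?mulr_ge0// norm2_sqr (le_trans (dotvv_le x))//.
rewrite exprMn ler_wpM2r ?sqr_ge0// -natrX ler_nat.
by move: (d) => [//|n]; rewrite expnS expn1 leq_pmulr.
Qed.

Lemma norm2D_sqr x y : norm2 (x + y) ^+ 2 <= 2 * norm2 x ^+ 2 + 2 * norm2 y ^+ 2.
Proof.
rewrite !norm2_sqr /dotv !mulr_sumr -big_split; apply: ler_sum => i _; rewrite !mxE.
have := sqr_ge0 (x 0 i - y 0 i); rewrite expr2 /=; lra.
Qed.

Lemma norm2Z_sqr (c : R) x : norm2 (c *: x) ^+ 2 = c ^+ 2 * norm2 x ^+ 2.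
Proof. by rewrite !norm2_sqr dotvZl dotvC dotvZl mulrA expr2. Qed.

(** The variance of the [a i] is nonnegative. *)
Lemma sqr_avg M (a : 'I_M -> R) : (0 < M)%N ->
  (M%:R^-1 * \sum_i a i) ^+ 2 <= M%:R^-1 * \sum_i a i ^+ 2.
Proof.
move=> M0; have M0' : 0 < M%:R :> R by rewrite ltr0n.
set s := M%:R^-1 * _.
have S : \sum_i a i = M%:R * s by rewrite /s mulVKf ?gt_eqF.
have : 0 <= \sum_i (a i - s) ^+ 2 by apply: sumr_ge0 => i _; exact: sqr_ge0.
have -> : \sum_i (a i - s) ^+ 2 = \sum_i a i ^+ 2 - M%:R * s ^+ 2.
  rewrite (eq_bigr (fun i => a i ^+ 2 - 2 * s * a i + s ^+ 2)); last by move=> i _; ring.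
  rewrite !big_split/= sumrN -mulr_sumr S sumr_const card_ord -[_ *+ M]mulr_natl; ring.
by rewrite subr_ge0 -ler_pdivlMl.
Qed.

Lemma norm2_avg M (z : 'I_M -> V) : (0 < M)%N ->
  norm2 (M%:R^-1 *: \sum_i z i) ^+ 2 <= M%:R^-1 * \sum_i norm2 (z i) ^+ 2.
Proof.
move=> M0; rewrite norm2_sqr (eq_bigr _ (fun i _ => norm2_sqr (z i))).
rewrite /dotv exchange_big mulr_sumr; apply: ler_sum => j _.
rewrite -expr2 mxE summxE (le_trans (sqr_avg _ M0))//.
Qed.

Lemma measurable_norm2_sqr : measurable_fun setT (fun x : V => norm2 x ^+ 2).
Proof.
under eq_fun do rewrite norm2_sqr.
by apply: measurable_sum => i; apply: measurable_funM; exact: measurable_coord.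
Qed.

End euclidean.

(** * Averages over segments and rectangles *)

Section translation1.
Context {R : realType}.
Local Notation mu := (@lebesgue_measure R).

Let shiftR (s : R) : measurableTypeR R -> measurableTypeR R := fun t => t + s.

Let measurable_shiftR s : measurable_fun setT (shiftR s).
Proof. by apply: measurable_funD. Qed.

(** A measure on the line is determined by its values on half-open intervals. *)
Lemma lebesgue_measure_shift (s : R) (A : set (measurableTypeR R)) :
  measurable A -> mu [set t | A (t + s)] = mu A.
Proof.
move=> mA; rewrite (_ : [set _ | _] = shiftR s @^-1` A)//.
have -> : mu (shiftR s @^-1` A) = pushforward mu (shiftR s) A by [].
apply/esym; apply: (@lebesgue_measure_unique _ (pushforward mu (shiftR s))) => // _ [[a b] _ <-] /=.
rewrite /pushforward (_ : _ @^-1` _ = `]a - s, b - s]%classic).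
  rewrite !lebesgue_measure_itv/= !lte_fin ltrD2r; case: ifP => // _.
  by rewrite -!EFinB; congr EFin; ring.
by apply/seteqP; split=> t /=; rewrite !in_itv/= /shiftR ltrBlDr lerBrDr.
Qed.

Lemma Rintegral_shift (g : R -> R) (a b s : R) : continuous g ->
  \int[mu]_(t in `[a, b]) g (t + s) = \int[mu]_(t in `[a + s, b + s]) g t.
Proof.
move=> cg; rewrite /Rintegral; congr fine.
have mg : measurable_fun setT (EFin \o g : measurableTypeR R -> \bar R).
  by apply/measurable_EFinP; exact: continuous_measurable_fun.
have ab : shiftR s @^-1` `[a + s, b + s]%classic = `[a, b]%classic.
  by apply/seteqP; split=> t /=; rewrite !in_itv/= /shiftR !lerD2r.
have := @integral_pushforward _ _ _ _ R _ (measurable_shiftR s) mu `[a + s, b + s]%classic _ mg.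
rewrite ab => <- //.
  by apply: eq_measure_integral => A mA _; exact: lebesgue_measure_shift.
apply: continuous_compact_integrable; first exact: segment_compact.
apply: continuous_subspaceT => t; apply: continuous_comp; last exact: cg.
by apply: cvgD; [exact: cvg_id|exact: cvg_cst].
Qed.

End translation1.

Section bounded_integrable.
Context {R : realType} d (T : measurableType d) (m : {measure set T -> \bar R}).
Implicit Types (A : set T) (g : T -> R).

Lemma bounded_integrable A g C : measurable A -> (m A < +oo)%E ->
  measurable_fun A g -> (forall x, A x -> `|g x| <= C) ->
  m.-integrable A (EFin \o g).
Proof.
move=> mA Aoo mg gC; apply: measurable_bounded_integrable => //.
by exists C; split; [rewrite num_real|move=> M CM x /gC /le_trans; apply; exact: ltW].
Qed.

Lemma Rintegral_indic A g :
  \int[m]_t (\1_A t * g t) = \int[m]_(t in A) g t.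
Proof.
rewrite [RHS]Rintegral_mkcond; apply: eq_Rintegral => t _.
by rewrite patchE indicE; case: ifP => _; rewrite ?mul1r ?mul0r.
Qed.

End bounded_integrable.

Section fubini_bounded.
Context {R : realType} d1 d2 (T1 : measurableType d1) (T2 : measurableType d2).
Context (m1 : {sigma_finite_measure set T1 -> \bar R}).
Context (m2 : {sigma_finite_measure set T2 -> \bar R}).
Variables (A : set T1) (B : set T2) (g : T1 * T2 -> R) (C : R).
Hypotheses (mA : measurable A) (mB : measurable B).
Hypotheses (Aoo : (m1 A < +oo)%E) (Boo : (m2 B < +oo)%E).
Hypotheses (mg : measurable_fun setT g).
Hypotheses (gC : forall x y, A x -> B y -> `|g (x, y)| <= C).

Let F (p : T1 * T2) : R := \1_(A `*` B) p * g p.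

Let mAB : measurable (A `*` B). Proof. exact: measurableX. Qed.

Let iAB : (m1 \x m2)%E.-integrable (A `*` B) (EFin \o g).
Proof.
apply: (@bounded_integrable _ _ _ _ _ _ C) => //.
- suff : ((m1 \x m2) (A `*` B) < +oo)%E by [].
  rewrite product_measure1E//; apply: lte_mul_pinfty => //.
  by rewrite ge0_fin_numE.
- exact: measurable_funS mg.
- by move=> [x y] [/= Ax By]; exact: gC.
Qed.

Let iF : (m1 \x m2)%E.-integrable setT (EFin \o F).
Proof.
move: iAB => /(integrable_mkcond _ mAB); apply: eq_integrable => // p _.
rewrite patchE /= /F indicE; case: ifPn => _; by rewrite ?mul1r ?mul0r.
Qed.

Let ig1 x : A x -> m2.-integrable B (EFin \o (fun y => g (x, y))).
Proof.
move=> Ax; apply: (@bounded_integrable _ _ _ _ _ _ C) => // [|y]; last exact: gC.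
by apply: measurable_funTS; apply: measurableT_comp mg _; exact: measurable_pair1.
Qed.

Let ig2 y : B y -> m1.-integrable A (EFin \o (fun x => g (x, y))).
Proof.
move=> By; apply: (@bounded_integrable _ _ _ _ _ _ C) => // [|x Ax]; last exact: gC.
by apply: measurable_funTS; apply: measurableT_comp mg _; exact: measurable_pair2.
Qed.

Let FE x y : F (x, y) = \1_A x * (\1_B y * g (x, y)).
Proof. by rewrite /F !indicE in_setX/= mulrA -natrM mulnb. Qed.

Lemma Rintegral_setX1 :
  \int[(m1 \x m2)%E]_(p in A `*` B) g p =
  \int[m1]_(x in A) \int[m2]_(y in B) g (x, y).
Proof.
rewrite -Rintegral_indic /Rintegral -(integral12_prod_meas1 iF)/=.
rewrite -[RHS]/(\int[m1]_(x in A) _) -Rintegral_indic; congr fine.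
apply: eq_integral => x _; rewrite /fubini_F.
under eq_integral do rewrite /= FE.
rewrite [\1_A x]indicE; have [xB|_] := boolP (x \in A); last first.
  by rewrite mul0r integral0_eq// => z _; rewrite mul0r.
rewrite mul1r fineK; last by apply: integrable_fin_num => //; apply: ig1; rewrite inE in xB.
rewrite [RHS]integral_mkcond; apply: eq_integral => y _.
by rewrite mul1r patchE indicE; case: ifPn; rewrite ?mul1r ?mul0r.
Qed.

Lemma Rintegral_setX2 :
  \int[(m1 \x m2)%E]_(p in A `*` B) g p =
  \int[m2]_(y in B) \int[m1]_(x in A) g (x, y).
Proof.
rewrite -Rintegral_indic /Rintegral -(integral21_prod_meas1 iF)/=.
rewrite -[RHS]/(\int[m2]_(x in B) _) -Rintegral_indic; congr fine.
apply: eq_integral => y _; rewrite /fubini_G.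
under eq_integral do rewrite /= FE mulrCA.
rewrite [\1_B y]indicE; have [yB|_] := boolP (y \in B); last first.
  by rewrite mul0r integral0_eq// => z _; rewrite mul0r.
rewrite mul1r fineK; last by apply: integrable_fin_num => //; apply: ig2; rewrite inE in yB.
rewrite [RHS]integral_mkcond; apply: eq_integral => x _.
by rewrite mul1r patchE indicE; case: ifPn; rewrite ?mul1r ?mul0r.
Qed.

End fubini_bounded.

Section slide.
Context {R : realType} {d : nat}.
Local Notation mu := (@lebesgue_measure R).
Local Notation V := 'rV[R]_d.
Implicit Types (h : V -> R) (w e : V) (r s K : R).

Definition lip K h := forall x y, `|h x - h y| <= K * `|x - y|.

Lemma lip_continuous K h : lip K h -> continuous h.
Proof.
move=> hK x; apply: ((@cvgrPdist_lt _ R^o _ (nbhs x) _ h (h x)).2) => eps eps0.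
have K1 : 0 < `|K| + 1 by rewrite ltr_wpDl.
near=> y.
rewrite (le_lt_trans (hK x y))//.
rewrite (@le_lt_trans _ _ ((`|K| + 1) * `|x - y|))//.
  by rewrite ler_wpM2r// ler_wpDr// ler_norm.
rewrite mulrC -ltr_pdivlMr//.
near: y; have := @cvg_id _ (nbhs x) => /cvgrPdist_lt; apply.
by rewrite divr_gt0.
Unshelve. all: by end_near. Qed.

Lemma lip_measurable K h : lip K h -> measurable_fun setT h.
Proof. by move=> /lip_continuous; exact: continuous_mx_measurable. Qed.

(** An unnormalised moving average in the direction [e]. The average over a
    rectangle is a composition of such averages, one for each axis. *)
Definition slide r e h : V -> R :=
  fun w => \int[mu]_(t in `[- r, r]) h (w + t *: e).

Lemma continuous_line w e : continuous (fun t : R => w + t *: e).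
Proof. by move=> t; apply: cvgD; [exact: cvg_cst|apply: cvgZl; exact: cvg_id]. Qed.

Lemma lip_line_integrable K h w e a b : lip K h ->
  mu.-integrable `[a, b] (EFin \o (fun t => h (w + t *: e))).
Proof.
move=> hK; apply: continuous_compact_integrable; first exact: segment_compact.
apply: continuous_subspaceT => t.
by apply: continuous_comp; [exact: continuous_line|exact: lip_continuous hK _].
Qed.

Lemma lebesgue_Rint_cst a b (c : R) : a <= b ->
  \int[mu]_(t in `[a, b]) c = c * (b - a).
Proof.
move=> ab; rewrite Rintegral_cst//; congr (_ * _).
have muE : mu `[a, b]%classic = (b - a)%:E.
  rewrite lebesgue_measure_itv/= lte_fin.
  by case: ltgtP ab => // -> _; rewrite subrr.
exact: (congr1 fine muE).
Qed.

Lemma slide_lip K r e h : 0 <= r -> lip K h -> lip (2 * r * K) (slide r e h).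
Proof.
move=> r0 hK x y; rewrite /slide -RintegralB//; try exact: lip_line_integrable hK.
have i1 := lip_line_integrable x e (- r) r hK.
have i2 := lip_line_integrable y e (- r) r hK.
have i3 : mu.-integrable `[- r, r] (EFin \o (fun t => h (x + t *: e) - h (y + t *: e))).
  by have := integrableB _ i1 i2; apply.
apply: (le_trans (le_normr_Rintegral _ i3)) => //.
apply: (@le_trans _ _ (\int[mu]_(t in `[- r, r]) (K * `|x - y|))).
  apply: le_Rintegral => //.
  - by have := integrable_norm i3.
  - apply: continuous_compact_integrable; first exact: segment_compact.
    by apply: continuous_subspaceT => ?; exact: cvg_cst.
  - move=> t _; rewrite (le_trans (hK _ _))//.
    by rewrite opprD addrACA subrr addr0.
by rewrite lebesgue_Rint_cst ?ge0_cp//; lra.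
Qed.

Lemma lebesgue_itv_lty a b : (mu `[a, b]%classic < +oo)%E.
Proof. by rewrite lebesgue_measure_itv/=; case: ifP => _; rewrite ?ltry// -EFinB ltry. Qed.

Lemma lip_line_dist K h w e r t : lip K h -> `|t| <= r ->
  `|h (w + t *: e)| <= `|h w| + `|K| * (`|r| * `|e|).
Proof.
move=> hK tr; rewrite -[X in `|X|](subrK (h w)) (le_trans (ler_normD _ _))//.
rewrite addrC lerD2l (le_trans (hK _ _))// addrC addKr normrZ.
rewrite (@le_trans _ _ (`|K| * (`|t| * `|e|)))//.
  by rewrite ler_wpM2r ?ler_norm// mulr_ge0.
by rewrite ler_wpM2l// ler_wpM2r// (le_trans tr)// ler_norm.
Qed.

(** Fubini's theorem on a rectangle, where a Lipschitz function is bounded. *)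
Lemma slide_comm K r r' e e' h : 0 <= r -> lip K h ->
  slide r e (slide r' e' h) = slide r' e' (slide r e h).
Proof.
move=> r0 hK; apply/funext => w.
pose g (p : measurableTypeR R * measurableTypeR R) : R := h (w + p.1 *: e + p.2 *: e').
pose C := `|h w| + `|K| * (`|r| * `|e|) + `|K| * (`|r'| * `|e'|).
have mg : measurable_fun setT g.
  apply: (@measurableT_comp _ _ _ _ _ _ h); first exact: lip_measurable hK.
  apply/measurable_fun_mxP => i j.
  under eq_fun do rewrite !mxE.
  apply: measurable_funD; first apply: measurable_funD; first exact: measurable_cst.
    by apply: measurable_funM; [exact: measurable_fst|exact: measurable_cst].
  by apply: measurable_funM; [exact: measurable_snd|exact: measurable_cst].
have gC t s : `[- r, r]%classic t -> `[- r', r']%classic s -> `|g (t, s)| <= C.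
  rewrite /= !in_itv/= -!ler_norml => tr sr.
  by rewrite (le_trans (lip_line_dist _ _ hK sr))// lerD2r; exact: lip_line_dist hK tr.
have m1 : measurable (`[- r, r]%classic : set (measurableTypeR R)) by exact: measurable_itv.
have m2 : measurable (`[- r', r']%classic : set (measurableTypeR R)) by exact: measurable_itv.
have E1 := Rintegral_setX1 m1 m2 (lebesgue_itv_lty (- r) r) (lebesgue_itv_lty (- r') r') mg gC.
have E2 := Rintegral_setX2 m1 m2 (lebesgue_itv_lty (- r) r) (lebesgue_itv_lty (- r') r') mg gC.
have := E2; rewrite E1 /g /= => E.
rewrite /slide E; apply: eq_Rintegral => s _; apply: eq_Rintegral => t _.
by rewrite addrAC.
Qed.

(** Moving the segment by [s] along its own direction adds a segment of length
    [s] at one end and removes one at the other end; on each of them [h] differs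
    from its value at the end of the old segment by at most [K * s]. *)
Lemma slide_expand K r e h w s : 0 <= r -> 0 <= K -> `|e| <= 1 -> lip K h ->
  `|slide r e h (w + s *: e) - slide r e h w
    - s * (h (w + r *: e) - h (w - r *: e))| <= 4 * K * s ^+ 2.
Proof.
move=> r0 K0 e1 hK.
have hK' x y : `|h (x + y *: e) - h x| <= K * `|y|.
  rewrite (le_trans (hK _ _))// addrC addKr normrZ.
  by rewrite ler_wpM2l// ler_piMr.
suff pos x t : 0 <= t -> `|slide r e h (x + t *: e) - slide r e h x
    - t * (h (x + r *: e) - h (x - r *: e))| <= 2 * K * t ^+ 2.
  have [/(pos w)|s0] := leP 0 s.
    by move=> /le_trans; apply; rewrite ler_wpM2r ?sqr_ge0// ler_wpM2r// ler_nat.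
  have s0' : 0 <= - s by rewrite oppr_ge0 ltW.
  have := pos (w + s *: e) _ s0'; rewrite scaleNr addrK sqrrN.
  have := hK' (w + r *: e) s; have := hK' (w - r *: e) s.
  rewrite (addrAC w (r *: e)) (addrAC w (- (r *: e))) (ltr0_norm s0) !ler_norml.
  move=> /andP[? ?] /andP[? ?] /andP[? ?]; apply/andP; split; nra.
(* from here on the shift is nonnegative *)
move=> {}s0 {w s}; move: x t s0 => w s s0.
pose g t := h (w + t *: e).
have gK t t' : `|g t - g t'| <= K * `|t - t'|.
  rewrite (le_trans (hK _ _))// opprD addrACA subrr add0r -scalerBl normrZ.
  by rewrite ler_wpM2l// ler_piMr.
have cg : continuous g.
  by move=> t; apply: continuous_comp; [exact: continuous_line|exact: lip_continuous hK _].
have ig a b : mu.-integrable `[a, b] (EFin \o g) by exact: lip_line_integrable hK.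
have -> : slide r e h (w + s *: e) = \int[mu]_(t in `[- r + s, r + s]) g t.
  rewrite -Rintegral_shift// /slide; apply: eq_Rintegral => t _.
  by rewrite /g -addrA -scalerDl (addrC s).
rewrite -[slide r e h w]/(\int[mu]_(t in `[- r, r]) g t).
have ic a b (c : R) : mu.-integrable `[a, b] (EFin \o (fun=> c)).
  apply: continuous_compact_integrable; first exact: segment_compact.
  by apply: continuous_subspaceT => ?; exact: cvg_cst.
have bnd a : `|\int[mu]_(t in `[a, a + s]) g t - s * g a| <= K * s ^+ 2.
  have as_ : a <= a + s by rewrite lerDl.
  have -> : s * g a = \int[mu]_(t in `[a, a + s]) g a.
    by rewrite lebesgue_Rint_cst// addrC addKr mulrC.
  rewrite -RintegralB//; try solve [exact: ig|exact: ic].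
  have i3 : mu.-integrable `[a, a + s] (EFin \o (fun t => g t - g a)).
    by have := integrableB _ (ig a (a + s)) (ic a (a + s) (g a)); apply.
  apply: (le_trans (le_normr_Rintegral _ i3)) => //.
  apply: (@le_trans _ _ (\int[mu]_(t in `[a, a + s]) (K * s))).
    apply: le_Rintegral => //; first by have := integrable_norm i3.
    move=> t /=; rewrite in_itv/= => /andP[ta tas]; rewrite (le_trans (gK _ _))//.
    by rewrite ler_wpM2l// ger0_norm ?subr_ge0// lerBlDl.
  by rewrite lebesgue_Rint_cst// addrAC subrr add0r -mulrA.
have split a b c : a <= b -> b <= c -> \int[mu]_(t in `[a, c]) g t =
   \int[mu]_(t in `[a, b]) g t + \int[mu]_(t in `[b, c]) g t.
  move=> ab bc; apply/eqP; rewrite addrC -subr_eq; apply/eqP.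
  rewrite Rintegral_itvB//; try exact: ig; rewrite ?bnd_simp//.
  rewrite Rintegral_itv_obnd_cbnd//; apply: integrableS (ig b c) => //.
  by apply: subset_itvr; rewrite bnd_simp.
have r2 : - r <= r by rewrite ge0_cp.
have rs : - r <= - r + s by rewrite lerDl.
have rrs : - r + s <= r + s by rewrite lerD2r.
have rs' : r <= r + s by rewrite lerDl.
have := split _ _ _ r2 rs'; rewrite (split _ _ _ rs rrs) => E.
have := bnd r; have := bnd (- r); rewrite /g scaleNr.
rewrite !ler_norml => /andP[? ?] /andP[? ?]; apply/andP; split; nra.
Qed.

Definition slides (ls : seq (R * V)) h := foldr (fun p => slide p.1 p.2) h ls.

Lemma slides_lip K rho ls h : 0 <= rho -> 0 <= K -> all (fun p => 0 <= p.1 <= rho) ls ->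
  lip K h -> lip ((2 * rho) ^+ size ls * K) (slides ls h).
Proof.
move=> rho0 K0 + hK; elim: ls => [_|p ls IH /= /andP[/andP[p0 prho] /IH lsK]].
  by rewrite expr0 mul1r.
move=> x y; rewrite (le_trans (slide_lip _ p0 lsK _ _))// ler_wpM2r//.
rewrite exprS -!mulrA ler_wpM2l// ler_wpM2r// mulr_ge0// exprn_ge0//.
by rewrite mulr_ge0.
Qed.

(** Slides commute, so any of them may be taken as the outermost one. This
    isolates one coordinate of an average over a rectangle. *)
Lemma slides_rem K ls p h : 0 <= K -> all (fun p => 0 <= p.1) ls -> lip K h -> p \in ls ->
  slides ls h = slide p.1 p.2 (slides (rem p ls) h).
Proof.
move=> K0 + hK; elim: ls => // q ls IH /= /andP[q0 ls0].
rewrite inE eq_sym; case: eqVneq => [->//|_ /= pls].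
rewrite (IH ls0 pls).
have [rho rho0 lsrho] : exists2 rho, 0 <= rho & all (fun p => 0 <= p.1 <= rho) (rem p ls).
  have : all (fun p : R * V => 0 <= p.1) (rem p ls).
    by apply/allP => x /mem_rem; exact: (allP ls0).
  elim: (rem p ls) => [_|x l IHl /= /andP[x0 /IHl[rho rho0 lrho]]]; first by exists 0.
  exists (Num.max rho x.1); rewrite ?le_max ?rho0// x0 lexx orbT/=.
  by apply/allP => z /(allP lrho)/andP[-> zr]; rewrite le_max zr.
exact: slide_comm q0 (slides_lip rho0 K0 lsrho hK).
Qed.

(** The coordinates are changed one after the other. The partial derivative
    [G i] is then read at an intermediate point, which costs [K] times the
    distance already covered. *)
Lemma quadratic_expansion K K' h (G : 'I_d -> V -> R) w v : 0 <= K -> 0 <= K' ->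
  (forall i, lip K (G i)) ->
  (forall i x s, `|h (x + s *: delta_mx 0 i) - h x - s * G i x| <= K' * s ^+ 2) ->
  `|h (w + v) - h w - \sum_i v 0 i * G i w| <= d%:R * (d%:R * K + K') * `|v| ^+ 2.
Proof.
move=> K0 K'0 GK hG.
have vi i : `|v 0 i| <= `|v| by exact: coord_le_norm.
pose pv (s : seq 'I_d) : V := \sum_(i <- s) v 0 i *: delta_mx 0 i.
have pv_le (s : seq _) : `|pv s| <= (size s)%:R * `|v|.
  elim: s => [|i s IH]; rewrite /pv ?big_nil ?big_cons ?normr0 ?mul0r//.
  rewrite (le_trans (ler_normD _ _))// /= -natr1 mulrDl mul1r addrC lerD//.
  by rewrite normrZ -(mulr1 `|v|) ler_pM ?norm_delta_mx.
suff H (s : seq _) : `|h (w + pv s) - h w - \sum_(i <- s) v 0 i * G i w| <=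
    (size s)%:R * ((size s)%:R * K + K') * `|v| ^+ 2.
  have := H (index_enum 'I_d); rewrite /pv -row_sum_delta.
  by rewrite -[index_enum _]enumT size_enum_ord.
elim: s => [|i s IH].
  by rewrite /pv !big_nil addr0 !subrr normr0 !mul0r.
rewrite /pv !big_cons -/(pv s) (addrC _ (pv s)) addrA /=.
have GKi : `|G i (w + pv s) - G i w| <= K * `|pv s|.
  by have := GK i (w + pv s) w; rewrite (addrAC w) subrr add0r.
have := hG i (w + pv s) (v 0 i).
set n : R := (size s)%:R.
have n0 : 0 <= n by rewrite /n ler0n.
have b2 : `|v 0 i| ^+ 2 <= `|v| ^+ 2 by rewrite ler_sqr ?nnegrE.
rewrite -natr1 -/n -(real_normK (num_real (v 0 i))).
move=> hGi; set S := \sum_(j <- s) _ in IH *.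
have GK2 : `|v 0 i * (G i (w + pv s) - G i w)| <= n * K * `|v| ^+ 2.
  have GKn : `|G i (w + pv s) - G i w| <= n * K * `|v|.
    by rewrite (le_trans GKi)// (mulrC n) -mulrA ler_wpM2l// pv_le.
  rewrite normrM (_ : n * K * _ = `|v| * (n * K * `|v|)); last by ring.
  exact: ler_pM.
have {}hGi := le_trans hGi (ler_wpM2l K'0 b2).
set a := h _ in hGi *; set b := h (w + pv s) in IH hGi.
have -> : a - h w - (v 0 i * G i w + S) =
   (a - b - v 0 i * G i (w + pv s)) + (v 0 i * (G i (w + pv s) - G i w)) + (b - h w - S) by ring.
rewrite (le_trans (ler_normD _ _))// (le_trans (lerD (le_trans (ler_normD _ _) (lerD hGi GK2)) IH))//.
have : 0 <= K * `|v| ^+ 2 by rewrite mulr_ge0// sqr_ge0.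
have : 0 <= n * (K * `|v| ^+ 2) by rewrite !mulr_ge0// sqr_ge0.
lra.
Qed.

End slide.

Section rect.
Context {R : realType}.

Definition rect m (r : 'I_m -> R) : set 'rV[R]_m := [set u | forall i, `|u 0 i| <= r i].

Lemma measurable_rect m (r : 'I_m -> R) : measurable (rect r).
Proof.
rewrite (_ : rect r = \bigcap_(i in [set: 'I_m]) ((fun u : 'rV_m => u 0 i) @^-1` `[- r i, r i])).
  apply: fin_bigcap_measurable => // i _; rewrite -[X in measurable X]setTI.
  by apply: measurable_coord => //; exact: measurable_itv.
apply/seteqP; split=> u; first by move=> ru i _ /=; rewrite in_itv/= -ler_norml.
by move=> ru i; have := ru i I; rewrite /= in_itv/= -ler_norml.
Qed.

Lemma lebesgue_rV_rect_lty m (r : 'I_m -> R) : (lebesgue_rV m (rect r) < +oo)%E.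
Proof.
pose rho := \sum_i `|r i|; have rho0 : 0 <= rho by exact: sumr_ge0.
apply: (@le_lt_trans _ _ (lebesgue_rV m (box m rho))).
  apply: le_measure; rewrite ?inE; [exact: measurable_rect|exact: measurable_box|].
  move=> u ru; apply/box_coord => // i; rewrite (le_trans (ru i))//.
  rewrite (le_trans (ler_norm _))// /rho (bigD1 i)//= lerDl; exact: sumr_ge0.
by rewrite lebesgue_rV_box// ltry.
Qed.

Section embedded_rect.
Context {d m : nat} (K : R) (h : 'rV[R]_d -> R) (hK : lip K h).
Context (r : 'I_m -> R) (E : 'I_m -> 'rV[R]_d) (w : 'rV[R]_d).

Let H (u : 'rV[R]_m) := h (w + \sum_i u 0 i *: E i).

Lemma measurable_embedded : measurable_fun setT H.
Proof.
apply: (@measurableT_comp _ _ _ _ _ _ h); first exact: lip_measurable hK.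
apply/measurable_fun_mxP => i j.
under eq_fun do rewrite !mxE summxE.
apply: measurable_funD; first exact: measurable_cst.
apply: measurable_sum => k; under eq_fun do rewrite mxE.
by apply: measurable_funM; [exact: measurable_coord|exact: measurable_cst].
Qed.

Lemma embedded_bounded u : rect r u ->
  `|H u| <= `|h w| + `|K| * \sum_i r i * `|E i|.
Proof.
move=> ru; rewrite -[X in `|X|](subrK (h w)) (le_trans (ler_normD _ _))//.
rewrite addrC lerD2l (le_trans (hK _ _))// addrC addKr.
apply: (@le_trans _ _ (`|K| * `|\sum_i u 0 i *: E i|)).
  by rewrite ler_wpM2r ?ler_norm.
rewrite ler_wpM2l// (le_trans (ler_norm_sum _ _ _))// ler_sum// => i _.
by rewrite normrZ ler_wpM2r.
Qed.

Lemma integrable_embedded : (lebesgue_rV m).-integrable (rect r) (EFin \o H).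
Proof.
apply: (@bounded_integrable _ _ _ _ _ _ (`|h w| + `|K| * \sum_i r i * `|E i|)).
- exact: measurable_rect.
- exact: lebesgue_rV_rect_lty.
- exact: measurable_funTS measurable_embedded.
- exact: embedded_bounded.
Qed.

End embedded_rect.

Lemma rect_cons m (r : 'I_(1 + m) -> R) :
  @cons_rV R m @^-1` rect r =
  `[- r ord0, r ord0]%classic `*` rect (fun i => r (lift ord0 i)).
Proof.
have l0 : lshift m 0 = ord0 :> 'I_(1 + m) by exact: val_inj.
have rl i : rshift 1 i = lift ord0 i :> 'I_(1 + m) by exact: val_inj.
apply/seteqP; split=> -[x v] /=; rewrite in_itv/= -ler_norml.
  move=> xv; split; first by have := xv ord0; rewrite -l0 cons_rV_l.
  by move=> i; have := xv (lift ord0 i); rewrite -rl cons_rV_r.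
move=> [xr vr] i; case: (unliftP ord0 i) => [j|] ->.
  by rewrite -rl cons_rV_r rl; exact: vr.
by rewrite -l0 cons_rV_l l0.
Qed.

(** Induction on the number of directions: the first coordinate is split off by
    Fubini's theorem. *)
Lemma slides_rect d K m (r : 'I_m -> R) (E : 'I_m -> 'rV[R]_d) h w : lip K h ->
  slides [seq (r i, E i) | i <- enum 'I_m] h w =
  \int[lebesgue_rV m]_(u in rect r) h (w + \sum_i u 0 i *: E i).
Proof.
move=> hK; elim: m r E w => [|m IH] r E w.
  have -> : enum 'I_0 = [::] by apply/size0nil; rewrite size_enum_ord.
  rewrite /= /Rintegral integral_dirac; first last.
  - by apply/measurable_EFinP; apply: measurable_funTS; exact: measurable_embedded hK _ _.
  - exact: measurable_rect.
  rewrite diracE mem_set ?mul1e; last by move=> [].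
  by rewrite /= big_ord0 addr0.
rewrite enum_ordSl /= -map_comp.
rewrite /slide.
transitivity (\int[@lebesgue_measure R]_(t in `[- r ord0, r ord0])
  \int[lebesgue_rV m]_(u in rect (fun i => r (lift ord0 i)))
     h (w + t *: E ord0 + \sum_i u 0 i *: E (lift ord0 i))).
  by apply: eq_Rintegral => t _; rewrite IH.
pose H (u : 'rV[R]_m.+1) := h (w + \sum_i u 0 i *: E i).
have mH : measurable_fun setT H by exact: measurable_embedded hK _ _.
have HE x v : H (cons_rV (x, v)) = h (w + x *: E ord0 + \sum_i v 0 i *: E (lift ord0 i)).
  rewrite /H -addrA big_ord_recl.
  have l0 : lshift m 0 = ord0 :> 'I_(1 + m) by exact: val_inj.
  have rl i : rshift 1 i = lift ord0 i :> 'I_(1 + m) by exact: val_inj.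
  congr (h (w + (_ *: _ + _))); first by rewrite -l0 cons_rV_l.
  by apply: eq_bigr => i _; rewrite -rl cons_rV_r.
pose A : set (measurableTypeR R) := `[- r ord0, r ord0]%classic.
pose B := rect (fun i => r (lift ord0 i)).
have mA : measurable A by exact: measurable_itv.
have mB : measurable B by exact: measurable_rect.
have HB x y : A x -> B y -> `|(H \o @cons_rV R m) (x, y)| <= `|h w| + `|K| * \sum_i r i * `|E i|.
  move=> Ax By; apply: embedded_bounded => //.
  by have : (A `*` B) (x, y) by []; rewrite -rect_cons.
have mHc : measurable_fun setT (H \o @cons_rV R m).
  by apply: measurableT_comp mH _; exact: measurable_cons_rV.
have := Rintegral_setX1 mA mB (lebesgue_itv_lty _ _) (lebesgue_rV_rect_lty _) mHc HB.
rewrite /= => E1; transitivity (\int[(lebesgue_measure \x lebesgue_rV m)%E]_(p in A `*` B) H (cons_rV p)).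
  rewrite E1; apply: eq_Rintegral => x _; apply: eq_Rintegral => y _.
  by rewrite HE.
rewrite /Rintegral; congr fine.
have iH := @integrable_embedded d m.+1 K h hK r E w.
have mr := measurable_rect r.
have := @integral_pushforward _ _ _ _ R _ (@measurable_cons_rV R m) (lebesgue_measure \x lebesgue_rV m)%E (rect r) (EFin \o H) _ _ mr.
rewrite rect_cons => <-//; first exact/measurable_EFinP.
apply: (@bounded_integrable _ _ _ _ _ _ (`|h w| + `|K| * \sum_i r i * `|E i|)).
- exact: measurableX.
- suff : ((lebesgue_measure \x lebesgue_rV m) (A `*` B) < +oo)%E by [].
  rewrite product_measure1E//; apply: lte_mul_pinfty => //; last exact: lebesgue_rV_rect_lty.
  by rewrite ge0_fin_numE//; exact: lebesgue_itv_lty.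
- exact: measurable_funTS mHc.
- by move=> [x v] [Ax Bv]; exact: HB.
Qed.

End rect.

(** * Smoothing over a cube *)

Section rect_smoothing.
Context {R : realType} {d : nat}.
Local Notation V := 'rV[R]_d.
Implicit Types (h : V -> R) (g : V -> V) (r : 'I_d -> R).

(** Taylor's formula of order one. It determines [g] as the gradient of [h]
    ([quadratic_at_grad]). *)
Definition quadratic_at C h g := forall w v,
  `|h (w + v) - h w - dotv v (g w)| <= C * `|v| ^+ 2.

Lemma quadratic_at_quotient C h g w v t : quadratic_at C h g -> t != 0 ->
  `|t^-1 * (h (w + t *: v) - h w) - dotv v (g w)| <= C * `|v| ^+ 2 * `|t|.
Proof.
move=> hg t0; have := hg w (t *: v); rewrite dotvZl normrZ => H.
have -> : t^-1 * (h (w + t *: v) - h w) - dotv v (g w) =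
  t^-1 * (h (w + t *: v) - h w - t * dotv v (g w)) by rewrite [RHS]mulrBr mulKf.
rewrite normrM normfV mulrC ler_pdivrMr ?normr_gt0// (le_trans H)//.
by rewrite le_eqVlt (_ : C * _ = C * `|v| ^+ 2 * `|t| * `|t|) ?eqxx//; ring.
Qed.

Lemma quadratic_at_partial C h g w v : quadratic_at C h g ->
  (fun t => t^-1 *: (h (t *: v + w) - h w)) @ 0^' --> dotv v (g w).
Proof.
move=> hg; apply/cvgrPdist_le => eps eps0.
pose C1 := `|C * `|v| ^+ 2| + 1.
have C10 : 0 < C1 by rewrite ltr_wpDl.
near=> t.
have t0 : t != 0 by near: t; exact: nbhs_dnbhs_neq.
rewrite distrC addrC (addrC _ w); have := quadratic_at_quotient w v hg t0.
rewrite [_ - dotv _ _]addrC => /le_trans; apply.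
apply: (@le_trans _ _ (C1 * `|t|)).
  by rewrite ler_wpM2r// (le_trans (ler_norm _))// lerDl.
rewrite mulrC -ler_pdivlMr//; near: t.
apply: dnbhs0_le; exact: divr_gt0.
Unshelve. all: by end_near. Qed.

Lemma quadratic_at_grad C h g : quadratic_at C h g -> grad h = g.
Proof.
move=> hg; apply/funext => w; apply/rowP => i; rewrite /grad mxE -dotv_delta.
by apply/cvg_lim => //; exact: quadratic_at_partial hg.
Qed.

(** The directional derivative as a limit of a sequence, the form that dominated
    convergence applies to. *)
Lemma quadratic_at_derive C h g w v : quadratic_at C h g ->
  (fun n : nat => n.+1%:R * (h (w + n.+1%:R^-1 *: v) - h w)) @ \oo --> dotv v (g w).
Proof.
move=> hg; apply/cvgrPdist_le => eps eps0.
pose C1 := `|C * `|v| ^+ 2| + 1.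
have C10 : 0 < C1 by rewrite ltr_wpDl.
near=> n.
have n0 : n.+1%:R^-1 != 0 :> R by rewrite invr_neq0.
rewrite distrC; have := quadratic_at_quotient w v hg n0.
rewrite invrK => /le_trans; apply.
apply: (@le_trans _ _ (C1 * `|n.+1%:R^-1|)).
  by rewrite ler_wpM2r// (le_trans (ler_norm _))// lerDl.
rewrite mulrC -ler_pdivlMr// ger0_norm ?invr_ge0//.
by apply: ltW; near: n; exact: (near_infty_natSinv_lt (PosNum (divr_gt0 eps0 C10))).
Unshelve. all: by end_near. Qed.

Lemma quadratic_at_lip C K h g w i : quadratic_at C h g -> 0 <= K -> lip K h ->
  `|g w 0 i| <= K.
Proof.
move=> hg K0 hK; have := @quadratic_at_derive C h g w (delta_mx 0 i) hg.
rewrite dotv_delta => /cvg_norm /cvgr_to_le; apply.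
apply: nearW => n; rewrite normrM ger0_norm//.
rewrite mulrC -ler_pdivlMr// (le_trans (hK _ _))// addrC addKr normrZ.
rewrite ler_wpM2l// ger0_norm ?invr_ge0// ler_piMr ?invr_ge0//.
exact: norm_delta_mx.
Qed.

Definition rint r h : V -> R := fun w => \int[lebesgue_rV d]_(u in rect r) h (w + u).

Let dirs r := [seq (r i, delta_mx 0 i : V) | i <- enum 'I_d].

Lemma rintE K r h : lip K h -> rint r h = slides (dirs r) h.
Proof.
move=> hK; apply/funext => w; rewrite (slides_rect _ _ _ hK) /rint.
by apply: eq_Rintegral => u _; rewrite -row_sum_delta.
Qed.

Lemma rint_lip K rho r h : 0 <= K -> (forall i, 0 <= r i <= rho) -> 0 <= rho -> lip K h ->
  lip ((2 * rho) ^+ d * K) (rint r h).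
Proof.
move=> K0 r_rho rho0 hK; rewrite (rintE _ hK).
have := @slides_lip _ _ K rho (dirs r) h rho0 K0 _ hK.
rewrite size_map size_enum_ord; apply.
by apply/allP => _ /mapP[i _ ->] /=.
Qed.

(** Along the axis [i], the average over a rectangle is a slide of the average
    [T i] over the other axes. Its partial derivative is thus a difference of two
    values of [T i], and [T i] is Lipschitz. *)
Lemma rint_quadratic K rho r h : (0 < d)%N -> 0 <= K -> (forall i, 0 <= r i <= rho) -> 0 <= rho ->
  lip K h -> exists g,
    quadratic_at (d%:R * (2 * d%:R + 4) * ((2 * rho) ^+ d.-1 * K)) (rint r h) g /\
    forall i, lip (2 * ((2 * rho) ^+ d.-1 * K)) (fun w => g w 0 i).
Proof.
move=> d0 K0 r_rho rho0 hK.
pose T i := slides (rem (r i, delta_mx 0 i : V) (dirs r)) h.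
set L := (2 * rho) ^+ d.-1 * K.
have dirs_rho : all (fun p => 0 <= p.1 <= rho) (dirs r).
  by apply/allP => _ /mapP[i _ ->] /=.
have dirs_i i : (r i, delta_mx 0 i : V) \in dirs r.
  by apply: map_f; rewrite mem_enum.
have TL i : lip L (T i).
  rewrite /L; have := @slides_lip _ _ K rho (rem (r i, delta_mx 0 i : V) (dirs r)) h rho0 K0 _ hK.
  rewrite size_rem// size_map size_enum_ord; apply.
  by apply/allP => z /mem_rem /(allP dirs_rho).
have L0 : 0 <= L by rewrite mulr_ge0// exprn_ge0// mulr_ge0.
have rintT i : rint r h = slide (r i) (delta_mx 0 i) (T i).
  rewrite (rintE _ hK) (slides_rem K0 _ hK (dirs_i i))//.
  by apply: sub_all dirs_rho => p /andP[].
have diffL i : lip (2 * L) (fun w => T i (w + r i *: delta_mx 0 i) - T i (w - r i *: delta_mx 0 i)).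
  have shift (x y c : V) : x + c - (y + c) = x - y.
    by rewrite opprD addrACA subrr addr0.
  move=> x y; have := TL i (x + r i *: delta_mx 0 i) (y + r i *: delta_mx 0 i).
  have := TL i (x - r i *: delta_mx 0 i) (y - r i *: delta_mx 0 i).
  rewrite !shift.
  by rewrite !ler_norml => /andP[? ?] /andP[? ?]; apply/andP; split; lra.
exists (fun w => \row_i (T i (w + r i *: delta_mx 0 i) - T i (w - r i *: delta_mx 0 i))); split.
- move=> w v; rewrite /dotv.
  have := @quadratic_expansion _ _ (2 * L) (4 * L) (rint r h)
    (fun i w => T i (w + r i *: delta_mx 0 i) - T i (w - r i *: delta_mx 0 i)) w v _ _ _ _.
  rewrite (_ : \sum_i v 0 i * _ = \sum_i v 0 i * (\row_i (T i (w + r i *: delta_mx 0 i) - T i (w - r i *: delta_mx 0 i)) : V) 0 i); last first.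
    by apply: eq_bigr => i _; rewrite mxE.
  have -> : d%:R * (d%:R * (2 * L) + 4 * L) = d%:R * (2 * d%:R + 4) * L :> R by ring.
  apply; [exact: mulr_ge0|exact: mulr_ge0| |].
  + by move=> i; exact: diffL.
  + move=> i x s; rewrite (rintT i); apply: slide_expand => //; last exact: norm_delta_mx.
    by have /andP[] := r_rho i.
- by move=> i x y; rewrite !mxE; exact: diffL.
Qed.

Lemma integrable_rint K r h w : lip K h ->
  (lebesgue_rV d).-integrable (rect r) (EFin \o (fun u => h (w + u))).
Proof.
move=> hK; apply: eq_integrable (integrable_embedded hK r (fun i => delta_mx 0 i) w) => //.
  exact: measurable_rect.
by move=> u _; rewrite /= -row_sum_delta.
Qed.

End rect_smoothing.

Section smoothing.
Context {R : realType} {d : nat}.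
Local Notation V := 'rV[R]_d.
Implicit Types (h : V -> R).

Lemma ge0_integral_mrestr d' (T : measurableType d') (m : {measure set T -> \bar R}) (D : set T)
    (mD : measurable D) (k : T -> \bar R) :
  measurable_fun setT k -> (forall x, (0 <= k x)%E) ->
  (\int[mrestr m mD]_x k x = \int[m]_(x in D) k x)%E.
Proof.
move=> mk k0.
rewrite [LHS](@ge0_negligible_integral _ _ _ (mrestr m mD) setT (~` D))//; first last.
- rewrite -(measure0 m); have := setICl D; rewrite /mrestr => {1}<-.
  by [].
- exact: measurableC.
rewrite setTD setCK; apply: eq_measure_integral => A mA AD.
by rewrite -[in RHS](setIidl AD).
Qed.

Lemma box_rect (alpha : R) : 0 <= alpha -> box d alpha = rect (fun=> alpha).
Proof.
by move=> a0; apply/seteqP; split=> u; [move/(box_coord _ a0)|move=> ?; apply/box_coord].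
Qed.

Lemma smoothingE K (alpha : R) h w : 0 < alpha -> (forall x, 0 <= h x) -> lip K h ->
  smoothing alpha h w = ((2 * alpha) ^+ d)^-1 * rint (fun=> alpha) h w.
Proof.
move=> a0 h0 hK; rewrite /smoothing /rint /Rintegral.
have mh : measurable_fun setT (fun u => (h (w + u))%:E).
  apply/measurable_EFinP; apply: lip_measurable (_ : lip K _) => x y.
  by rewrite (le_trans (hK _ _))// opprD addrACA subrr add0r.
rewrite ge0_integral_mscale//=; first last.
- by move=> u _; rewrite lee_fin.
rewrite ge0_integral_mrestr//; last by move=> u; rewrite lee_fin.
rewrite fineM//; last first.
  rewrite box_rect ?ltW//; apply: integrable_fin_num; first exact: measurable_rect.
  exact: integrable_rint hK.
by rewrite lebesgue_rV_box ?ltW// box_rect ?ltW.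
Qed.

Section smoothing_nonneg_lip.
Variables (K : R) (h : V -> R).
Hypotheses (d0 : (0 < d)%N) (K0 : 0 <= K) (h0 : forall x, 0 <= h x) (hK : lip K h).

Lemma smoothing_ge0 alpha w : 0 <= smoothing alpha h w.
Proof. by apply: Rintegral_ge0. Qed.

Lemma smoothing_lip alpha : 0 < alpha -> lip K (smoothing alpha h).
Proof.
move=> a0 x y; rewrite !(smoothingE _ a0 h0 hK) -mulrBr normrM.
have c0 : 0 < (2 * alpha) ^+ d by rewrite exprn_gt0// mulr_gt0.
rewrite ger0_norm; last by rewrite invr_ge0 ltW.
rewrite ler_pdivrMl// mulrA.
have := @rint_lip _ d K alpha (fun=> alpha) h K0 _ (ltW a0) hK x y; apply => _.
by rewrite ltW/=.
Qed.

(** The bounds of [rint_quadratic], with [d.-1] factors [2 * alpha], divided by the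
    volume of the cube. *)
Lemma smoothing_quadratic alpha : 0 < alpha ->
  quadratic_at (d%:R * (d%:R + 2) * K / alpha) (smoothing alpha h) (grad (smoothing alpha h))
  /\ forall i, lip (K / alpha) (fun w => grad (smoothing alpha h) w 0 i).
Proof.
move=> a0.
have [|g [gq gl]] := @rint_quadratic _ d K alpha (fun=> alpha) h d0 K0 _ (ltW a0) hK.
  by move=> _; rewrite ltW/=.
pose c := ((2 * alpha) ^+ d)^-1.
have c0 : 0 <= c by rewrite invr_ge0 exprn_ge0// mulr_ge0// ltW.
have cK : c * (2 * ((2 * alpha) ^+ d.-1 * K)) = K / alpha.
  rewrite /c -[X in _ ^+ X](prednK d0) exprS.
  by field; rewrite expf_neq0 ?mulf_neq0 ?gt_eqF.
have sq : quadratic_at (d%:R * (d%:R + 2) * K / alpha) (smoothing alpha h) (fun w => c *: g w).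
  move=> w v; rewrite !(smoothingE _ a0 h0 hK).
  have -> : dotv v (c *: g w) = c * dotv v (g w).
    by rewrite /dotv mulr_sumr; apply: eq_bigr => i _; rewrite mxE mulrCA.
  rewrite -!mulrBr normrM (ger0_norm c0).
  apply: (le_trans (ler_wpM2l c0 (gq w v))).
  rewrite -[_ * K / alpha]mulrA -cK.
  by rewrite le_eqVlt; apply/orP; left; apply/eqP; ring.
rewrite (quadratic_at_grad sq); split=> // i x y.
rewrite !mxE -mulrBr normrM (ger0_norm c0) -cK -mulrA ler_wpM2l//.
exact: gl.
Qed.

Lemma grad_smoothing_le alpha w i : 0 < alpha -> `|grad (smoothing alpha h) w 0 i| <= K.
Proof.
move=> a0; have [q _] := smoothing_quadratic a0.
exact: quadratic_at_lip q K0 (smoothing_lip a0).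
Qed.

(** Multiplied by [alpha ^+ d], the mean over a cube becomes the integral over it
    up to a constant, and [h] is nonnegative. *)
Lemma smoothing_scaled_le beta alpha w : 0 < beta -> beta <= alpha ->
  beta ^+ d * smoothing beta h w <= alpha ^+ d * smoothing alpha h w.
Proof.
move=> b0 ba; have a0 := lt_le_trans b0 ba.
have E r : 0 < r -> r ^+ d * smoothing r h w = (2 ^+ d)^-1 * rint (fun=> r) h w.
  move=> r0; rewrite (smoothingE _ r0 h0 hK) exprMn invfM mulrA.
  by rewrite [r ^+ d * _]mulrCA mulfV ?mulr1// expf_neq0// gt_eqF.
rewrite !E// ler_wpM2l ?invr_ge0 ?exprn_ge0//.
have mh r : measurable_fun (rect r) (fun u => (h (w + u))%:E).
  by apply: measurable_int (integrable_rint r w hK).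
have fin r : (\int[lebesgue_rV d]_(x in rect (fun=> r)) (h (w + x))%:E)%E \is a fin_num.
  by apply: integrable_fin_num; [exact: measurable_rect|exact: integrable_rint hK].
apply: fine_le; [exact: fin|exact: fin|].
apply: ge0_subset_integral => //; try exact: measurable_rect.
- by move=> u _; rewrite lee_fin.
- by move=> u ub i; exact: le_trans (ub i) ba.
Qed.

End smoothing_nonneg_lip.

End smoothing.

(** * Lipschitz functions of one variable *)

Section lipschitz_line.
Context {R : realType}.
Local Notation mu := (@lebesgue_measure R).
Implicit Types (g phi : R -> R) (K : R).

Lemma continuous_cumulative phi : {homo phi : x y / x <= y} -> continuous phi ->
  exists F : cumulative R R, forall x, F x = phi x.
Proof.
move=> nd cphi.
have rc : right_continuous phi by exact: right_continuousW.
pose F : cumulative R R := HB.pack phi (isCumulative.Build R _ R phi nd rc).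
by exists F.
Qed.

Lemma lebesgue_stieltjes_itvoc (F : cumulative R R) a b : a <= b ->
  lebesgue_stieltjes_measure F `]a, b]%classic = (F b - F a)%:E.
Proof.
move=> ab; rewrite /lebesgue_stieltjes_measure /measure_extension/=.
rewrite measurable_mu_extE/=; last exact: is_ocitv.
by rewrite wlength_itv_bnd.
Qed.

Definition lip1 K g := forall x y, `|g x - g y| <= K * `|x - y|.

Lemma lip1_continuous K g : lip1 K g -> continuous g.
Proof.
move=> gK x; apply/cvgrPdist_le => eps eps0.
have K1 : 0 < `|K| + 1 by rewrite ltr_wpDl.
near=> y; rewrite (le_trans (gK x y))//.
apply: (@le_trans _ _ ((`|K| + 1) * `|x - y|)).
  by rewrite ler_wpM2r// ler_wpDr// ler_norm.
rewrite mulrC -ler_pdivlMr//; near: y.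
by apply: cvgr_dist_le; [exact: cvg_id|rewrite divr_gt0].
Unshelve. all: by end_near. Qed.

(** The Stieltjes measures of [K * x + g x] and [K * x - g x] add up to [2 * K]
    times Lebesgue measure. *)
Lemma lip1_stieltjes_dominated K g (F : cumulative R R) :
  lip1 K g -> (forall x, F x = K * x + g x) ->
  forall A : set (measurableTypeR R), measurable A -> mu A = 0%E -> lebesgue_stieltjes_measure F A = 0%E.
Proof.
move=> gK FE.
have K0 : 0 <= K.
  have := gK 1 0; rewrite subr0 normr1 mulr1; exact: le_trans.
have lin x y : x <= y -> `|g y - g x| <= K * (y - x).
  by move=> xy; have := gK y x; rewrite (ger0_norm (_ : 0 <= y - x)) ?subr_ge0.
have [F' F'E] : exists F' : cumulative R R, forall x, F' x = K * x - g x.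
  apply: continuous_cumulative => [x y xy|x].
    by have := lin _ _ xy; rewrite ler_norml => /andP[? ?]; lra.
  apply: cvgB; last exact: lip1_continuous gK x.
  by apply: cvgMr; exact: cvg_id.
have [G GE] : exists G : cumulative R R, forall x, G x = 2 * K * x.
  apply: continuous_cumulative => [x y xy|x]; first by rewrite ler_wpM2l// mulr_ge0.
  by apply: cvgMr; exact: cvg_id.
have addE A : measure_add (lebesgue_stieltjes_measure F) (lebesgue_stieltjes_measure F') A =
    (lebesgue_stieltjes_measure F A + lebesgue_stieltjes_measure F' A)%E.
  exact: measure_addE.
have H1 A : measurable A -> lebesgue_stieltjes_measure G A =
  measure_add (lebesgue_stieltjes_measure F) (lebesgue_stieltjes_measure F') A.
  apply: lebesgue_stieltjes_measure_unique => _ [[a b] _ <-] /=.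
  have [ab|ba] := leP a b; last first.
    by rewrite set_itv_ge ?measure0// -leNgt bnd_simp ltW.
  apply: (etrans _ (esym (addE _))).
  apply: (etrans (lebesgue_stieltjes_itvoc G ab)).
  apply: (etrans _ (esym (f_equal2 adde (lebesgue_stieltjes_itvoc F ab) (lebesgue_stieltjes_itvoc F' ab)))).
  transitivity ((F b - F a + (F' b - F' a))%:E); last by [].
  by rewrite !GE !FE !F'E; congr EFin; ring.
have K20 : 0 <= 2 * K by rewrite mulr_ge0.
have H2 A : measurable A -> lebesgue_stieltjes_measure G A = mscale (NngNum K20) mu A.
  apply: lebesgue_stieltjes_measure_unique => _ [[a b] _ <-] /=.
  have [ab|ba] := leP a b; last first.
    by rewrite set_itv_ge ?measure0// -leNgt bnd_simp ltW.
  apply: (etrans (lebesgue_stieltjes_itvoc G ab)).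
  apply: (etrans _ (esym (f_equal2 mule erefl (lebesgue_stieltjes_itvoc idfun ab)))).
  transitivity ((2 * K * (b - a))%:E); last by [].
  by rewrite !GE -mulrBr.
move=> A mA A0; apply/eqP; rewrite eq_le measure_ge0 andbT.
have := etrans (esym (H1 A mA)) (H2 A mA).
rewrite [X in X = _]addE /mscale/= A0 mule0 => <-.
by rewrite leeDl.
Qed.

(** The function [K * x + g x] is nondecreasing and its Stieltjes measure is
    absolutely continuous, so on bounded intervals it is the integral of a
    density and is derivable almost everywhere. *)
Lemma lip1_ae_derivable K g : lip1 K g -> {ae mu, forall x, derivable g x 1}.
Proof.
move=> gK.
have K0 : 0 <= K.
  have := gK 1 0; rewrite subr0 normr1 mulr1; exact: le_trans.
have cg := lip1_continuous gK.
have [F FE] : exists F : cumulative R R, forall x, F x = K * x + g x.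
  apply: continuous_cumulative => [x y xy|x].
    have := gK y x; rewrite (ger0_norm (_ : 0 <= y - x)) ?subr_ge0//.
    by rewrite ler_norml => /andP[? ?]; lra.
  apply: cvgD; last exact: cg.
  by apply: cvgMr; exact: cvg_id.
suff H n : {ae mu, forall x, - n%:R < x < n%:R -> derivable g x 1}.
  have := ae_foralln H; apply: filterS => x /(_ (Num.bound `|x|)); apply.
  by rewrite -ltr_norml; exact: archi_boundP.
have [->|n0] := posnP n.
  by apply: aeW => x; rewrite oppr0 => /andP[/lt_trans /[apply]]; rewrite ltxx.
pose D : set (measurableTypeR R) := `]- n%:R, n%:R]%classic.
have mD : measurable D by exact: measurable_itv.
have nn : - n%:R <= n%:R :> R by rewrite ge0_cp.
have Doo : (lebesgue_stieltjes_measure F D < +oo)%E.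
  by rewrite lebesgue_stieltjes_itvoc// ltry.
pose nu := mfrestr mD Doo.
have nu_mu : nu `<< mu.
  apply/null_content_dominatesP => A mA A0.
  rewrite /nu /mfrestr /mrestr/=; apply: (lip1_stieltjes_dominated gK FE).
    exact: measurableI.
  by apply/eqP; rewrite eq_le measure_ge0 andbT -A0 le_measure ?inE//; exact: measurableI.
have [f [f0 ffin fi nuE]] := radon_nikodym_sigma_finite nu_mu.
have fineE : EFin \o (fine \o f) = f by apply/funext => x /=; rewrite fineK.
have fi' : mu.-integrable setT (EFin \o (fine \o f)) by rewrite fineE.
pose a : itv_bound R := BRight (- n%:R).
have floc : locally_integrable [set: R] (fine \o f).
  by apply: open_integrable_locally; [exact: openT|exact: fi'].
have fint y : mu.-integrable [set` Interval a (BRight y)] (EFin \o (fine \o f)).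
  by apply: (integrableS measurableT) fi' => //; exact: measurable_itv.
have := FTC1 fint floc.
apply: filterS; first exact: (ae_filter_ringOfSetsType mu).
move=> x /= + /andP[nx xn].
have ax : (a < BRight x)%O by rewrite /a bnd_simp.
move=> /(_ ax)[dx _].
set Fint := (X in derivable X x 1) in dx.
have near_g : \forall y \near x, K * y + g y - F (- n%:R) = Fint y.
  near=> y.
  have ny : - n%:R <= y by apply: ltW; near: y; exact: lt_nbhsr.
  have yn : y <= n%:R by apply: ltW; near: y; exact: lt_nbhsl.
  rewrite -FE; apply: EFin_inj; rewrite -lebesgue_stieltjes_itvoc//.
  rewrite /Fint /Rintegral fineK; last first.
    by apply: integrable_fin_num; [exact: measurable_itv|exact: fint].
  have mA : measurable (`]- n%:R, y]%classic : set (measurableTypeR R)) by exact: measurable_itv.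
  transitivity (integral mu `]- n%:R, y]%classic f); last first.
    by apply: eq_integral => t _; rewrite /= fineK.
  apply: (etrans _ (nuE _ mA)).
  rewrite /nu /mfrestr /mrestr.
  rewrite /D /=; congr (lebesgue_stieltjes_measure F _); apply/esym/setIidl => z /=.
  by rewrite !in_itv/= => /andP[-> /le_trans]; apply.
have d1 : derivable (fun y => K * y + g y - F (- n%:R)) x 1.
  apply: near_eq_derivable dx; near=> y; apply/esym; near: y; exact: near_g.
have -> : g = (fun y => (K * y + g y - F (- n%:R)) - (K * y - F (- n%:R))).
  by apply/funext => y; ring.
apply: derivableB; first exact: d1.
by apply: derivableB => //; apply: derivableM.
Unshelve. all: by end_near. Qed.

End lipschitz_line.

(** * Translation invariance of Lebesgue measure *)

Section translation.
Context {R : realType}.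
Local Notation mu := (@lebesgue_measure R).

Lemma ge0_integral_lebesgue_shift (s : R) (k : measurableTypeR R -> \bar R) :
  measurable_fun setT k -> (forall x, (0 <= k x)%E) ->
  (\int[mu]_t k (t + s)%R = \int[mu]_t k t)%E.
Proof.
move=> mk k0.
have ms : measurable_fun setT ((fun t => t + s) : measurableTypeR R -> measurableTypeR R).
  exact: measurable_funD.
have := ge0_integral_pushforward ms mu measurableT mk (fun x _ => k0 x).
rewrite preimage_setT => <-.
by apply: eq_measure_integral => A mA _; exact: lebesgue_measure_shift.
Qed.

Lemma cons_rVD d (p q : measurableTypeR R * 'rV[R]_d) :
  cons_rV p + cons_rV q = cons_rV (p.1 + q.1, p.2 + q.2).
Proof. by rewrite /cons_rV add_row_mx -raddfD. Qed.

(** Induction on the dimension, through the sections of the product measure. *)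
Lemma lebesgue_rV_shift d (v : 'rV[R]_d) (A : set 'rV[R]_d) : measurable A ->
  lebesgue_rV d [set u | A (u + v)] = lebesgue_rV d A.
Proof.
elim: d v A => [|d IH] v A mA.
  by congr (lebesgue_rV 0 _); apply/seteqP; split=> u /=; rewrite [v]thinmx0 addr0.
rewrite /= /lebesgue_step /pushforward.
set S := cons_rV (d:=d) @^-1` A.
pose x0 : R := (uncons_rV (v : 'rV_(1 + d))).1; pose v' : 'rV[R]_d := (uncons_rV (v : 'rV_(1 + d))).2.
have mS : measurable S.
  by rewrite -[S]setTI; exact: measurable_cons_rV.
have SE : cons_rV (d:=d) @^-1` [set u | A (u + v)] = [set p | S (p.1 + x0, p.2 + v')].
  have vE : v = cons_rV (x0, v') by rewrite -[LHS](uncons_rVK (v : 'rV_(1 + d))).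
  have E x y : cons_rV (x, y) + v = cons_rV (x + x0, y + v') by rewrite vE cons_rVD.
  by apply/seteqP; split=> -[x y] /=; rewrite /S /= E.
rewrite SE /product_measure1 /=.
pose k (x : measurableTypeR R) := lebesgue_rV d (xsection S x).
have mk : measurable_fun setT k by exact: measurable_fun_xsection.
rewrite -(ge0_integral_lebesgue_shift x0 mk)//; apply: eq_integral => x _.
apply: (etrans _ (IH v' _ (measurable_xsection (x + x0) mS))).
congr (lebesgue_rV d _); apply/seteqP; split=> y /=; rewrite /xsection/= !inE//=.
Qed.

(** All the translates of [N] by [t *: v] have the measure of [N], which is therefore
    the measure of the set of pairs [(t, y)] with [y + t *: v] in [N] and [t] in
    [0, 1]. Integrating over [t] first gives [0]. *)
Lemma lebesgue_rV_line_null d (v : 'rV[R]_d) (N : set 'rV[R]_d) : measurable N ->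
  (forall y, mu [set t | N (y + t *: v)] = 0%E) -> lebesgue_rV d N = 0%E.
Proof.
move=> mN N0.
pose line (p : measurableTypeR R * 'rV[R]_d) : 'rV[R]_d := p.2 + p.1 *: v.
have mline : measurable_fun setT line.
  apply/measurable_fun_mxP => i j; under eq_fun do rewrite !mxE.
  apply: measurable_funD.
    exact: measurableT_comp (measurable_coord _ _) measurable_snd.
  by apply: measurable_funM; [exact: measurable_fst|exact: measurable_cst].
pose I : set (measurableTypeR R) := `[0, 1]%classic.
have mI : measurable I by exact: measurable_itv.
pose S := (line @^-1` N) `&` (I `*` setT).
have mS : measurable S.
  apply: measurableI; last exact: measurableX.
  by rewrite -[_ @^-1` _]setTI; exact: mline.
have mNy y : measurable [set t : measurableTypeR R | N (y + t *: v)].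
  rewrite -[X in measurable X]setTI.
  apply: (measurableT_comp mline (pair2_measurable y)) => //.
have I1 : mu I = 1%E by rewrite lebesgue_measure_itv/= lte_fin ltr01 oppr0 adde0.
have E1 : (mu \x lebesgue_rV d)%E S = lebesgue_rV d N.
  rewrite /product_measure1/=.
  transitivity (\int[mu]_x ((\1_I x)%:E * lebesgue_rV d N))%E.
    apply: eq_integral => x _; rewrite indicE; case: (boolP (x \in I)) => xI.
      rewrite mul1e; apply: etrans (lebesgue_rV_shift (x *: v) mN).
      congr (lebesgue_rV d _); apply/seteqP; split=> y; rewrite /xsection/= inE.
        by case.
      by move=> Ny; split => //; split => //; rewrite inE in xI.
    rewrite mul0e (_ : xsection S x = set0) ?measure0//; apply/seteqP; split=> y //.
    by rewrite /xsection/= inE => -[_ [/= Ix _]]; move: xI; rewrite notin_setE.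
  rewrite ge0_integralZr//; last first.
    by apply/measurable_EFinP; exact: measurable_indic.
  by rewrite integral_indic// setIT; rewrite [X in (X * _)%E](_ : _ = 1%E) ?mul1e.
have E0 : (mu \x^ lebesgue_rV d)%E S = 0%E.
  rewrite /product_measure2/= integral0_eq// => y _ /=.
  apply/eqP; rewrite eq_le measure_ge0 andbT -(N0 y); apply: le_measure.
  - by rewrite inE; exact: measurable_ysection.
  - by rewrite inE; exact: mNy.
  - by move=> t; rewrite /ysection/= inE => -[].
have E2 : (mu \x lebesgue_rV d)%E S = (mu \x^ lebesgue_rV d)%E S.
  apply: product_measure_unique => // A B mA mB; exact: product_measure2E.
exact: etrans (esym E1) (etrans E2 E0).
Qed.

End translation.

(** * Directional derivatives *)

Section directional.
Context {R : realType} {d : nat} (K : R) (f : 'rV[R]_d -> R) (fK : lip K f).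
Local Notation V := 'rV[R]_d.
Local Notation mu := (@lebesgue_measure R).
Implicit Types (v y : V).

Let quot v (h : R) y := h^-1 * (f (h *: v + y) - f y).

Let derivableE v y : derivable f y v = cvg (quot v h y @[h --> 0^']).
Proof. by []. Qed.

(** By Cauchy's criterion with rational candidates for the limit, the set is a
    countable combination of sets that are closed because [f] is continuous. *)
Lemma measurable_derivable v : measurable [set y | derivable f y v].
Proof.
pose A (k : nat) (c : rat * nat) : set V := [set y | forall h : R, 0 < `|h| < c.2.+1%:R^-1 ->
  `|quot v h y - ratr c.1| <= k.+1%:R^-1].
have cA k c : closed (A k c).
  rewrite (_ : A k c = \bigcap_(h in [set h : R | 0 < `|h| < c.2.+1%:R^-1])
     ((fun y => `|quot v h y - ratr c.1|) @^-1` [set x | x <= k.+1%:R^-1])); last first.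
    by apply/seteqP; split=> y /= Ay h; exact: Ay.
  apply: closed_bigI => h _; apply: (@closed_comp _ _ (fun y => `|quot v h y - ratr c.1|) [set x | x <= k.+1%:R^-1]); last exact: closed_le.
  move=> y _; apply: (@lip_continuous _ _ (`|h^-1| * (2 * K))) => {}y z.
  rewrite (le_trans (ler_dist_dist _ _))// opprB addrA subrK /quot -mulrBr normrM -mulrA ler_wpM2l//.
  have := fK (h *: v + y) (h *: v + z); rewrite opprD addrACA subrr add0r.
  have := fK y z; rewrite !ler_norml => /andP[? ?] /andP[? ?]; apply/andP; split; lra.
suff -> : [set y | derivable f y v] = \bigcap_k \bigcup_c A k c.
  apply: bigcapT_measurable => k; apply: countable_bigcupT_measurable => // c.
  exact: measurable_mx_closed.
apply/seteqP; split=> y.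
  rewrite /= derivableE => /cvg_ex[/= l ql] k _.
  have k20 : 0 < k.+1%:R^-1 / 2 :> R by rewrite divr_gt0.
  have [q] : exists q : rat, ratr q \in `]l, (l + k.+1%:R^-1 / 2)[%R.
    by have [q qP] := @rat_in_itvoo R l (l + k.+1%:R^-1 / 2) (ltr_pwDr k20 (lexx _)); exists q.
  rewrite in_itv/= => /andP[lq ql2].
  move/cvgrPdist_lt : ql => /(_ _ k20) [del /= del0 Hdel].
  have [m _ Hm] := near_infty_natSinv_lt (PosNum del0).
  exists (q, m) => // h /= /andP[h0 hm].
  have /= := Hdel h; rewrite /ball_ /= sub0r normrN (lt_trans hm (Hm m (leqnn _))) => /(_ isT).
  rewrite -normr_gt0 h0 => /(_ isT) lqh.
  rewrite -(subrK l (quot v h y)) -addrA (le_trans (ler_normD _ _))//.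
  rewrite [leRHS]splitr lerD//; first by rewrite distrC ltW.
  by rewrite distrC gtr0_norm ?subr_gt0// lerBlDl ltW.
move=> Ay; rewrite /= derivableE.
apply: cauchy_cvg; apply: cauchy_exP => eps eps0.
have [k _ Hk] := near_infty_natSinv_lt (PosNum eps0).
have [[q m] _ Aq] := Ay k I.
exists (ratr q).
suff : \forall h \near (0 : R)^', ball (ratr q : R) eps (quot v h y) by [].
near=> h.
suff : `|quot v h y - ratr q| < eps by rewrite -ball_normE/= distrC.
apply: (@le_lt_trans _ _ k.+1%:R^-1); last exact: (Hk k (leqnn _)).
apply: Aq.
apply/andP; split; first by rewrite normr_gt0; near: h; exact: nbhs_dnbhs_neq.
by near: h; apply: dnbhs0_lt; rewrite invr_gt0.
Unshelve. all: by end_near. Qed.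

Lemma derivable_line v y (t : R) :
  derivable ((fun s => f (y + s *: v)) : R -> R) t 1 = derivable f (y + t *: v) v.
Proof.
suff E : (fun h : R => h^-1 *: (f (y + (h *: 1 + t) *: v) - f (y + t *: v))) =
    (fun h : R => h^-1 *: (f (h *: v + (y + t *: v)) - f (y + t *: v))).
  rewrite /derivable -[X in cvg (X @ _)]/(fun h : R => h^-1 *: (f (y + (h *: 1 + t) *: v) - f (y + t *: v))).
  by rewrite E.
apply/funext => h; congr (_ *: (f _ - _)).
rewrite (_ : h *: (1 : R) = h); last exact: mulr1.
by rewrite scalerDl addrCA.
Qed.

(** On every line of direction [v], [f] is a Lipschitz function of one variable. *)
Lemma ae_derivable v : {ae lebesgue_rV d, forall y, derivable f y v}.
Proof.
have mD := measurable_derivable v.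
exists (~` [set y | derivable f y v]); split => //; first exact: measurableC.
apply: (lebesgue_rV_line_null (v := v)); first exact: measurableC.
move=> y; pose g t := f (y + t *: v).
have gK : lip1 (K * `|v|) g.
  move=> s t; rewrite (le_trans (fK _ _))// opprD addrACA subrr add0r -scalerBl normrZ.
  by rewrite mulrCA mulrC.
have [N [mN N0 gN]] := lip1_ae_derivable gK.
apply/eqP; rewrite eq_le measure_ge0 andbT -N0; apply: le_measure; rewrite ?inE//.
  rewrite -[X in measurable X]setTI; apply: (_ : measurable_fun setT (fun t : measurableTypeR R => y + t *: v)) => //.
    apply/measurable_fun_mxP => i j; under eq_fun do rewrite !mxE.
    by apply: measurable_funD; [exact: measurable_cst|apply: measurable_funM].
  exact: measurableC.
by move=> t /= Nt; apply: gN => /=; rewrite derivable_line.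
Qed.

End directional.

(** * Functions with zero integral over all boxes *)

Section density.
Context d {T : measurableType d} {R : realType} (mu : {measure set T -> \bar R}).
Variables (phi : T -> \bar R).
Hypotheses (mphi : measurable_fun setT phi) (phi0 : forall x, (0 <= phi x)%E).

(** The two proofs are arguments so that the measure structure below can be
    inferred from the term. *)
Definition density of measurable_fun setT phi & (forall x, (0 <= phi x)%E) :=
  fun A => (\int[mu]_(x in A) phi x)%E.

Local Notation dens := (density mphi phi0).

Let dens0 : dens set0 = 0%E. Proof. exact: integral_set0. Qed.

Let dens_ge0 A : (0 <= dens A)%E. Proof. exact: integral_ge0. Qed.

Let dens_sigma_additive : semi_sigma_additive dens.
Proof.
move=> F mF tF mUF; rewrite /density ge0_integral_bigcup//; last first.
  exact: measurable_funTS.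
by apply: is_cvg_ereal_nneg_natsum_cond => n _ _; exact: integral_ge0.
Qed.

HB.instance Definition _ := isMeasure.Build _ _ _ dens dens0 dens_ge0 dens_sigma_additive.

End density.

Section closed_boxes.
Context {R : realType} {d : nat}.
Local Notation V := 'rV[R]_d.
Local Notation mu := (lebesgue_rV d).

Definition cbox (a b : V) : set V := [set x | forall i, a 0 i <= x 0 i <= b 0 i].

Let cboxes : set (set V) := [set B | exists a b, B = cbox a b].

Lemma measurable_cbox a b : measurable (cbox a b).
Proof.
rewrite (_ : cbox a b = \bigcap_(i in [set: 'I_d]) ((fun u : V => u 0 i) @^-1` `[a 0 i, b 0 i])).
  apply: fin_bigcap_measurable => // i _; rewrite -[X in measurable X]setTI.
  by apply: measurable_coord => //; exact: measurable_itv.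
apply/seteqP; split=> u; first by move=> ru i _ /=; rewrite in_itv/=; exact: ru.
by move=> ru i; have := ru i I; rewrite /= in_itv/=.
Qed.

Lemma cbox_lty a b : (mu (cbox a b) < +oo)%E.
Proof.
pose r : 'I_d -> R := fun i => `|a 0 i| + `|b 0 i|.
apply: le_lt_trans (lebesgue_rV_rect_lty r).
apply: le_measure; rewrite ?inE; [exact: measurable_cbox|exact: measurable_rect|].
move=> u abu i; have /andP[au ub] := abu i.
rewrite ler_norml /r; have := ler_norm (b 0 i); have := ler_norm (- a 0 i).
rewrite normrN => ? ?; have := normr_ge0 (a 0 i); have := normr_ge0 (b 0 i).
by move=> ? ?; apply/andP; split; lra.
Qed.

Let cube (n : nat) := cbox (const_mx (- n%:R)) (const_mx n%:R).

Lemma cube_cover : \bigcup_n cube n = setT.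
Proof.
apply/seteqP; split=> // x _; exists (Num.bound `|x|) => // i; rewrite !mxE -ler_norml.
by rewrite (le_trans (coord_le_norm _ _))// ltW// archi_boundP.
Qed.

(** Half-spaces bounded by coordinate hyperplanes are countable unions of boxes. *)
Lemma borel_cboxes : measurable = <<s cboxes >>.
Proof.
apply/seteqP; split; last first.
  apply: smallest_sub; first exact: sigma_algebra_measurable.
  by move=> _ [a [b ->]]; exact: measurable_cbox.
suff : measurable_fun (setT : set (g_sigma_algebraType cboxes)) (id : g_sigma_algebraType cboxes -> V).
  by move=> mid A mA; have := mid measurableT A mA; rewrite setTI preimage_id.
apply/measurable_fun_mxP => i j.
apply: (measurability _ (RGenCInfty.measurableE R)) => _ [_ [c ->] <-].
rewrite setTI; rewrite (_ : _ @^-1` _ = \bigcup_n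
   cbox (\row_k if k == j then c else - n%:R) (const_mx n%:R)).
  apply: bigcupT_measurable => n; apply: sub_sigma_algebra.
  by exists (\row_k if k == j then c else - n%:R), (const_mx n%:R).
apply/seteqP; split=> x /=; rewrite in_itv/= andbT (ord1 i).
  move=> cx; exists (Num.bound `|x|) => // k; rewrite !mxE.
  have : `|x 0 k| <= (Num.bound `|x|)%:R.
    by rewrite (le_trans (coord_le_norm _ _))// ltW// archi_boundP.
  rewrite ler_norml => /andP[xk ->]; rewrite andbT.
  by case: eqP => [->|_].
by move=> [n _ /(_ j)]; rewrite !mxE eqxx => /andP[].
Qed.

(** The measures of densities [g + C] and [C], both nonnegative, agree on boxes.
    Boxes are stable under intersection and generate the Borel sets, so the two
    measures are equal and so are their densities almost everywhere. *)
Lemma ae_eq0_cboxes (g : V -> R) (C : R) : measurable_fun setT g -> (forall x, `|g x| <= C) ->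
  (forall a b : V, (forall i, a 0 i <= b 0 i) -> (\int[mu]_(x in cbox a b) (g x)%:E = 0)%E) ->
  {ae mu, forall x, g x = 0}.
Proof.
move=> mg gC g0.
have C0 : 0 <= C by apply: le_trans (gC 0).
have mgC : measurable_fun setT (fun x => (g x + C)%:E).
  by apply/measurable_EFinP; exact: measurable_funD.
have gC0 x : (0 <= (g x + C)%:E)%E.
  by rewrite lee_fin; have := gC x; rewrite ler_norml => /andP[? ?]; lra.
have mC : measurable_fun setT (fun x : V => C%:E) by exact: measurable_cst.
have C0' (x : V) : (0 <= C%:E)%E by rewrite lee_fin.
pose m1 := density mu mgC gC0; pose m2 := density mu mC C0'.
have iC a b : mu.-integrable (cbox a b) (fun x => C%:E).
  apply: (@bounded_integrable _ _ _ _ _ (fun=> C) C) => //; [exact: measurable_cbox|exact: cbox_lty|].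
  by move=> x _; rewrite ger0_norm.
have ig a b : mu.-integrable (cbox a b) (fun x => (g x)%:E).
  apply: (@bounded_integrable _ _ _ _ _ g C) => //; [exact: measurable_cbox|exact: cbox_lty|].
  exact: measurable_funTS.
have m12 A : measurable A -> m1 A = m2 A.
  move=> mA; apply: (@measure_unique _ _ _ cboxes cube) => //.
  - exact: borel_cboxes.
  - move=> _ _ [a [b ->]] [a' [b' ->]].
    exists (\row_i Num.max (a 0 i) (a' 0 i)), (\row_i Num.min (b 0 i) (b' 0 i)).
    apply/seteqP; split=> x /=.
      move=> [abx abx'] i; rewrite !mxE ge_max le_min.
      by have /andP[-> ->] := abx i; have /andP[-> ->] := abx' i.
    move=> xab; split=> i; have := xab i; rewrite !mxE ge_max le_min.
      by move=> /andP[/andP[-> _] /andP[-> _]].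
    by move=> /andP[/andP[_ ->] /andP[_ ->]].
  - by move=> n; exists (const_mx (- n%:R)), (const_mx n%:R).
  - exact: cube_cover.
  - move=> _ [a [b ->]]; rewrite /m1 /m2 /= /density.
    have [ab|nab] := pselect (forall i, a 0 i <= b 0 i); last first.
      rewrite (_ : cbox a b = set0) ?integral_set0//.
      apply/seteqP; split=> // x abx; apply: nab => i.
      by have /andP[] := abx i; exact: le_trans.
    under eq_integral do rewrite EFinD.
    rewrite integralD//; try solve [exact: measurable_cbox|exact: ig|exact: iC].
    by rewrite g0// add0e.
  - move=> n; rewrite /m1 /= /density.
    under eq_integral do rewrite EFinD.
    rewrite integralD//; try solve [exact: measurable_cbox|exact: ig|exact: iC].
    by apply: lte_add_pinfty; apply: integrable_lty; try exact: measurable_cbox; [exact: ig|exact: iC].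
suff H m : {ae mu, forall x, cube m x -> (g x + C)%:E = C%:E}.
  have [N [mN N0 HN]] := ae_foralln H.
  exists N; split=> // x nx; apply: HN => Hx; apply: nx.
  have : (\bigcup_n cube n) x by rewrite cube_cover.
  by move=> [n _ /Hx] [] /eqP; rewrite -subr_eq0 addrK => /eqP.
apply: integral_ae_eq.
- exact: measurable_cbox.
- under eq_fun do rewrite EFinD.
  by apply: integrableD; [exact: measurable_cbox|exact: ig|exact: iC].
- exact: measurable_cst.
- move=> E _ mE; exact: m12.
Qed.

End closed_boxes.

(** * Rademacher's theorem *)

Section rademacher.
Context {R : realType} {d : nat} (K : R) (f : 'rV[R]_d -> R).
Hypotheses (d0 : (0 < d)%N) (K0 : 0 <= K) (fK : lip K f).
Local Notation V := 'rV[R]_d.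
Local Notation mu := (lebesgue_rV d).
Implicit Types (v y : V).

Definition quotient_seq v (n : nat) y := n.+1%:R * (f (y + n.+1%:R^-1 *: v) - f y).

Lemma quotient_seq_lip v n : lip (n.+1%:R * (2 * K)) (quotient_seq v n).
Proof.
move=> y z; rewrite /quotient_seq -mulrBr normrM ger0_norm// -mulrA ler_wpM2l//.
have := fK (y + n.+1%:R^-1 *: v) (z + n.+1%:R^-1 *: v); rewrite opprD addrACA subrr addr0.
have := fK y z; rewrite !ler_norml => /andP[? ?] /andP[? ?]; apply/andP; split; lra.
Qed.

Lemma quotient_seq_bounded v n y : `|quotient_seq v n y| <= K * `|v|.
Proof.
rewrite /quotient_seq normrM ger0_norm// -ler_pdivlMl// (le_trans (fK _ _))//.
by rewrite addrC addKr normrZ ger0_norm ?invr_ge0// mulrCA.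
Qed.

Lemma quotient_seq_cvg v y : derivable f y v ->
  quotient_seq v n y @[n --> \oo] --> 'D_v f y.
Proof.
move=> /cvg_ex[l fl]; have -> : 'D_v f y = l by exact/cvg_lim.
apply/cvgrPdist_lt => eps eps0.
move/cvgrPdist_lt : fl => /(_ _ eps0) [del /= del0 Hdel].
near=> n.
have -> : quotient_seq v n y = n.+1%:R^-1^-1 *: ((f \o shift y) (n.+1%:R^-1 *: v) - f y).
  by rewrite invrK /= [_ *: v + y]addrC.
apply: Hdel.
  rewrite /ball_/= sub0r normrN ger0_norm ?invr_ge0//.
  by near: n; exact: (near_infty_natSinv_lt (PosNum del0)).
by rewrite invr_neq0.
Unshelve. all: by end_near. Qed.

(** The value [0] where the derivative does not exist makes the function
    measurable and bounded everywhere. *)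
Definition dirder v y : R := \1_[set y | derivable f y v] y * 'D_v f y.

Lemma dirderE v y : derivable f y v -> dirder v y = 'D_v f y.
Proof. by move=> dfy; rewrite /dirder indicE mem_set// mul1r. Qed.

Let dirder_cvg v y : (\1_[set y | derivable f y v] y * quotient_seq v n y) @[n --> \oo] --> dirder v y.
Proof.
rewrite /dirder indicE; case: (boolP (y \in _)) => [|_].
  by rewrite inE /= => dfy; apply: cvgM; [exact: cvg_cst|exact: quotient_seq_cvg].
rewrite mul0r; under eq_fun do rewrite mul0r; exact: cvg_cst.
Qed.

Lemma measurable_dirder v : measurable_fun setT (dirder v).
Proof.
apply: (measurable_fun_cvg (h := fun n y => \1_[set y | derivable f y v] y * quotient_seq v n y)).
  move=> n; apply: measurable_funM.
    exact: measurable_indic (measurable_derivable fK v).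
  exact: lip_measurable (quotient_seq_lip v n).
by move=> y _; exact: dirder_cvg.
Qed.

Lemma dirder_bounded v y : `|dirder v y| <= K * `|v|.
Proof.
have /cvg_norm := dirder_cvg (v := v) (y := y); move/cvgr_to_le; apply.
apply: nearW => n; rewrite normrM indicE.
case: (y \in _); rewrite ?normr1 ?mul1r ?normr0 ?mul0r; last by rewrite mulr_ge0.
exact: quotient_seq_bounded.
Qed.

Lemma integral_rV_shift (c : V) (D : set V) (k : V -> \bar R) :
  measurable D -> measurable_fun setT k ->
  mu.-integrable [set u | D (u + c)] (fun u => k (u + c)%R) ->
  (\int[mu]_(y in D) k y = \int[mu]_(u in [set u | D (u + c)%R]) k (u + c)%R)%E.
Proof.
move=> mD mk ik.
have mc : measurable_fun setT (fun u : V => u + c).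
  apply/measurable_fun_mxP => i j; under eq_fun do rewrite !mxE.
  by apply: measurable_funD; [exact: measurable_coord|exact: measurable_cst].
have := @integral_pushforward _ _ _ _ R _ mc mu D k mk ik mD.
move=> <-; apply: eq_measure_integral => A mA _; exact/esym/lebesgue_rV_shift.
Qed.

Lemma integral_cbox_shift K' (k : V -> R) a b : lip K' k ->
  (\int[mu]_(y in cbox a b) (k y)%:E =
   (rint (fun i => (b 0 i - a 0 i) / 2) k (2^-1 *: (a + b)))%:E)%E.
Proof.
move=> kK; set c := 2^-1 *: _.
pose r i := (b 0 i - a 0 i) / 2; rewrite -[fun i => _ / 2]/r.
have ck : [set u | cbox a b (u + c)] = rect r.
  apply/seteqP; split=> u /= uab i; have := uab i; rewrite /r /c !mxE ?ler_norml => /andP[? ?]; apply/andP; split; lra.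
rewrite (@integral_rV_shift c).
- rewrite ck /rint /Rintegral fineK.
    by apply: eq_integral => u _; rewrite addrC.
  apply: integrable_fin_num; first exact: measurable_rect.
  exact: integrable_rint kK.
- exact: measurable_cbox.
- by apply/measurable_EFinP; exact: lip_measurable kK.
- rewrite ck; under eq_fun do rewrite addrC; exact: integrable_rint kK.
Qed.

Lemma rint_quotient_seq r v n w :
  rint r (quotient_seq v n) w = n.+1%:R * (rint r f (w + n.+1%:R^-1 *: v) - rint r f w).
Proof.
have i1 : mu.-integrable (rect r) (EFin \o (fun u => f (w + n.+1%:R^-1 *: v + u))) by exact: integrable_rint fK.
have i2 : mu.-integrable (rect r) (EFin \o (fun u => f (w + u))) by exact: integrable_rint fK.
rewrite /rint -RintegralB//; try solve [exact: measurable_rect|exact: i1|exact: i2].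
rewrite -RintegralZl//; try exact: measurable_rect.
  by apply: eq_Rintegral => u _; rewrite /quotient_seq addrAC.
have := integrableB (measurable_rect r) i1 i2; exact.
Qed.

(** Averaging commutes with difference quotients and, by dominated convergence,
    with their limit. The integral of the derivative is thus the derivative of the
    average, which Taylor's formula computes. *)
Lemma integral_dirder_quadratic (a b v : V) C g :
  quadratic_at C (rint (fun i => (b 0 i - a 0 i) / 2) f) g ->
  (\int[mu]_(y in cbox a b) (dirder v y)%:E = (dotv v (g (2^-1 *: (a + b))))%:E)%E.
Proof.
move=> gq.
have cvg1 : (\int[mu]_(y in cbox a b) (quotient_seq v n y)%:E @[n --> \oo] --> (dotv v (g (2^-1 *: (a + b))))%:E)%E.
  under eq_fun => n do rewrite (integral_cbox_shift _ _ (quotient_seq_lip v n)) rint_quotient_seq.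
  by apply: cvg_EFin; [exact: nearW|exact: quadratic_at_derive gq].
have mq n : measurable_fun (cbox a b) (fun y => (quotient_seq v n y)%:E).
  by apply: measurable_funTS; apply/measurable_EFinP; exact: lip_measurable (quotient_seq_lip v n).
have md : measurable_fun (cbox a b) (fun y => (dirder v y)%:E).
  by apply: measurable_funTS; apply/measurable_EFinP; exact: measurable_dirder.
have qd : {ae mu, forall y, cbox a b y -> (quotient_seq v n y)%:E @[n --> \oo] --> (dirder v y)%:E}.
  have [N [mN N0 HN]] := ae_derivable fK v; exists N; split=> // y ny; apply: HN => dy; apply: ny => _.
  by rewrite dirderE//; apply: cvg_EFin; [exact: nearW|exact: quotient_seq_cvg].
have iK : mu.-integrable (cbox a b) (fun y => (K * `|v|)%:E).
  apply: (@bounded_integrable _ _ _ _ _ (fun=> K * `|v|) (K * `|v|)) => //; [exact: measurable_cbox|exact: cbox_lty|].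
  by move=> y _; rewrite ger0_norm// mulr_ge0.
have qK : {ae mu, forall y n, cbox a b y -> (`|(quotient_seq v n y)%:E| <= (K * `|v|)%:E)%E}.
  by apply: aeW => y n _; rewrite abse_EFin lee_fin quotient_seq_bounded.
have [_ _ cvg2] := dominated_convergence (measurable_cbox a b) mq md qd iK qK.
exact: cvg_unique cvg2 cvg1.
Qed.

(** Linearity in [v] holds for the integrals first; for [dirder] it can only hold
    almost everywhere. *)
Lemma integral_dirder (a b : V) : (forall i, a 0 i <= b 0 i) ->
  exists G : V, forall v, (\int[mu]_(y in cbox a b) (dirder v y)%:E = (dotv v G)%:E)%E.
Proof.
move=> ab; pose r (i : 'I_d) := (b 0 i - a 0 i) / 2.
pose rho := \sum_i r i.
have r0 i : 0 <= r i by rewrite /r divr_ge0// subr_ge0.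
have rho0 : 0 <= rho by exact: sumr_ge0.
have rrho i : 0 <= r i <= rho.
  by rewrite r0 /rho (bigD1 i)//= lerDl sumr_ge0.
have [g [gq _]] := rint_quadratic d0 K0 rrho rho0 fK.
by exists (g (2^-1 *: (a + b))) => v; exact: integral_dirder_quadratic gq.
Qed.

(** The defect of linearity has zero integral over every box. *)
Lemma ae_dirder_linear v :
  {ae mu, forall y, dirder v y = \sum_i v 0 i * dirder (delta_mx 0 i) y}.
Proof.
pose g y := dirder v y - \sum_i v 0 i * dirder (delta_mx 0 i) y.
suff [N [mN N0 HN]] : {ae mu, forall y, g y = 0}.
  exists N; split=> // y ny; apply: HN => gy0; apply: ny.
  by apply/eqP; rewrite -subr_eq0; apply/eqP.
apply: (@ae_eq0_cboxes _ _ g (K * `|v| + \sum_i `|v 0 i| * K)).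
- apply: measurable_funB; first exact: measurable_dirder.
  apply: measurable_sum => i; apply: measurable_funM; first exact: measurable_cst.
  exact: measurable_dirder.
- move=> y; rewrite (le_trans (ler_normB _ _))// lerD ?dirder_bounded//.
  rewrite (le_trans (ler_norm_sum _ _ _))// ler_sum// => i _.
  rewrite normrM ler_wpM2l// (le_trans (dirder_bounded _ _))// ler_piMr//.
  exact: norm_delta_mx.
move=> a b ab; have [G HG] := integral_dirder ab.
have id z : mu.-integrable (cbox a b) (fun y => (dirder z y)%:E).
  apply: (@bounded_integrable _ _ _ _ _ (dirder z) (K * `|z|)).
  - exact: measurable_cbox.
  - exact: cbox_lty.
  - exact: measurable_funTS (measurable_dirder _).
  - by move=> y _; exact: dirder_bounded.
have iz i : mu.-integrable (cbox a b) (fun y => (v 0 i)%:E * (dirder (delta_mx 0 i) y)%:E)%E.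
  by apply: integrableZl; [exact: measurable_cbox|exact: id].
transitivity (\int[mu]_(y in cbox a b) ((dirder v y)%:E -
    \sum_(i < d) ((v 0 i)%:E * (dirder (delta_mx 0 i) y)%:E)))%E.
  apply: eq_integral => y _; rewrite /g EFinB; congr (_ - _)%E.
  by rewrite -sumEFin.
rewrite integralB; first last.
- by apply: integrable_sum => // *; exact: measurable_cbox.
- exact: id.
- exact: measurable_cbox.
rewrite integral_sum//; last exact: measurable_cbox.
under eq_bigr => i _.
  rewrite integralZl; [|exact: measurable_cbox|exact: id].
  rewrite HG dotv_delta -EFinM; over.
by rewrite HG sumEFin -EFinB subrr.
Qed.

Lemma rational_grid (m : nat) (x : V) : (0 < m)%N -> `|x| <= 1 ->
  exists j : {ffun 'I_d -> 'I_(2 * m).+1},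
    `|x - map_mx ratr (\row_i ((j i)%:R / m%:R - 1))| <= m%:R^-1.
Proof.
move=> m0 x1.
have mr0 : 0 < m%:R :> R by rewrite ltr0n.
have x1i i : 0 <= (x 0 i + 1) * m%:R <= (2 * m)%:R.
  have := le_trans (coord_le_norm x i) x1; rewrite ler_norml => /andP[? ?].
  rewrite natrM; apply/andP; split; first by apply: mulr_ge0; [lra|exact: ltW].
  by apply: ler_wpM2r; [exact: ltW|lra].
have jm i : (Num.truncn ((x 0 i + 1) * m%:R)%R < (2 * m).+1)%N.
  have /andP[x0 x2] := x1i i.
  by rewrite ltnS -(@ler_nat R) (le_trans _ x2)// truncn_le.
exists [ffun i => Ordinal (jm i)].
rewrite /Num.norm/= mx_normrE; apply/bigmax_leP; split; first by rewrite invr_ge0.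
move=> -[a i] _ /=.
rewrite (ord1 a) !mxE ffunE /= rmorphB/= rmorph1 fmorph_div/= !ratr_nat.
have /andP[x0 x2] := x1i i; have := truncn_itv x0 => /andP[t1 t2].
set T := Num.truncn _ in t1 t2 *.
have -> : x 0 i - (T%:R / m%:R - 1) = ((x 0 i + 1) * m%:R - T%:R) / m%:R.
  by field; rewrite gt_eqF.
rewrite normrM normfV (ger0_norm (ltW mr0)) ler_pdivrMr// mulVf ?gt_eqF//.
rewrite ger0_norm ?subr_ge0// lerBlDl natr1; exact: ltW.
Qed.

(** A vector of norm at most [1] is within [m%:R^-1] of a finite grid of rational
    directions, and moving the direction by that much costs at most
    [(K + d%:R * `|D|) / m%:R]. Finitely many directional derivatives thus give a
    first order expansion that is uniform in the direction. *)
Lemma differentiable_rational y (D : V) :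
  (forall q : 'rV[rat]_d, let v := map_mx ratr q in derivable f y v /\ 'D_v f y = dotv v D) ->
  differentiable f y.
Proof.
move=> Hq.
have linL : linear (fun v => dotv v D : R).
  move=> a u v; rewrite /dotv scaler_sumr -big_split/=; apply: eq_bigr => i _.
  by rewrite !mxE mulrDl /GRing.scale/= mulrA.
pose L : {linear V -> R} := HB.pack (fun v => dotv v D : R)
  (GRing.isLinear.Build R V R _ (fun v => dotv v D : R) linL).
have Lc : continuous L.
  apply: (@lip_continuous _ _ (d%:R * `|D|)) => u v.
  by rewrite -[L u]/(dotv u D) -[L v]/(dotv v D) -dotvBl; exact: dotv_le.
suff dfL : f \o shift y = cst (f y) + L +o_ (0 : V) id.
  by apply/diff_locallyP; rewrite (diff_unique Lc dfL).
apply/eqaddoP => eps eps0.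
pose c := K + d%:R * `|D|.
have c0 : 0 <= c by rewrite addr_ge0// mulr_ge0.
pose m := (Num.truncn (c / (eps / 2))).+1.
have mr0 : 0 < m%:R :> R by rewrite ltr0n.
have cm : c / m%:R <= eps / 2.
  rewrite ler_pdivrMr// mulrC -ler_pdivrMr ?divr_gt0//.
  by apply: ltW; exact: truncnS_gt.
pose q (j : {ffun 'I_d -> 'I_(2 * m).+1}) : 'rV[rat]_d := \row_i ((j i)%:R / m%:R - 1).
have eps20 : 0 < eps / 2 by rewrite divr_gt0.
have near_q (j : {ffun 'I_d -> 'I_(2 * m).+1}) : \forall s \near (0 : R)^',
    `|f (y + s *: map_mx ratr (q j)) - f y - s * dotv (map_mx ratr (q j)) D| <= eps / 2 * `|s|.
  have [/cvg_ex[l fl] Dl] := Hq (q j).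
  have {}Dl : l = dotv (map_mx ratr (q j)) D by rewrite -Dl; apply/esym/cvg_lim.
  move/cvgrPdist_le : fl => /(_ _ eps20) H.
  near=> s.
  have s0 : s != 0 by near: s; exact: nbhs_dnbhs_neq.
  have : `|l - s^-1 *: ((f \o shift y) (s *: map_mx ratr (q j)) - f y)| <= eps / 2.
    by near: s.
  rewrite distrC Dl => Hs.
  have -> : f (y + s *: map_mx ratr (q j)) - f y - s * dotv (map_mx ratr (q j)) D =
      s * (s^-1 *: ((f \o shift y) (s *: map_mx ratr (q j)) - f y) - dotv (map_mx ratr (q j)) D).
    by rewrite [RHS]mulrBr /= mulVKf// [_ *: _ + y]addrC.
  by rewrite normrM mulrC ler_wpM2r.
have near_q' : \forall s \near (0 : R)^', forall j,
    `|f (y + s *: map_mx ratr (q j)) - f y - s * dotv (map_mx ratr (q j)) D| <= eps / 2 * `|s|.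
  by apply: filter_forall; exact: near_q.
have [del /= del0 Hdel] := near_q'.
have near_del : \forall h \near (0 : V), `|h| < del by exact: nbhs0_lt.
near=> h.
suff H : `|f (h + y) - (f y + dotv h D)| <= eps * `|h| by exact: H.
rewrite [h + y]addrC.
have [->|h0] := eqVneq h 0.
  by rewrite addr0 (_ : dotv 0 D = 0) ?addr0 ?subrr ?normr0 ?mulr0//; exact: (linear0 L).
have t0 : 0 < `|h| by rewrite normr_gt0.
have u1 : `| `|h|^-1 *: h| <= 1.
  by rewrite normrZ ger0_norm ?invr_ge0// mulVf// gt_eqF.
have [j uj] := rational_grid (ltn0Sn _ : (0 < m)%N) u1.
set z := map_mx ratr _ in uj.
have Hz : `|f (y + `|h| *: z) - f y - `|h| * dotv z D| <= eps / 2 * `|h|.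
  have := Hdel `|h|; rewrite /ball_/= sub0r normrN normr_id; apply; last by rewrite gt_eqF.
  by near: h; exact: near_del.
have hz : `|h - `|h| *: z| <= `|h| / m%:R.
  have -> : h - `|h| *: z = `|h| *: (`|h|^-1 *: h - z).
    by rewrite scalerBr scalerA mulfV ?scale1r// gt_eqF.
  by rewrite normrZ normr_id ler_wpM2l.
have H1 : `|f (y + h) - f (y + `|h| *: z)| <= K * (`|h| / m%:R).
  rewrite (le_trans (fK _ _))// opprD addrACA subrr add0r ler_wpM2l//.
have H2 : `| `|h| * dotv z D - dotv h D| <= d%:R * `|D| * (`|h| / m%:R).
  rewrite -dotvZl -dotvBl (le_trans (dotv_le _ _))// ler_wpM2l// ?mulr_ge0//.
  by rewrite distrC.
have -> : f (y + h) - (f y + dotv h D) = (f (y + h) - f (y + `|h| *: z)) +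
   (f (y + `|h| *: z) - f y - `|h| * dotv z D) + (`|h| * dotv z D - dotv h D) by ring.
rewrite (le_trans (ler_normD _ _))// (le_trans (lerD (le_trans (ler_normD _ _) (lerD H1 Hz)) H2))//.
have := ler_wpM2r (ltW t0) cm; rewrite /c; lra.
Unshelve. all: by end_near. Qed.

(** The countably many rational directions can be handled outside one null set. *)
Theorem rademacher : {ae mu, forall y, differentiable f y}.
Proof.
pose lin_at (n : nat) (y : V) : Prop := if @choice.unpickle 'rV[rat]_d n is Some q
  then derivable f y (map_mx ratr q) /\
       dirder (map_mx ratr q) y = \sum_i (map_mx ratr q : V) 0 i * dirder (delta_mx 0 i) y
  else True.
have HP n : {ae mu, forall y, lin_at n y}.
  rewrite /lin_at; case: choice.unpickle => [q|]; last by exact: aeW.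
  apply: (negligibleS _ (negligibleU (ae_derivable fK (map_mx ratr q)) (ae_dirder_linear (map_mx ratr q)))).
  by move=> y /not_andP[ny|ny]; [left|right].
have [N [mN N0 HN]] := ae_foralln HP; exists N; split=> // y ny; apply: HN => HPy; apply: ny.
apply: (@differentiable_rational y (\row_i dirder (delta_mx 0 i) y)) => q /=.
have := HPy (choice.pickle q); rewrite /lin_at choice.pickleK => -[dq dE]; split=> //.
rewrite -dirderE// dE; apply: eq_bigr => i _; by rewrite [in RHS]mxE.
Qed.

End rademacher.

(** * Limits of gradients of smoothings *)

Section separation.
Context {R : realType} {d : nat}.
Local Notation V := 'rV[R]_d.
Implicit Types (x : V).

(** A point [a] of [H] that almost minimises the norm plays the role of the nearest
    point of a closed set: if [dotv a x] were small, the point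
    [t *: x + (1 - t) *: a] would be shorter than the infimum. The bound [B]
    fixes [t], and [t] fixes how close to the infimum [a] has to be. *)
Lemma convex_separation (H : set V) (r B : R) : @convex_set R V H -> H !=set0 ->
  0 < r -> (forall x, H x -> r <= norm2 x) ->
  exists v : V, exists2 del : R, 0 < del &
    forall x, H x -> `|x| <= B -> del <= dotv v x.
Proof.
move=> cH [h Hh] r0 Hr.
pose E := [set dotv x x | x in H].
have Er : lbound E (r ^+ 2).
  by move=> _ [x Hx <-]; rewrite -norm2_sqr ler_sqr ?nnegrE ?norm2_ge0 ?Hr//; exact: ltW.
have E_inf : has_inf E by split; [exists (dotv h h), h|exists (r ^+ 2)].
pose m := inf E.
have m0 : 0 < m.
  by apply: (lt_le_trans (_ : 0 < r ^+ 2)); [rewrite exprn_gt0|apply: lb_le_inf => //; exists (dotv h h), h].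
have Hm x : H x -> m <= dotv x x by move=> Hx; apply: ge_inf; [exists (r ^+ 2)|exists x].
pose X := d%:R * B ^+ 2.
have X0 : 0 <= X by rewrite mulr_ge0// sqr_ge0.
(* [t] is so small that the term [t ^+ 2 * dotv x x] of the squared norm of
   [p] below is at most [t * m / 4] *)
pose t := m / (4 * (X + m)).
have Xm : 0 < 4 * (X + m) by rewrite mulr_gt0// ltr_wpDl.
have t0 : 0 < t by rewrite divr_gt0.
have t0' := ltW t0.
have t1 : t <= 1 by rewrite ler_pdivrMr// mul1r; lra.
have tX : t * X <= m / 4.
  rewrite /t mulrAC ler_pdivrMr// -[leRHS]mulrA.
  have -> : 4^-1 * (4 * (X + m)) = X + m by rewrite mulKf.
  by apply: ler_wpM2l; [exact: ltW|rewrite lerDl; exact: ltW].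
have tau0 : 0 < t * m / 4 by rewrite divr_gt0// mulr_gt0.
have [_ [a Ha <-] am] := inf_adherent tau0 E_inf.
exists a, (m / 2); first by rewrite divr_gt0.
move=> x Hx xB; rewrite leNgt; apply/negP => xam.
pose p : V := t *: x + (1 - t) *: a.
have Hp : H p.
  have := cH x a (Itv01 (ltW t0) t1); rewrite !inE => /(_ Hx Ha).
  by rewrite /conv /=.
have := Hm p Hp.
have pE z : dotv p z = t * dotv x z + (1 - t) * dotv a z by rewrite dotvDl !dotvZl.
rewrite pE [dotv x p]dotvC [dotv a p]dotvC !pE [dotv x a]dotvC.
have xX : dotv x x <= X.
  rewrite (le_trans (dotvv_le x))// ler_wpM2l// ler_sqr// nnegrE.
    exact: normr_ge0.
  exact: le_trans (normr_ge0 x) xB.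
rewrite -/m in am.
have h1 : t * t * dotv x x <= t * (t * X) by rewrite -mulrA !ler_wpM2l.
have h2 : t * (t * X) <= t * (m / 4) by rewrite ler_wpM2l.
have q0 : 0 <= 1 - t by rewrite subr_ge0.
have h3 : (1 - t) * ((1 - t) * dotv a a) <= (1 - t) * ((1 - t) * (m + t * m / 4)).
  by rewrite !ler_wpM2l//; exact: ltW.
have h4 : (1 - t) * (1 - t) * (t * m / 4) <= t * m / 4.
  by apply: ler_piMl; [rewrite divr_ge0// mulr_ge0// ltW|rewrite mulr_ile1//; lra].
have h5 : t * ((1 - t) * dotv a x) <= t * ((1 - t) * (m / 2)).
  by apply: ler_wpM2l; [exact: ltW|apply: ler_wpM2l => //; exact: ltW].
have tm0 : 0 < t * m by rewrite mulr_gt0.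
have h6 : t * ((1 - t) * m) + (1 - t) * ((1 - t) * m) = m - t * m by ring.
lra.
Qed.

End separation.

Section clarke.
Context {R : realType} {d : nat} (K : R) (f : 'rV[R]_d -> R).
Hypotheses (d0 : (0 < d)%N) (K0 : 0 <= K) (fK : lip K f) (f0 : forall x, 0 <= f x).
Local Notation V := 'rV[R]_d.
Local Notation mu := (lebesgue_rV d).
Implicit Types (v y w : V).

Lemma derive_dotv v y : differentiable f y -> 'D_v f y = dotv v (grad f y).
Proof.
move=> dfy; rewrite deriveE// [in LHS](row_sum_delta v) linear_sum; apply: eq_bigr => i _.
by rewrite linearZ /= /grad mxE deriveE.
Qed.

Lemma grad_le y : differentiable f y -> `|grad f y| <= K.
Proof.
move=> dfy; rewrite /Num.norm/= mx_normrE; apply/bigmax_leP; split=> // -[a i] _ /=.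
rewrite (ord1 a) {a} mxE -dirderE; last exact: diff_derivable.
rewrite (le_trans (dirder_bounded K0 fK _ _))// ler_piMr//; exact: norm_delta_mx.
Qed.

Lemma lebesgue_cbox_center alpha w : 0 < alpha ->
  mu (cbox (w - const_mx alpha) (w + const_mx alpha)) = ((2 * alpha) ^+ d)%:E.
Proof.
move=> a0; rewrite -lebesgue_rV_box ?ltW//.
apply: (etrans _ (lebesgue_rV_shift (- w) (@measurable_box R d alpha))).
congr (mu _); apply/seteqP; split=> y /=.
  move=> yab; apply/(@box_coord R d alpha _ (ltW a0)) => i; have := yab i.
  by rewrite !mxE ler_norml => /andP[? ?]; apply/andP; split; lra.
move=> /(@box_coord R d alpha _ (ltW a0)) yw i; have := yw i.
by rewrite !mxE ler_norml => /andP[? ?]; apply/andP; split; lra.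
Qed.

(** The gradient of the smoothing is the mean over the cube of the gradient of
    [f], which exists almost everywhere. *)
Lemma grad_smoothing_ge alpha w v del : 0 < alpha ->
  (forall y, `|y - w| <= alpha -> differentiable f y -> del <= dotv v (grad f y)) ->
  del <= dotv v (grad (smoothing alpha f) w).
Proof.
move=> a0 Hdel.
have [q _] := smoothing_quadratic d0 K0 f0 fK a0.
have c0 : 0 < (2 * alpha) ^+ d by rewrite exprn_gt0// mulr_gt0.
set C := (_ / alpha) in q.
set g := grad _ in q *.
pose a : V := w - const_mx alpha; pose b : V := w + const_mx alpha.
have rE : (fun i : 'I_d => (b 0 i - a 0 i) / 2) = (fun=> alpha).
  by apply/funext => i; rewrite !mxE; lra.
have q' : quadratic_at (C * (2 * alpha) ^+ d) (rint (fun i => (b 0 i - a 0 i) / 2) f) (fun w => (2 * alpha) ^+ d *: g w).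
  move=> x z; have := q x z; rewrite rE !(smoothingE _ a0 f0 fK).
  rewrite -(ler_pM2l c0) -{1}(ger0_norm (ltW c0)) -normrM !mulrBr !mulVKf ?gt_eqF//.
  by rewrite ![dotv z _]dotvC dotvZl mulrA (mulrC _ C).
have := integral_dirder_quadratic K0 fK v q'.
have -> : 2^-1 *: (a + b) = w.
  by apply/rowP => i; rewrite !mxE; lra.
rewrite dotvC dotvZl dotvC => E.
rewrite -(ler_pM2l c0) -lee_fin -E.
have mab := measurable_cbox a b.
(* the maximum makes the lower bound [del] hold everywhere, without changing the
   function almost everywhere on the cube *)
have mh : measurable_fun setT (fun y => Num.max del (dirder f v y)).
  by apply: measurable_maxr; [exact: measurable_cst|exact: (measurable_dirder fK)].
rewrite (@ae_eq_integral _ _ _ _ _ (fun y => (Num.max del (dirder f v y))%:E)) //; first last.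
- have [N [mN N0 HN]] := rademacher d0 K0 fK; exists N; split=> // y ny; apply: HN => dfy; apply: ny.
  move=> yab; rewrite max_r// dirderE; last exact: diff_derivable.
  rewrite derive_dotv//; apply: Hdel => //.
  rewrite /Num.norm/= mx_normrE; apply/bigmax_leP; split; first exact: ltW.
  move=> oi _; case: oi => o i /=; rewrite (ord1 o); have := yab i.
  by rewrite !mxE ler_norml => /andP[? ?]; apply/andP; split; lra.
- by apply: measurable_funTS; apply/measurable_EFinP.
- by apply: measurable_funTS; apply/measurable_EFinP; exact: (measurable_dirder fK).
apply: (@le_trans _ _ (\int[mu]_(y in cbox a b) del%:E)%E).
  by rewrite integral_cst//= lebesgue_cbox_center// -EFinM mulrC.
apply: le_integral => //.
- apply: (@bounded_integrable _ _ _ _ _ (fun=> del) `|del|) => //; exact: cbox_lty.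
- apply: (@bounded_integrable _ _ _ _ _ (fun y => Num.max del (dirder f v y)) (`|del| + K * `|v|)) => //.
  + exact: cbox_lty.
  + exact: measurable_funTS.
  + move=> y _; have := dirder_bounded K0 fK v y.
    have := ler_norm del; have := ler_norm (- del); rewrite normrN !ler_norml.
    have : 0 <= K * `|v| by rewrite mulr_ge0.
    move=> ? ? ? /andP[? ?]; apply/andP; split.
      by rewrite le_max; apply/orP; left; lra.
    by rewrite ge_max; apply/andP; split; lra.
- by move=> y _; rewrite lee_fin le_max lexx.
Qed.

(** Otherwise there are points tending to [ws] where the gradient has a scalar
    product below [del / 2] with [v]. These gradients are bounded, so along a
    subsequence they tend to a limiting gradient that violates the assumption. *)
Lemma separated_near (ws v : V) del : 0 < del ->
  (forall x, [set v | exists xs : nat -> 'rV[R]_d,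
    [/\ xs @ \oo --> ws, forall k, differentiable f (xs k) &
        grad f (xs k) @[k --> \oo] --> v]] x -> del <= dotv v x) ->
  exists2 rho : R, 0 < rho & forall y, `|y - ws| < rho -> differentiable f y ->
    del / 2 <= dotv v (grad f y).
Proof.
move=> del0 Hdel; apply: contrapT => nrho.
have Hn (n : nat) : exists y, `|y - ws| < n.+1%:R^-1 /\ differentiable f y /\ dotv v (grad f y) < del / 2.
  apply: contrapT => ny; apply: nrho; exists n.+1%:R^-1; first by rewrite invr_gt0.
  move=> y yws dfy; rewrite leNgt; apply/negP => yd; apply: ny; by exists y.
have [ys Hys] := choice Hn.
pose A : set V := [set x | `|x| <= K].
have cA : compact A.
  apply: bounded_closed_compact.
    by exists K; split; [exact: num_real|move=> M KM x /le_trans; apply; exact: ltW].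
  rewrite (_ : A = (fun x : V => `|x|) @^-1` [set y | y <= K])//.
  apply: closed_comp; last exact: closed_le.
  by move=> x _; exact: norm_continuous.
have [xi [_ xi_cl]] : A `&` cluster (grad f (ys n) @[n --> \oo]) !=set0.
  by apply: cA; exists 0%N => // n _; apply: grad_le; exact: (Hys n).2.1.
have Hk (k : nat) : exists n, (k <= n)%N /\ `|grad f (ys n) - xi| < k.+1%:R^-1.
  have := xi_cl ((fun n => grad f (ys n)) @` [set n | (k <= n)%N]) (ball xi k.+1%:R^-1) _ _.
  case.
  - by exists k => // n kn; exists n.
  - by apply: nbhsx_ballx; rewrite invr_gt0.
  move=> _ [[n kn <-]]; rewrite -ball_normE /= distrC => xin.
  by exists n.
have [nk Hnk] := choice Hk.
have cvg_inv (u : nat -> V) l : (forall k, `|u k - l| <= k.+1%:R^-1) -> u @ \oo --> l.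
  move=> ul; apply: ((@cvgrPdist_lt _ V _ \oo eventually_filter u l).2) => eps eps0; near=> k.
  rewrite distrC (le_lt_trans (ul k))//; near: k.
  exact: (near_infty_natSinv_lt (PosNum eps0)).
have xs_cvg : (fun k => ys (nk k)) @ \oo --> ws.
  apply: cvg_inv => k; apply: ltW; apply: lt_le_trans (Hys (nk k)).1 _.
  by rewrite lef_pV2 ?posrE// ler_nat ltnS (Hnk k).1.
have g_cvg : grad f (ys (nk k)) @[k --> \oo] --> xi.
  by apply: (cvg_inv (fun k => grad f (ys (nk k)))) => k; exact: ltW (Hnk k).2.
have : del <= dotv v xi.
  by apply: Hdel; exists (fun k => ys (nk k)); split => // k; exact: (Hys (nk k)).2.1.
apply/negP; rewrite -ltNge; apply: (@le_lt_trans _ _ (del / 2)); last lra.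
have dcvg : dotv v (grad f (ys (nk k))) @[k --> \oo] --> dotv v xi.
  have dc : continuous (fun z : V => dotv v z).
    apply: (@lip_continuous _ _ (d%:R * `|v|)) => x z.
    by rewrite dotvC (dotvC v) -dotvBl; exact: dotv_le.
  exact: (continuous_cvg _ (dc xi) g_cvg).
apply: (cvgr_to_le dcvg); apply: nearW => k; exact: ltW (Hys (nk k)).2.2.
Unshelve. all: by end_near. Qed.

(** A vector that separates [0] from the limiting gradients at [ws] separates it from
    the gradients of [f] near [ws], hence from those of its smoothings, which
    come close to [0] along the sequence. *)
Theorem clarke_stationary (alpha : nat -> R) (x : nat -> V) (ws : V) :
  (forall k, 0 < alpha k) -> alpha @ \oo --> (0 : R) ->
  norm2 (grad (smoothing (alpha k) f) (x k)) @[k --> \oo] --> (0 : R) ->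
  cluster (x k @[k --> \oo]) ws ->
  dist2 0 (clarke f ws) = 0%E.
Proof.
move=> a0 a_cvg g_cvg x_cl.
pose A : set V := [set v : V | exists xs : nat -> V, [/\ xs @ \oo --> ws, forall k, differentiable f (xs k) &
        grad f (xs k) @[k --> \oo] --> v]].
(* it suffices that no [v] separates 0 from the limiting gradients *)
suff nosep (v : V) (del : R) : 0 < del -> ~ (forall z, A z -> del <= dotv v z).
  have A_K z : A z -> `|z| <= K.
    move=> [xs [_ dxs /cvg_norm gz]]; apply: (cvgr_to_le gz).
    by apply: nearW => k; exact: grad_le.
  have cH : @convex_set R V (convex_hull A).
    move=> z1 z2 t; rewrite !inE => H1 H2 M [cM AM].
    have := cM z1 z2 t; rewrite !inE; apply; [exact: H1|exact: H2].
  have AH : A `<=` convex_hull A by exact: sub_smallest.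
  have H0 : convex_hull A !=set0.
    apply: contrapT => H0; apply: (nosep 0 1 ltr01) => z Az.
    by exfalso; apply: H0; exists z; exact: AH.
  apply/eqP; rewrite eq_le; apply/andP; split; last first.
    by apply: le_ereal_inf_tmp => _ [z _ <-]; rewrite lee_fin norm2_ge0.
  rewrite leNgt; apply/negP => dist_gt0.
  have [r r0 Hr] : exists2 r : R, 0 < r & forall z, convex_hull A z -> r <= norm2 z.
    have Hd z : convex_hull A z -> (dist2 0 (clarke f ws) <= (norm2 z)%:E)%E.
      by move=> Hz; apply: ereal_inf_lbound; exists z => //; rewrite sub0r norm2N.
    move: dist_gt0 Hd; case: (dist2 _ _) => [r| |] //; first by rewrite lte_fin => r0 Hd; exists r.
    by have [z Hz] := H0; move=> _ /(_ z Hz); rewrite leye_eq.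
  have [v [del del0 Hdel]] := convex_separation K cH H0 r0 Hr.
  by apply: (nosep v del del0) => z Az; apply: Hdel; [exact: AH|exact: A_K].
move=> del0 /(separated_near del0)[rho rho0 Hrho].
have eps0 : 0 < del / 2 / (d%:R * `|v| + 1).
  by rewrite !divr_gt0// ltr_wpDl// mulr_ge0.
move/cvgrPdist_lt : g_cvg => /(_ _ eps0) Hg.
have rho20 : 0 < rho / 2 by rewrite divr_gt0.
move/cvgrPdist_lt : a_cvg => /(_ _ rho20) Ha.
have [N _ HN] : \forall k \near \oo, `|0 - norm2 (grad (smoothing (alpha k) f) (x k))| < del / 2 / (d%:R * `|v| + 1) /\ `|0 - alpha k| < rho / 2.
  by near=> k; split; near: k.
have [] := x_cl (x @` [set k | (N <= k)%N]) (ball ws (rho / 2)).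
- by exists N => // k Nk; exists k.
- exact: nbhsx_ballx.
move=> _ [[k Nk <-]]; rewrite -ball_normE /= => xk.
have [gk ak] := HN k Nk.
have : del / 2 <= dotv v (grad (smoothing (alpha k) f) (x k)).
  apply: grad_smoothing_ge => // y yx dfy; apply: Hrho => //.
  rewrite -(subrK (x k) y) -addrA (le_lt_trans (ler_normD _ _))//.
  rewrite [ltRHS]splitr; apply: ler_ltD; last by rewrite distrC.
  move: ak; rewrite sub0r normrN (gtr0_norm (a0 k)) => /ltW; exact: le_trans.
apply/negP; rewrite -ltNge (le_lt_trans (ler_norm _))// dotvC (le_lt_trans (dotv_le _ _))//.
move: gk; rewrite sub0r normrN ger0_norm ?norm2_ge0// ltr_pdivlMr ?ltr_wpDl ?mulr_ge0//.
apply: le_lt_trans; rewrite mulrC; apply: ler_pM => //; rewrite ?mulr_ge0//.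
  exact: norm_le_norm2.
by rewrite lerDl.
Unshelve. all: by end_near. Qed.

End clarke.

(** * Joint laws, independence and sub-sigma-algebras *)

Section laws.
Context {dO : measure_display} {O : measurableType dO} {R : realType}.
Context (P : probability O R).

(** Rectangles generate the product sigma-algebra. The events [E] and [E'] can hold
    conditions on further variables, so that several coordinates can be treated
    in stages. *)
Lemma joint_law d1 d2 (T1 : measurableType d1) (T2 : measurableType d2)
    (E E' : set O) (X X' : O -> T1) (Y Y' : O -> T2) :
  measurable E -> measurable E' ->
  measurable_fun setT X -> measurable_fun setT X' ->
  measurable_fun setT Y -> measurable_fun setT Y' ->
  (forall A B, measurable A -> measurable B ->
    P (E `&` X @^-1` A `&` Y @^-1` B) = P (E' `&` X' @^-1` A `&` Y' @^-1` B)) ->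
  forall S, measurable S ->
    P (E `&` [set o | S (X o, Y o)]) = P (E' `&` [set o | S (X' o, Y' o)]).
Proof.
move=> mE mE' mX mX' mY mY' H S mS.
have mXY := measurable_fun_pair mX mY; have mXY' := measurable_fun_pair mX' mY'.
pose m1 := pushforward (mrestr P mE) (fun o => (X o, Y o)).
pose m2 := pushforward (mrestr P mE') (fun o => (X' o, Y' o)).
suff : m1 S = m2 S.
  by rewrite /m1 /m2 /pushforward /mrestr => H12; rewrite setIC H12 setIC.
pose G := [set A `*` B | A in @measurable _ T1 & B in @measurable _ T2].
apply: (@measure_unique _ _ _ G (fun=> setT)) => //.
- exact: measurable_prod_measurableType.
- move=> _ _ [A mA [B mB <-]] [A' mA' [B' mB' <-]].
  by exists (A `&` A'); [exact: measurableI|exists (B `&` B'); [exact: measurableI|rewrite setXI]].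
- by move=> n; exists setT => //; exists setT => //; rewrite setXTT.
- by rewrite bigcup_const.
- move=> _ [A mA [B mB <-]].
  have := H A B mA mB; rewrite /m1 /m2 /pushforward /mrestr.
  rewrite -!setIA [E `&` _]setIC [E' `&` _]setIC; exact.
- move=> n; rewrite /m1 /pushforward /mrestr.
  by apply: (@le_lt_trans _ _ 1%E); [apply: probability_le1; rewrite preimage_setT setTI|exact: ltry].
Qed.

(** The product rule is used with the image of [k] as index set. *)
Lemma independent_sub m (Gs : seq (set (set O))) (k : 'I_m -> nat) (B : 'I_m -> set O) :
  independent P Gs -> injective k -> (forall j, (k j < size Gs)%N) ->
  (forall j, nth set0 Gs (k j) (B j)) ->
  P (\bigcap_j B j) = (\prod_j P (B j))%E.
Proof.
move=> ind kinj kG GB.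
pose F j : 'I_(size Gs) := Ordinal (kG j).
have Finj : injective F by move=> i j /(congr1 val) /kinj.
pose A (i : 'I_(size Gs)) : set O := if [pick j | F j == i] is Some j then B j else set0.
have AF j : A (F j) = B j.
  rewrite /A; case: pickP => [j' /eqP /Finj ->//|/(_ j)].
  by rewrite eqxx.
have := ind [set F j | j in 'I_m]%SET A.
rewrite big_imset/=; last by move=> i j _ _ /Finj.
under eq_bigr do rewrite AF.
rewrite (_ : \bigcap_(i in _) A i = \bigcap_j B j).
  by apply=> _ /imsetP[j _ ->]; rewrite AF; exact: GB.
apply/seteqP; split=> o Ho.
  by move=> j _; rewrite -AF; apply: Ho => /=; apply/imsetP; exists j.
by move=> i /= /imsetP[j _ ->]; rewrite AF; exact: Ho.
Qed.

Lemma independent4 (Gs : seq (set (set O))) (k0 k1 k2 k3 : nat) (B0 B1 B2 B3 : set O) :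
  independent P Gs -> uniq [:: k0; k1; k2; k3] ->
  all (fun k => k < size Gs)%N [:: k0; k1; k2; k3] ->
  nth set0 Gs k0 B0 -> nth set0 Gs k1 B1 -> nth set0 Gs k2 B2 -> nth set0 Gs k3 B3 ->
  P (B0 `&` B1 `&` B2 `&` B3) = (P B0 * P B1 * P B2 * P B3)%E.
Proof.
move=> ind uk sk G0 G1 G2 G3.
pose k (j : 'I_4) := nth 0%N [:: k0; k1; k2; k3] j.
pose B (j : 'I_4) := nth set0 [:: B0; B1; B2; B3] j.
have := @independent_sub 4 Gs k B ind.
rewrite !big_ord_recr big_ord0 /= mul1e => <-.
- congr (P _); apply/seteqP; split=> o.
    by move=> [[[? ?] ?] ?] [[|[|[|[|//]]]] ?] _.
  move=> Ho; split; [split; [split|]|].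
  + exact: (Ho (@Ordinal 4 0 isT) I).
  + exact: (Ho (@Ordinal 4 1 isT) I).
  + exact: (Ho (@Ordinal 4 2 isT) I).
  + exact: (Ho (@Ordinal 4 3 isT) I).
- by move=> i j /eqP; rewrite nth_uniq ?ltn_ord// => /eqP/val_inj.
- by move=> j; apply: (allP sk); rewrite mem_nth ?ltn_ord.
- by move=> [[|[|[|[|//]]]] ?].
Qed.

End laws.

Section sub_sigma_algebra.
Context {dO : measure_display} {O : measurableType dO} (G : set (set O)).

(** Gives access to the closure properties of measurable functions, on the type
    that carries the sigma-algebra [<<s G >>]. *)
Lemma measurable_wrt_sigma d (T : measurableType d) (X : O -> T) :
  measurable_wrt <<s G >> X <-> measurable_fun setT (X : g_sigma_algebraType G -> T).
Proof.
split=> [GX _ B mB|mX _ [B mB <-]]; last exact: mX.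
by rewrite setTI; apply: GX; exists B => //; rewrite setTI.
Qed.

Lemma measurable_sub_sigma d (T : measurableType d) (X : O -> T) :
  G `<=` measurable -> measurable_fun setT (X : g_sigma_algebraType G -> T) ->
  measurable_fun setT X.
Proof.
move=> Gm mX _ B mB; have := mX measurableT B mB.
by apply: smallest_sub => //; exact: sigma_algebra_measurable.
Qed.

End sub_sigma_algebra.

(** * Exchange of variables with the same law, centred variables *)

Section exchange.
Context {dO : measure_display} {O : measurableType dO} {R : realType}.
Context (P : probability O R).

Lemma eq_law_integral d (T : measurableType d) (A : set O) (Z Z' : O -> T) (k : T -> \bar R) :
  measurable A -> measurable_fun setT Z -> measurable_fun setT Z' ->
  (forall B, measurable B -> P (A `&` Z @^-1` B) = P (A `&` Z' @^-1` B)) ->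
  measurable_fun setT k ->
  (\int[P]_(o in A) k (Z o) = \int[P]_(o in A) k (Z' o))%E.
Proof.
move=> mA mZ mZ' H mk.
have ge0 (l : T -> \bar R) : measurable_fun setT l -> (forall x, (0 <= l x)%E) ->
    (\int[P]_(o in A) l (Z o) = \int[P]_(o in A) l (Z' o))%E.
  move=> ml l0.
  rewrite -(ge0_integral_mrestr P mA (measurableT_comp ml mZ)); last by move=> o; exact: l0.
  rewrite -(ge0_integral_mrestr P mA (measurableT_comp ml mZ')); last by move=> o; exact: l0.
  have := ge0_integral_pushforward mZ (mrestr P mA) measurableT ml (fun x _ => l0 x).
  have := ge0_integral_pushforward mZ' (mrestr P mA) measurableT ml (fun x _ => l0 x).
  rewrite !preimage_setT => <- <-.
  apply: eq_measure_integral => B mB _; rewrite /pushforward /mrestr.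
  by have := H B mB; rewrite ![A `&` _]setIC.
have E (Z0 : O -> T) : (\int[P]_(o in A) k (Z0 o) =
    \int[P]_(o in A) k^\+ (Z0 o) - \int[P]_(o in A) k^\- (Z0 o))%E.
  apply: (etrans (integralE P A (k \o Z0))); congr (_ - _)%E; apply: eq_integral => o _.
    by rewrite !funeposE.
  by rewrite !funenegE.
rewrite !E; congr (_ - _)%E.
  exact: (ge0 (k^\+)%E (measurable_funepos mk) (fun x => funepos_ge0 k x)).
exact: (ge0 (k^\-)%E (measurable_funeneg mk) (fun x => funeneg_ge0 k x)).
Qed.

Section law4.
Context d1 d2 d3 d4 (T1 : measurableType d1) (T2 : measurableType d2)
  (T3 : measurableType d3) (T4 : measurableType d4).
Variables (past : set (set O)) (W : O -> T1) (U : O -> T2).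
Variables (X X' : O -> T3) (Y Y' : O -> T4).
Hypotheses (mpast : past `<=` measurable)
  (mW : measurable_fun setT W) (mU : measurable_fun setT U)
  (mX : measurable_fun setT X) (mX' : measurable_fun setT X')
  (mY : measurable_fun setT Y) (mY' : measurable_fun setT Y').
Hypothesis pastW : forall A B, past A -> measurable B -> past (A `&` W @^-1` B).
Hypothesis H : forall A B C D, past A -> measurable B -> measurable C -> measurable D ->
  P (A `&` U @^-1` B `&` X @^-1` C `&` Y @^-1` D) =
  P (A `&` U @^-1` B `&` X' @^-1` C `&` Y' @^-1` D).

Let mpre d (T : measurableType d) (Z : O -> T) B :
  measurable_fun setT Z -> measurable B -> measurable (Z @^-1` B).
Proof. by move=> mZ mB; rewrite -[X in measurable X]setTI; exact: mZ. Qed.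

(** The identity extends from rectangles to all measurable sets by one application
    of [joint_law] for each coordinate. Conditions on [W] are events of the past,
    so they are absorbed in [A]. *)
Lemma exchange_law A S : past A -> measurable S ->
  P (A `&` [set o | S (W o, U o, X o, Y o)]) = P (A `&` [set o | S (W o, U o, X' o, Y' o)]).
Proof.
move=> pA; have mA := mpast pA.
have mWU := measurable_fun_pair mW mU.
move: S; apply: joint_law => //; [exact: measurable_fun_pair|exact: measurable_fun_pair|].
move=> S D mS mD.
rewrite -!setIA ![_ `&` Y @^-1` D]setIC ![_ `&` Y' @^-1` D]setIC !setIA.
move: S mS; apply: (joint_law (E := A `&` Y @^-1` D) (E' := A `&` Y' @^-1` D)) => //.
- by apply: measurableI => //; exact: mpre.
- by apply: measurableI => //; exact: mpre.
move=> S C mS mC.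
have perm E0 E1 E2 E3 : E0 `&` E1 `&` E2 `&` E3 = E0 `&` E3 `&` E1 `&` E2 :> set O.
  by rewrite -!setIA; congr (_ `&` _); rewrite setIA setIC.
apply: (etrans (congr1 P (perm _ _ _ _))); apply: (etrans _ (esym (congr1 P (perm _ _ _ _)))).
move: S mS; apply: (joint_law (E := A `&` X @^-1` C `&` Y @^-1` D) (E' := A `&` X' @^-1` C `&` Y' @^-1` D)) => //.
- by apply: measurableI; [apply: measurableI => //; exact: mpre|exact: mpre].
- by apply: measurableI; [apply: measurableI => //; exact: mpre|exact: mpre].
move=> B1 B2 mB1 mB2.
have h := H (pastW pA mB1) mB2 mC mD.
have perm2 E0 E1 E2 E3 E4 : E0 `&` E1 `&` E2 `&` E3 `&` E4 = E0 `&` E3 `&` E4 `&` E1 `&` E2 :> set O.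
  by rewrite -!setIA; congr (_ `&` _); rewrite setIA setIC -!setIA.
apply: (etrans (congr1 P (esym (perm2 _ _ _ _ _)))); apply: (etrans h).
exact: (congr1 P (perm2 _ _ _ _ _)).
Qed.

End law4.

End exchange.

Section zero_mean.
Context {dO : measure_display} {O : measurableType dO} {R : realType}.
Context (P : probability O R) (G : set (set O)).
Hypothesis mG : <<s G >> `<=` measurable.
Implicit Types (D Z : O -> R).

(** The conditional expectation given [G] is [0], in integrated form. *)
Definition zero_mean D := P.-integrable setT (EFin \o D) /\
  forall A, <<s G >> A -> (\int[P]_(o in A) (D o)%:E = 0)%E.

Let mZ_ Z : measurable_wrt <<s G >> Z -> measurable_fun setT Z.
Proof.
by move=> /measurable_wrt_sigma; apply: measurable_sub_sigma => B GB; apply: mG; exact: sub_sigma_algebra.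
Qed.

Lemma bounded_mul_integrable D Z C A : P.-integrable setT (EFin \o D) -> measurable_fun setT Z ->
  (forall o, `|Z o| <= C) -> measurable A -> P.-integrable A (EFin \o (fun o => Z o * D o)).
Proof.
move=> iD mZ ZC mA; apply: (integrableS measurableT) => //.
apply: (@le_integrable _ _ _ _ _ measurableT _ (fun o => (C * D o)%:E)).
- apply/measurable_EFinP; apply: measurable_funM => //.
  by apply/measurable_EFinP; exact: measurable_int iD.
- move=> o _; rewrite !abse_EFin lee_fin !normrM ler_wpM2r//.
  exact: le_trans (ZC o) (ler_norm _).
- by have := integrableZl measurableT C iD.
Qed.

(** The sum is the integer part of [x]. It approximates a bounded function by sums
    of indicators. *)
Lemma sum_floor (x : R) (N : nat) : 0 <= x -> x <= N%:R ->
  `|x - \sum_(j < N) (j.+1%:R <= x)%R%:R| <= 1.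
Proof.
move=> x0 xN; pose t := Num.truncn x.
have /andP[t1 t2] := truncn_itv x0.
have tN : (t <= N)%N by rewrite -(@ler_nat R) (le_trans t1).
have -> : \sum_(j < N) (j.+1%:R <= x)%R%:R = t%:R :> R.
  under eq_bigr do rewrite -truncn_ge_nat//.
  rewrite -natr_sum; congr (_%:R).
  rewrite -(big_mkord xpredT (fun j => nat_of_bool (j < t)%N)) (big_cat_nat (leq0n t) tN)//=.
  rewrite [X in (X + _)%N](eq_big_nat _ _ (F2 := fun=> 1%N)); last by move=> i /= ->.
  rewrite [X in (_ + X)%N](_ : _ = 0%N) ?addn0; last first.
    rewrite big_nat_cond big1// => i; rewrite andbT => /andP[ti _].
    by rewrite ltnNge ti.
  by rewrite sum_nat_const_nat muln1 subn0.
by rewrite ger0_norm ?subr_ge0// lerBlDl natr1 ltW.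
Qed.

Lemma zero_mean_indic D B A : zero_mean D -> <<s G >> B -> <<s G >> A ->
  (\int[P]_(o in A) (\1_B o * D o)%:E = 0)%E.
Proof.
move=> [iD D0] GB GA.
rewrite -(D0 (A `&` B)); last first.
  exact: (@measurableI _ (g_sigma_algebraType G) A B GA GB).
rewrite integral_mkcondr; apply: eq_integral => o _.
by rewrite patchE indicE; case: ifP => _; rewrite ?mul1r ?mul0r.
Qed.

(** A bounded measurable factor is a uniform limit of combinations of indicators of
    sets of [<<s G >>], and for an indicator the claim is the definition. *)
Lemma zero_mean_mul D Z C : zero_mean D -> measurable_wrt <<s G >> Z ->
  (forall o, `|Z o| <= C) -> zero_mean (fun o => Z o * D o).
Proof.
move=> zD GZ ZC; have [iD D0] := zD; have mZ := mZ_ GZ.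
have iZ A : measurable A -> P.-integrable A (EFin \o (fun o => Z o * D o)).
  by move=> mA; exact: bounded_mul_integrable ZC mA.
split; first exact: iZ.
move=> A GA; have mA := mG GA.
pose M := \int[P]_(o in A) `|D o|.
have iDA : P.-integrable A (EFin \o D) by exact: (integrableS measurableT).
suff H (n : nat) : `|\int[P]_(o in A) (Z o * D o)| <= n.+1%:R^-1 * M.
  have fin := integrable_fin_num mA (iZ A mA).
  rewrite -(fineK fin); congr EFin; apply/eqP; rewrite -normr_le0.
  have cvgM : (n.+1%:R^-1 * M) @[n --> \oo] --> (0 : R).
    by rewrite -[X in _ --> X](mul0r M); apply: cvgMl; exact: cvg_harmonic.
  by apply: (cvgr_to_ge cvgM); apply: nearW => n; exact: H.
pose N := (Num.truncn (2 * C * n.+1%:R)).+1.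
pose B j := [set o | j.+1%:R <= (Z o + C) * n.+1%:R].
have GB j : <<s G >> (B j).
  have mZG : measurable_fun setT (Z : g_sigma_algebraType G -> R) by apply/measurable_wrt_sigma.
  rewrite (_ : B j = Z @^-1` `[j.+1%:R / n.+1%:R - C, +oo[).
    by have := mZG measurableT _ (measurable_itv `[j.+1%:R / n.+1%:R - C, +oo[); rewrite setTI.
  by apply/seteqP; split=> o; rewrite /B /= in_itv/= andbT lerBlDr ler_pdivrMr.
pose Zn o := \sum_(j < N) n.+1%:R^-1 * \1_(B j) o - C.
have ZZn o : `|Z o - Zn o| <= n.+1%:R^-1.
  have := ZC o; rewrite ler_norml => /andP[z1 z2].
  have n0 : 0 < n.+1%:R :> R by rewrite ltr0n.
  have x0 : 0 <= (Z o + C) * n.+1%:R by rewrite mulr_ge0//; lra.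
  have xN : (Z o + C) * n.+1%:R <= N%:R.
    apply: (@le_trans _ _ (2 * C * n.+1%:R)); last exact: ltW (truncnS_gt _).
    by rewrite ler_pM2r//; lra.
  have SB : \sum_(j < N) \1_(B j) o = \sum_(j < N) (j.+1%:R <= (Z o + C) * n.+1%:R)%R%:R :> R.
    apply: eq_bigr => j _; rewrite indicE; congr (nat_of_bool _)%:R.
    by apply/idP/idP; rewrite inE.
  have -> : Z o - Zn o = n.+1%:R^-1 * ((Z o + C) * n.+1%:R - \sum_(j < N) \1_(B j) o).
    rewrite (_ : Zn o = n.+1%:R^-1 * \sum_(j < N) \1_(B j) o - C); last by rewrite /Zn mulr_sumr.
    by move: n0; set q : R := n.+1%:R => n0; field; rewrite gt_eqF.
  rewrite normrM ger0_norm ?invr_ge0// ler_piMr ?invr_ge0// SB.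
  exact: sum_floor.
have mZn : measurable_fun setT Zn.
  apply: measurable_funB; last exact: measurable_cst.
  apply: measurable_sum => j; apply: measurable_funM; first exact: measurable_cst.
  exact: measurable_indic (mG (GB j)).
have iB j : P.-integrable A (fun o => (\1_(B j) o * D o)%:E).
  apply: (@bounded_mul_integrable D (\1_(B j)) 1) => //.
    exact: measurable_indic (mG (GB j)).
  by move=> o; rewrite indicE; case: (_ \in _); rewrite ?normr1 ?normr0.
have iZn : P.-integrable A (EFin \o (fun o => Zn o * D o)).
  apply: (@bounded_mul_integrable D Zn (C + 1)) => // o.
  rewrite -(subrK (Z o) (Zn o)) addrC (le_trans (ler_normD _ _))// lerD// distrC.
  by rewrite (le_trans (ZZn o))// invf_le1// ler1n.
have Zn0 : \int[P]_(o in A) (Zn o * D o) = 0.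
  rewrite /Rintegral (_ : integral _ _ _ = 0%E)//.
  transitivity (\int[P]_(o in A) (\sum_(j < N) ((n.+1%:R^-1)%:E * (\1_(B j) o * D o)%:E) - C%:E * (D o)%:E))%E.
    apply: eq_integral => o _; rewrite /Zn mulrBl EFinB mulr_suml -sumEFin.
    by congr (_ - _)%E; apply: eq_bigr => j _; rewrite -mulrA EFinM.
  have iS j : P.-integrable A (fun o => (n.+1%:R^-1)%:E * (\1_(B j) o * D o)%:E)%E.
    exact: integrableZl.
  rewrite integralB//; [|exact: integrable_sum|exact: integrableZl].
  rewrite integral_sum// big1; last first.
    by move=> j _; rewrite integralZl// zero_mean_indic// mule0.
  by rewrite integralZl// D0// mule0 sube0.
rewrite -[X in `|X|]subr0 -Zn0 -RintegralB//; last exact: iZ.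
have iZZn : P.-integrable A (EFin \o (fun o => Z o * D o - Zn o * D o)).
  by have := integrableB mA (iZ A mA) iZn; exact.
apply: (le_trans (le_normr_Rintegral mA iZZn)).
have iaD : P.-integrable A (EFin \o (fun o => `|D o|)) by exact: integrable_norm iDA.
rewrite -RintegralZl//; apply: le_Rintegral => //.
- exact: integrable_norm iZZn.
- by have := integrableZl mA n.+1%:R^-1 iaD; exact.
- by move=> o _; rewrite -mulrBl normrM ler_wpM2r.
Qed.

End zero_mean.

(** * Almost supermartingales *)

Section almost_supermartingale.
Context {dO : measure_display} {O : measurableType dO} {R : realType}.
Context (P : probability O R).
Implicit Types (X Y Z r m : O -> R) (A : set O).

(** The integral of [X] may be infinite and [m] has no sign, so the negative part of
    [m] is moved to the other side before integrating. *)
Lemma integral_step A X X' Y r m : measurable A ->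
  measurable_fun setT X -> measurable_fun setT X' -> measurable_fun setT Y ->
  measurable_fun setT r -> (forall o, 0 <= X o) -> (forall o, 0 <= X' o) ->
  (forall o, 0 <= Y o) -> (forall o, 0 <= r o) ->
  P.-integrable A (EFin \o m) -> (\int[P]_(o in A) (m o)%:E = 0)%E -> measurable_fun setT m ->
  {ae P, forall o, X' o + Y o <= X o + m o + r o} ->
  (\int[P]_(o in A) (X' o)%:E + \int[P]_(o in A) (Y o)%:E <=
   \int[P]_(o in A) (X o)%:E + \int[P]_(o in A) (r o)%:E)%E.
Proof.
move=> mA mX mX' mY mr X0 X'0 Y0 r0 im m0 mm H.
pose p o : R := Num.max (m o) 0; pose n o : R := Num.max (- m o) 0.
have p0 o : 0 <= p o by rewrite le_max lexx orbT.
have n0 o : 0 <= n o by rewrite le_max lexx orbT.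
have pn o : p o - n o = m o.
  rewrite /p /n; case: (boolP (0 <= m o)) => [m_ge|]; last rewrite -ltNge => m_lt.
    have nm : - m o <= 0 by rewrite oppr_le0.
    by rewrite (max_idPl m_ge) (max_idPr nm) subr0.
  have nm : 0 <= - m o by rewrite oppr_ge0 ltW.
  by rewrite (max_idPr (ltW m_lt)) (max_idPl nm) sub0r opprK.
have mE (g : O -> R) : measurable_fun setT g -> measurable_fun A (fun o => (g o)%:E).
  by move=> mg; apply: measurable_funTS; apply/measurable_EFinP.
have mp : measurable_fun setT p by apply: measurable_maxr.
have mn : measurable_fun setT n by apply: measurable_maxr => //; exact: measurable_funN.
have ip : P.-integrable A (fun o => (p o)%:E).
  apply: (le_integrable mA _ _ im); first exact: mE.
  move=> o _; rewrite /= lee_fin (ger0_norm (p0 o)) /p ge_max normr_ge0 andbT.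
  exact: ler_norm.
have ni : P.-integrable A (fun o => (n o)%:E).
  apply: (le_integrable mA _ _ im); first exact: mE.
  move=> o _; rewrite /= lee_fin (ger0_norm (n0 o)) /n ge_max normr_ge0 andbT.
  by rewrite -normrN ler_norm.
have pnE : (\int[P]_(o in A) (p o)%:E = \int[P]_(o in A) (n o)%:E)%E.
  have fp : (\int[P]_(o in A) (p o)%:E)%E \is a fin_num by exact: integrable_fin_num.
  have fn : (\int[P]_(o in A) (n o)%:E)%E \is a fin_num by exact: integrable_fin_num.
  have : (\int[P]_(o in A) (p o)%:E - \int[P]_(o in A) (n o)%:E = 0)%E.
    rewrite -integralB// -[RHS]m0.
    by apply: eq_integral => o _; rewrite -EFinB pn.
  by move/eqP; rewrite sube_eq ?fin_num_adde_defl// add0e => /eqP.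
have fin : (\int[P]_(o in A) (n o)%:E)%E \is a fin_num by exact: integrable_fin_num.
have E3 (f g h : O -> R) : measurable_fun setT f -> measurable_fun setT g -> measurable_fun setT h ->
    (forall o, 0 <= f o) -> (forall o, 0 <= g o) -> (forall o, 0 <= h o) ->
    (\int[P]_(o in A) (f o + g o + h o)%:E =
     \int[P]_(o in A) (f o)%:E + \int[P]_(o in A) (g o)%:E + \int[P]_(o in A) (h o)%:E)%E.
  move=> mf mg mh f0 g0 h0.
  under eq_integral do rewrite EFinD EFinD.
  rewrite ge0_integralD//; [|by move=> o _; rewrite -EFinD lee_fin addr_ge0| |by move=> o _; rewrite lee_fin|exact: mE].
    rewrite ge0_integralD//; [by move=> o _; rewrite lee_fin|exact: mE|by move=> o _; rewrite lee_fin|exact: mE].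
  by apply: emeasurable_funD; exact: mE.
rewrite -(@leeD2rE _ _ _ _ fin) -{2}pnE -!E3//.
apply: ae_ge0_le_integral => //.
- by move=> o _; rewrite lee_fin !addr_ge0.
- by apply: mE; apply: measurable_funD => //; exact: measurable_funD.
- by move=> o _; rewrite lee_fin !addr_ge0.
- by apply: mE; apply: measurable_funD => //; exact: measurable_funD.
case: H => N [mN N0 HN]; exists N; split => // o no; apply: HN => Ho; apply: no => _.
rewrite lee_fin; move: Ho (pn o) => /=; move: (p o) (n o) (m o) => po no mo Ho pno; lra.
Qed.

Lemma telescope_sums (I J : nat -> \bar R) (s : nat -> R) : (forall k, 0 <= I k)%E ->
  (forall k, I k.+1 + J k <= I k + (s k)%:E)%E ->
  forall n, (\sum_(k < n) J k <= I 0%N + (\sum_(k < n) s k)%:E)%E.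
Proof.
move=> I0 IJ n.
suff : (I n + \sum_(k < n) J k <= I 0%N + (\sum_(k < n) s k)%:E)%E.
  by apply: le_trans; rewrite leeDr.
elim: n => [|n IH]; first by rewrite !big_ord0 !adde0.
rewrite !big_ord_recr/= EFinD.
apply: (@le_trans _ _ (I n + \sum_(k < n) J k + (s n)%:E)%E); last first.
  by rewrite [leRHS]addeA; exact: leeD2r.
have -> : (I n + \sum_(k < n) J k + (s n)%:E = \sum_(k < n) J k + (I n + (s n)%:E))%E.
  by rewrite addeAC addeC.
by rewrite addeCA; exact: leeD2l.
Qed.

(** By monotone convergence the sum of the series is integrable on [A], hence
    finite almost everywhere on [A]. *)
Lemma ae_bounded_sums A (h : nat -> O -> R) (B : R) : measurable A ->
  (forall k, measurable_fun setT (h k)) -> (forall k o, 0 <= h k o) ->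
  (forall n, \sum_(k < n) \int[P]_(o in A) (h k o)%:E <= B%:E)%E ->
  {ae P, forall o, A o -> exists b, forall n, \sum_(k < n) h k o <= b}.
Proof.
move=> mA mh h0 HB.
pose S o := (\sum_(0 <= k <oo) (h k o)%:E)%E.
have mhA k : measurable_fun A (fun o => (h k o)%:E).
  by apply: measurable_funTS; apply/measurable_EFinP.
have h0' k o : A o -> (0 <= (h k o)%:E)%E by rewrite lee_fin.
have mS : measurable_fun A S.
  apply: (@ge0_emeasurable_sum _ _ _ A (fun k o => (h k o)%:E) xpredT) => [k o Ao _|k _]; [exact: h0'|exact: mhA].
have S0 o : (0 <= S o)%E by apply: nneseries_ge0 => k _ _; rewrite lee_fin.
have iS : P.-integrable A S.
  apply/integrableP; split => //.
  under eq_integral => o _ do rewrite gee0_abs//.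
  rewrite integral_nneseries//; apply: le_lt_trans (ltry B).
  apply: lime_le; first by apply: is_cvg_nneseries => k _ _; apply: integral_ge0 => o Ao; exact: h0'.
  by apply: nearW => n; rewrite big_mkord.
have [N [mN N0 HN]] := integrable_ae mA iS; exists N; split => // o no; apply: HN => So; apply: no => Ao.
exists (fine (S o)) => n; rewrite -lee_fin fineK; last exact: So Ao.
rewrite -sumEFin -(big_mkord xpredT (fun k => (h k o)%:E)).
by apply: nneseries_lim_ge => k _ _; rewrite lee_fin.
Qed.

End almost_supermartingale.

Section subsequence.
Context {R : realType}.
Implicit Types (c y : nat -> R).

(** If [y] stayed above [eps], the sums of [c k * y k] would dominate [eps] times
    those of [c k]. *)
Lemma frequently_small c y K (b : R) :
  (forall k, (0 < k)%N -> 0 <= c k) -> (forall k, 0 <= y k) ->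
  (\sum_(1 <= k <oo) (c k)%:E = +oo)%E ->
  (forall n, \sum_(k < n) c (K + k)%N * y (K + k)%N <= b) -> (0 < K)%N ->
  forall eps N, 0 < eps -> exists2 k, (N <= k)%N & y k < eps.
Proof.
move=> c0 y0 coo cy K0 eps N eps0; apply: contrapT => nk.
have {}nk k : (N <= k)%N -> eps <= y k.
  by move=> Nk; rewrite leNgt; apply/negP => yk; apply: nk; exists k.
pose M := (N + K)%N.
pose B := \sum_(1 <= k < M) c k + b / eps.
have M1 : (1 <= M)%N by rewrite /M addn_gt0 K0 orbT.
have c_ge0 m n k : (0 < m)%N -> (m <= k < n)%N -> 0 <= c k.
  by move=> m0 /andP[mk _]; apply: c0; exact: leq_trans mk.
have bnd n : \sum_(1 <= k < n) c k <= B.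
  have H1 : \sum_(1 <= k < n) c k <= \sum_(1 <= k < M + n) c k.
    have [n1|n1] := leqP n 1.
      rewrite big_geq// big_nat_cond sumr_ge0// => k; rewrite andbT; exact: c_ge0.
    rewrite (@big_cat_nat _ _ _ n 1 (M + n))//=; [|exact: ltnW|exact: leq_addl].
    rewrite lerDl big_nat_cond sumr_ge0// => k; rewrite andbT; exact/c_ge0/ltnW.
  apply: (le_trans H1); rewrite (@big_cat_nat _ _ _ M 1 (M + n))//=; last exact: leq_addr.
  rewrite lerD2l ler_pdivlMr// mulr_suml.
  apply: (@le_trans _ _ (\sum_(M <= k < M + n) c k * y k)).
    rewrite [leLHS]big_nat_cond [leRHS]big_nat_cond; apply: ler_sum => k; rewrite andbT => kM.
    rewrite ler_wpM2l//; first exact: c_ge0 kM.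
    apply: nk; case/andP: kM => + _; apply: leq_trans; exact: leq_addr.
  apply: le_trans (cy (N + n)%N).
  have -> : \sum_(k < N + n) c (K + k)%N * y (K + k)%N = \sum_(K <= k < M + n) c k * y k.
    transitivity (\sum_(0 + K <= k < M + n) c k * y k); last by rewrite add0n.
    rewrite big_addn -(big_mkord xpredT (fun k => c (K + k)%N * y (K + k)%N)).
    rewrite (_ : (M + n - K = N + n)%N); last by rewrite /M addnAC addnK.
    by apply: eq_bigr => k _; rewrite addnC.
  rewrite (@big_cat_nat _ _ _ M K (M + n))//=; [|exact: leq_addl|exact: leq_addr].
  rewrite lerDr big_nat_cond sumr_ge0// => k; rewrite andbT => kM.
  by rewrite mulr_ge0//; exact: c_ge0 kM.
have : (\sum_(1 <= k <oo) (c k)%:E <= B%:E)%E.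
  apply: lime_le.
    by apply: is_cvg_nneseries => k k1 _; rewrite lee_fin c0.
  by apply: nearW => n; rewrite sumEFin lee_fin.
by rewrite coo leye_eq.
Qed.

Lemma increasing_choice (Q : nat -> nat -> Prop) :
  (forall i N, exists2 k, (N <= k)%N & Q i k) ->
  exists phi : nat -> nat, [/\ (0 < phi 0)%N, forall i, (phi i < phi i.+1)%N & forall i, Q i (phi i)].
Proof.
move=> HQ; have HQ' i N : exists k, (N <= k)%N /\ Q i k by have [k] := HQ i N; exists k.
pose g i N := projT1 (cid (HQ' i N)).
have gP i N : (N <= g i N)%N /\ Q i (g i N) by rewrite /g; case: cid.
pose phi := fix phi i := if i is i'.+1 then g i (phi i').+1 else g 0%N 1%N.
exists phi; split => [|i|[|i]] /=; [exact: (gP _ _).1|exact: (gP _ _).1|exact: (gP _ _).2|exact: (gP _ _).2].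
Qed.

End subsequence.

(** * Conditional expectations *)

Section zero_mean_algebra.
Context {dO : measure_display} {O : measurableType dO} {R : realType}.
Context (P : probability O R) (G : set (set O)).
Hypothesis mG : <<s G >> `<=` measurable.
Implicit Types (D Z : O -> R).

Lemma zero_meanD D D' : zero_mean P G D -> zero_mean P G D' -> zero_mean P G (fun o => D o + D' o).
Proof.
move=> [iD D0] [iD' D'0]; split; first by have := integrableD measurableT iD iD'; exact.
move=> A GA; have mA := mG GA.
have iA := integrableS measurableT mA (@subsetT _ A) iD.
have iA' := integrableS measurableT mA (@subsetT _ A) iD'.
by under eq_integral do rewrite EFinD; rewrite integralD// D0// D'0// adde0.
Qed.

Lemma zero_mean0 : zero_mean P G (fun=> 0).
Proof.
split; last by move=> A GA; rewrite integral0.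
apply: (@bounded_integrable _ _ _ _ _ _ 0) => // [|o _]; rewrite ?normr0//.
exact: (le_lt_trans (probability_le1 P measurableT) (ltry _)).
Qed.

Lemma zero_mean_sum (I : finType) (D : I -> O -> R) :
  (forall i, zero_mean P G (D i)) -> zero_mean P G (fun o => \sum_i D i o).
Proof.
move=> HD; elim: (index_enum I) => [|i s IH].
  by under eq_fun do rewrite big_nil; exact: zero_mean0.
by under eq_fun do rewrite big_cons; exact: zero_meanD.
Qed.

Lemma measurable_wrt_cst (c : R) : measurable_wrt <<s G >> (fun _ : O => c).
Proof. by apply/measurable_wrt_sigma; exact: measurable_cst. Qed.

Lemma zero_meanZ (c : R) D : zero_mean P G D -> zero_mean P G (fun o => c * D o).
Proof.
move=> zD; exact: (@zero_mean_mul _ _ _ P G mG D (fun=> c) `|c| zD (@measurable_wrt_cst c) (fun _ => lexx _)).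
Qed.

End zero_mean_algebra.

(** If the positive or the negative part had an infinite integral, so would the
    function. *)
Lemma integrable_of_fin_num d (T : measurableType d) (R : realType)
    (m : {measure set T -> \bar R}) (D : set T) (f : T -> \bar R) :
  measurable D -> measurable_fun D f ->
  (\int[m]_(x in D) f x)%E \is a fin_num -> m.-integrable D f.
Proof.
move=> mD mf; rewrite integralE => fin; apply/integrableP; split=> //.
have p0 : (0 <= \int[m]_(x in D) f^\+ x)%E by exact: integral_ge0.
have n0 : (0 <= \int[m]_(x in D) f^\- x)%E by exact: integral_ge0.
rewrite (eq_integral (fun x => f^\+ x + f^\- x)%E); last first.
  by move=> x _; rewrite -[RHS]/((f^\+ \+ f^\-)%E x) -fune_abse.
rewrite ge0_integralD//; [|exact: measurable_funepos|exact: measurable_funeneg].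
move: fin p0 n0; case: (integral _ _ _) => [a| |]; case: (integral _ _ _) => [b| |] //=.
by move=> _ _ _; rewrite -EFinD ltry.
Qed.

Section conditional_expectation.
Context {dO : measure_display} {O : measurableType dO} {R : realType}.
Context (P : probability O R) (G : set (set O)).
Hypothesis mG : <<s G >> `<=` measurable.

(** The integral of [Y] over the whole space is that of [X], hence finite. *)
Lemma cond_exp_integrable (X Y : O -> R) : P.-integrable setT (EFin \o X) ->
  is_cond_exp P <<s G >> (EFin \o X) (EFin \o Y) -> P.-integrable setT (EFin \o Y).
Proof.
move=> iX [GY XY].
have mY' : measurable_fun setT ((EFin \o Y) : g_sigma_algebraType G -> \bar R).
  exact/measurable_wrt_sigma.
have mY : measurable_fun setT (EFin \o Y).
  by apply: measurable_sub_sigma mY' => B GB; apply: mG; exact: sub_sigma_algebra.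
apply: (integrable_of_fin_num measurableT mY).
rewrite XY; first exact: integrable_fin_num.
exact: (@measurableT _ (g_sigma_algebraType G)).
Qed.

(** Only an upper bound on [q] is given, so its negative part is discarded before
    integrating. *)
Lemma cond_exp_le (X : O -> \bar R) (q : O -> \bar R) (c : R) A : 0 <= c ->
  is_cond_exp P <<s G >> X q -> {ae P, forall o, (q o <= c%:E)%E} -> <<s G >> A ->
  (\int[P]_(o in A) X o <= c%:E)%E.
Proof.
move=> c0 [Gq Xq] qc GA; have mA := mG GA.
have mq : measurable_fun setT q.
  apply: (@measurable_sub_sigma _ _ G) => [B GB|]; first by apply: mG; exact: sub_sigma_algebra.
  exact/measurable_wrt_sigma.
rewrite -Xq// integralE.
apply: (@le_trans _ _ (\int[P]_(o in A) q^\+ o)%E).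
  by rewrite geeDl// oppe_le0 integral_ge0.
apply: (@le_trans _ _ (\int[P]_(o in A) c%:E)%E); last first.
  rewrite integral_cst//= -[leRHS]mule1 lee_wpmul2l ?lee_fin//; exact: probability_le1.
apply: ae_ge0_le_integral => //.
- by apply: measurable_funTS; exact: measurable_funepos.
case: qc => N [mN N0 HN]; exists N; split => // o no; apply: HN => qo; apply: no => _.
by rewrite funeposE ge_max qo lee_fin.
Qed.

End conditional_expectation.

(** * Descent in mean of one stochastic step *)

Section descent.
Context {dO : measure_display} {O : measurableType dO} {R : realType}.
Context (P : probability O R) (G : set (set O)).
Hypothesis mG : <<s G >> `<=` measurable.
Context {d M : nat} (M0 : (0 < M)%N).
Local Notation V := 'rV[R]_d.
Variables (h : V -> R) (g : V -> V) (K C : R).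
Hypotheses (K0 : 0 <= K) (C0 : 0 <= C) (h0 : forall x, 0 <= h x) (hK : lip K h)
  (gK : forall x, `|g x| <= K) (mg : measurable_fun setT g) (hq : quadratic_at C h g).
Variables (x : O -> V) (z : 'I_M -> O -> V) (zbar e : O -> V) (psi Psi : O -> R).
Hypotheses (Gx : measurable_wrt <<s G >> x) (mz : forall i, measurable_fun setT (z i))
  (me : measurable_fun setT e) (mpsi : measurable_fun setT psi)
  (GPsi : measurable_wrt <<s G >> Psi).
Hypothesis z_mean : forall i j, zero_mean P G (fun o => z i o 0 j - zbar o 0 j).
Hypothesis e_mean : forall j, zero_mean P G (fun o => e o 0 j).
Variables (q2 e2 Psi_inf Psi_sup D eta c1 a : R).
Hypotheses (D0 : 0 <= D) (eta0 : 0 <= eta) (c10 : 0 <= c1) (a0 : 0 <= a)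
  (Psi_inf0 : 0 <= Psi_inf).
Hypothesis z_sqr : forall i A, <<s G >> A -> (\int[P]_(o in A) (norm2 (z i o) ^+ 2)%:E <= q2%:E)%E.
Hypothesis e_sqr : forall A, <<s G >> A -> (\int[P]_(o in A) (norm2 (e o) ^+ 2)%:E <= e2%:E)%E.
Hypothesis Psi_bounded : forall o, 0 <= Psi o <= Psi_sup.
Hypothesis psi_ae : {ae P, forall o,
  [/\ Psi_inf <= Psi o, 0 <= psi o, psi o <= Psi o & Psi o - psi o <= D]}.
Hypothesis zbar_ae : {ae P, forall o, c1 * norm2 (g (x o)) ^+ 2 <= dotv (zbar o) (g (x o))}.

Let x' o := x o - (eta * psi o / M%:R) *: (\sum_(i < M) z i o) + e o.

Let avg o := M%:R^-1 *: \sum_(i < M) z i o.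
Let S o := M%:R^-1 * \sum_(i < M) norm2 (z i o) ^+ 2.
Let m o := a * (eta * (Psi o * dotv (zbar o - avg o) (g (x o))) + dotv (e o) (g (x o))).
(* the terms of second order in the step sizes *)
Let r o := a * (eta * D * (d%:R * K) * (1 + S o) + C * (2 * (eta * Psi_sup) ^+ 2 * S o + 2 * norm2 (e o) ^+ 2)).

Let dotv_gK y o : `|dotv y (g (x o))| <= d%:R * K * norm2 y.
Proof.
rewrite (le_trans (dotv_le _ _))// -!mulrA ler_wpM2l//.
by rewrite ler_pM ?norm_le_norm2.
Qed.

Let S_ge0 o : 0 <= S o.
Proof. by rewrite mulr_ge0 ?invr_ge0// sumr_ge0// => i _; exact: sqr_ge0. Qed.

(** Taylor's formula at [x o]. In the first order term, trading [psi] for [Psi]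
    costs at most [D] times the size of the term, and trading the average of the
    [z i] for [zbar] leaves the centred term [m]. *)
Let pointwise o : c1 * norm2 (g (x o)) ^+ 2 <= dotv (zbar o) (g (x o)) ->
  [/\ Psi_inf <= Psi o, 0 <= psi o, psi o <= Psi o & Psi o - psi o <= D] ->
  a * h (x' o) + a * (eta * Psi_inf * c1 * norm2 (g (x o)) ^+ 2) <= a * h (x o) + m o + r o.
Proof.
move=> Hz [P1 P2 P3 P4]; rewrite /m /r -!mulrDr ler_wpM2l//.
set gx := g (x o); pose v := e o - (eta * psi o) *: avg o.
have x'E : x' o = x o + v.
  by rewrite /x' /v /avg scalerA -addrA; congr (_ + _); rewrite addrC.
have := hq (x o) v; rewrite -x'E -/gx ler_norml => /andP[_].
have v2 : `|v| ^+ 2 <= 2 * norm2 (e o) ^+ 2 + 2 * (eta * Psi_sup) ^+ 2 * S o.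
  apply: (@le_trans _ _ (norm2 v ^+ 2)).
    by rewrite ler_sqr ?nnegrE ?norm2_ge0// norm_le_norm2.
  rewrite /v (le_trans (norm2D_sqr _ _))// lerD2l -mulrA ler_wpM2l// norm2N norm2Z_sqr.
  rewrite ler_pM ?sqr_ge0//; last exact: norm2_avg.
  have /andP[? ?] := Psi_bounded o.
  rewrite ler_sqr ?nnegrE ?mulr_ge0//; last exact: le_trans P2 (le_trans P3 _).
  by rewrite ler_wpM2l//; exact: le_trans P3 _.
have Cv := ler_wpM2l C0 v2.
have dv : dotv v gx = dotv (e o) gx - eta * psi o * dotv (avg o) gx.
  by rewrite /v dotvBl dotvZl.
rewrite dv dotvBl -/gx.
have avgb : `|dotv (avg o) gx| <= d%:R * K * (1 + S o).
  rewrite (le_trans (dotv_gK _ _))// ler_wpM2l ?mulr_ge0//.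
  have n2 : norm2 (avg o) ^+ 2 <= S o by exact: norm2_avg.
  have := sqr_ge0 (norm2 (avg o) - 1); have := norm2_ge0 (avg o).
  rewrite sqrrB expr1n; lra.
have key : eta * (Psi o - psi o) * dotv (avg o) gx <= eta * D * (d%:R * K) * (1 + S o).
  rewrite (le_trans (ler_norm _))// normrM -mulrA [leRHS]mulrA -[leRHS]mulrA.
  rewrite [X in X * _]ger0_norm; last by rewrite mulr_ge0// subr_ge0.
  rewrite -!mulrA ler_wpM2l// ler_pM// ?subr_ge0//.
  by rewrite mulrA.
have key2 : eta * Psi_inf * c1 * norm2 gx ^+ 2 <= eta * Psi o * dotv (zbar o) gx.
  rewrite -!mulrA ler_wpM2l// ler_pM//; first by rewrite mulr_ge0 ?sqr_ge0.
rewrite /= in Cv *; lra.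
Qed.

Let mx : measurable_fun setT x.
Proof.
apply: (@measurable_sub_sigma _ _ G) => [B GB|]; first by apply: mG; exact: sub_sigma_algebra.
exact/measurable_wrt_sigma.
Qed.

Let mgx : measurable_fun setT (fun o => g (x o)).
Proof. exact: measurableT_comp. Qed.

Let Ggx j : measurable_wrt <<s G >> (fun o => g (x o) 0 j).
Proof.
apply/measurable_wrt_sigma; move/measurable_wrt_sigma : Gx => Gx'.
by have /measurable_fun_mxP := measurableT_comp mg Gx'; exact.
Qed.

Let gxK o j : `|g (x o) 0 j| <= K.
Proof. exact: le_trans (coord_le_norm _ _) (gK _). Qed.

(** [m] is a combination of centred variables whose coefficients are bounded and
    measurable for [<<s G >>]. *)
Let m_zero_mean : zero_mean P G m.
Proof.
have -> : m = (fun o => (a * eta) * (\sum_j (Psi o * g (x o) 0 j) *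
    (\sum_i - M%:R^-1 * (z i o 0 j - zbar o 0 j))) + a * (\sum_j g (x o) 0 j * e o 0 j)).
  apply/funext => o; rewrite /m mulrDr mulrA; congr (_ * _ + _ * _); last first.
    by apply: eq_bigr => j _; rewrite mulrC.
  rewrite /dotv mulr_sumr; apply: eq_bigr => j _.
  rewrite -mulr_sumr sumrB sumr_const card_ord -[_ *+ M]mulr_natl /avg !mxE summxE.
  have M0' : M%:R != 0 :> R by rewrite pnatr_eq0 -lt0n.
  by field.
apply: zero_meanD => //; apply: zero_meanZ => //; apply: zero_mean_sum => // j.
  apply: (@zero_mean_mul _ _ _ P G mG _ _ (Psi_sup * K)).
  - by apply: zero_mean_sum => // i; exact: zero_meanZ.
  - apply/measurable_wrt_sigma; apply: measurable_funM; exact/measurable_wrt_sigma.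
  - move=> o; rewrite normrM; have /andP[p0 p1] := Psi_bounded o.
    by rewrite ler_pM// ger0_norm.
exact: (@zero_mean_mul _ _ _ P G mG _ _ K).
Qed.

(** [pointwise] integrated over an event of the past, where the contribution of
    [m] vanishes. *)
Theorem descent_in_mean A : <<s G >> A ->
  (\int[P]_(o in A) (a * h (x' o))%:E +
   \int[P]_(o in A) (a * (eta * Psi_inf * c1 * norm2 (g (x o)) ^+ 2))%:E <=
   \int[P]_(o in A) (a * h (x o))%:E +
   (a * (eta * D * (d%:R * K) * (1 + q2) + C * (2 * (eta * Psi_sup) ^+ 2 * q2 + 2 * e2)))%:E)%E.
Proof.
move=> GA; have mA := mG GA.
have [im m0] := m_zero_mean.
have mm : measurable_fun setT m by apply/measurable_EFinP; exact: measurable_int im.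
have mx' : measurable_fun setT x'.
  apply/measurable_fun_mxP => i j; rewrite /x'.
  have E (o : O) : (x o - (eta * psi o / M%:R) *: (\sum_(i < M) z i o) + e o) i j =
      x o i j - (eta * psi o / M%:R) * (\sum_(k < M) z k o i j) + e o i j.
    by rewrite !mxE summxE.
  under eq_fun do rewrite E.
  move/measurable_fun_mxP : mx => mx0; move/measurable_fun_mxP : me => me0.
  apply: measurable_funD => //; apply: measurable_funB => //.
  apply: measurable_funM.
    by do 2!apply: measurable_funM => //.
  by apply: measurable_sum => k; have /measurable_fun_mxP := mz k; exact.
have mS : measurable_fun setT S.
  apply: measurable_funM => //; apply: measurable_sum => i.
  exact: (measurableT_comp measurable_norm2_sqr).
have me2 : measurable_fun setT (fun o => norm2 (e o) ^+ 2).
  exact: (measurableT_comp measurable_norm2_sqr).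
have mr : measurable_fun setT r.
  apply: measurable_funM => //; apply: measurable_funD.
    by apply: measurable_funM => //; apply: measurable_funD.
  by apply: measurable_funM => //; apply: measurable_funD; apply: measurable_funM.
have mh : measurable_fun setT h by exact: lip_measurable hK.
have mah (y : O -> V) : measurable_fun setT y -> measurable_fun setT (fun o => a * h (y o)).
  by move=> my; apply: measurable_funM => //; exact: (measurableT_comp mh).
have K2 : 0 <= eta * D * (d%:R * K) by rewrite !mulr_ge0.
have r0 o : 0 <= r o.
  apply: mulr_ge0 => //; apply: addr_ge0; apply: mulr_ge0 => //.
    by rewrite addr_ge0.
  apply: addr_ge0; apply: mulr_ge0 => //; [by rewrite mulr_ge0 ?sqr_ge0|exact: sqr_ge0].
have step : (\int[P]_(o in A) (a * h (x' o))%:E +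
   \int[P]_(o in A) (a * (eta * Psi_inf * c1 * norm2 (g (x o)) ^+ 2))%:E <=
   \int[P]_(o in A) (a * h (x o))%:E + \int[P]_(o in A) (r o)%:E)%E.
  apply: (@integral_step _ _ _ P A (fun o => a * h (x o)) (fun o => a * h (x' o)) _ r m) => //.
  - exact: mah.
  - exact: mah.
  - apply: measurable_funM => //; apply: measurable_funM => //.
    exact: (measurableT_comp measurable_norm2_sqr).
  - by move=> o; rewrite mulr_ge0.
  - by move=> o; rewrite mulr_ge0.
  - move=> o; apply: mulr_ge0 => //; apply: mulr_ge0; last exact: sqr_ge0.
    by apply: mulr_ge0 => //; exact: mulr_ge0.
  - exact: (integrableS measurableT).
  - exact: m0.
  case: psi_ae => N1 [mN1 N10 H1]; case: zbar_ae => N2 [mN2 N20 H2].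
  exists (N1 `|` N2); split; [exact: measurableU|exact: null_set_setU|].
  move=> o no; apply: contrapT => /not_orP[n1 n2]; apply: no; apply: pointwise.
    by apply: contrapT => n; apply: n2; exact: H2.
  by apply: contrapT => n; apply: n1; exact: H1.
apply: (le_trans step); rewrite leeD2l//.
pose k1 := a * (eta * D * (d%:R * K) + C * (2 * (eta * Psi_sup) ^+ 2)) * M%:R^-1.
pose k0 := a * (eta * D * (d%:R * K)).
pose k2 := a * (C * 2).
have k00 : 0 <= k0 by rewrite /k0 mulr_ge0.
have k10 : 0 <= k1.
  apply: mulr_ge0; last by rewrite invr_ge0.
  apply: mulr_ge0 => //; apply: addr_ge0 => //; apply: mulr_ge0 => //.
  by rewrite mulr_ge0 ?sqr_ge0.
have k20 : 0 <= k2 by apply: mulr_ge0 => //; exact: mulr_ge0.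
have rE o : (r o)%:E = (k0%:E + (k1%:E * \sum_(i < M) (norm2 (z i o) ^+ 2)%:E +
    k2%:E * (norm2 (e o) ^+ 2)%:E))%E.
  rewrite sumEFin -!EFinM -!EFinD /r /S /k0 /k1 /k2; congr EFin.
  by move: (\sum_(i < M) _) => s; ring.
have mAE (y : O -> R) : measurable_fun setT y -> measurable_fun A (EFin \o y).
  by move=> my; apply: measurable_funTS; exact/measurable_EFinP.
have mz2 i : measurable_fun A (fun o => (norm2 (z i o) ^+ 2)%:E).
  by apply: mAE; exact: (measurableT_comp measurable_norm2_sqr).
have mzs : measurable_fun A (fun o => \sum_(i < M) (norm2 (z i o) ^+ 2)%:E)%E.
  exact: emeasurable_sum.
have z0 o : (0 <= \sum_(i < M) (norm2 (z i o) ^+ 2)%:E)%E.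
  by apply: sume_ge0 => i _; rewrite lee_fin sqr_ge0.
under eq_integral do rewrite rE.
have z1 o : (0 <= k1%:E * \sum_(i < M) (norm2 (z i o) ^+ 2)%:E)%E.
  by apply: mule_ge0 => //; rewrite lee_fin.
have e1 o : (0 <= k2%:E * (norm2 (e o) ^+ 2)%:E)%E by rewrite -EFinM lee_fin mulr_ge0 ?sqr_ge0.
have mz1 : measurable_fun A (fun o => k1%:E * \sum_(i < M) (norm2 (z i o) ^+ 2)%:E)%E.
  exact: emeasurable_funM.
have me1 : measurable_fun A (fun o => k2%:E * (norm2 (e o) ^+ 2)%:E)%E.
  by apply: emeasurable_funM => //; exact: mAE.
rewrite ge0_integralD//; [|by move=> o _; exact: adde_ge0|exact: emeasurable_funD].
rewrite ge0_integralD//.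
rewrite ge0_integralZl//.
rewrite ge0_integralZl//; [|exact: mAE|by move=> o _; rewrite lee_fin sqr_ge0].
rewrite ge0_integral_sum//; last by move=> i o _; rewrite lee_fin sqr_ge0.
apply: (@le_trans _ _ (k0%:E + (k1%:E * (M%:R * q2)%:E + k2%:E * e2%:E))%E).
  apply: leeD; last apply: leeD.
  - by rewrite integral_cst//= -[leRHS]mule1 lee_wpmul2l ?lee_fin//; exact: probability_le1.
  - rewrite lee_wpmul2l ?lee_fin// (le_trans (lee_sum _ (fun i _ => z_sqr i GA)))//.
    by rewrite sumEFin sumr_const card_ord -[_ *+ M]mulr_natl.
  - by rewrite lee_wpmul2l ?lee_fin//; exact: e_sqr.
rewrite -!EFinM -!EFinD lee_fin /k0 /k1 /k2 le_eqVlt; apply/orP; left; apply/eqP.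
have M0' : M%:R != 0 :> R by rewrite pnatr_eq0 -lt0n.
by field.
Qed.

End descent.

(** * The expected loss and the filtration of the algorithm *)

Lemma ae_distribution {dO d : measure_display} {O : measurableType dO} {T : measurableType d}
    {R : realType} (P : probability O R) (X : {RV P >-> T}) (Q : T -> Prop) :
  {ae distribution P X, forall x, Q x} -> {ae P, forall o, Q (X o)}.
Proof.
move=> [N [mN N0 NQ]]; exists (X @^-1` N); split; last by move=> o; exact: NQ.
  by rewrite -[Y in measurable Y]setTI; exact: measurable_funPT.
exact: N0.
Qed.

Lemma measurable_rVD {dT : measure_display} {T : measurableType dT} {R : realType} {d : nat}
    (x y : T -> 'rV[R]_d) :
  measurable_fun setT x -> measurable_fun setT y -> measurable_fun setT (fun t => x t + y t).
Proof.
move=> /measurable_fun_mxP mx /measurable_fun_mxP my; apply/measurable_fun_mxP => i j.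
by under eq_fun do rewrite mxE; exact: measurable_funD.
Qed.

Section expected_loss.
Context {R : realType} {d n : nat} {dO : measure_display} {O : measurableType dO}.
Context (P : probability O R) (xi : {RV P >-> 'rV[R]_n}).
Variables (F : 'rV[R]_d -> 'rV[R]_n -> R) (L0 : 'rV[R]_n -> R) (Q : R) (f : 'rV[R]_d -> R).
Hypotheses (F_meas : forall v, measurable_fun setT (F v)) (L0_meas : measurable_fun setT L0).
Hypothesis F_lip : \forall x \ae distribution P xi,
  forall v v', `|F v x - F v' x| <= L0 x * norm2 (v - v').
Hypothesis QE : ('E_P[fun o => (L0 (xi o) ^+ 2)%R] = Q%:E)%E.
Hypothesis fE : forall v, ('E_P[fun o => F v (xi o)] = (f v)%:E)%E.

Lemma second_moment_ge0 : 0 <= Q.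
Proof.
rewrite -lee_fin -QE unlock; apply: integral_ge0 => o _.
by rewrite lee_fin sqr_ge0.
Qed.

Let mL0 : measurable_fun setT (fun o => L0 (xi o)).
Proof. exact: measurableT_comp. Qed.

Let iL0 : P.-integrable setT (fun o => `|L0 (xi o)|%:E).
Proof.
have i2 : P.-integrable setT (fun o => (L0 (xi o) ^+ 2)%:E).
  apply: integrable_of_fin_num => //; first by apply/measurable_EFinP; exact: measurable_funX.
  by move: QE; rewrite unlock => ->.
have i1 : P.-integrable setT (cst 1%:E : O -> \bar R).
  by apply: finite_measure_integrable_cst.
apply: (le_integrable measurableT _ _ (integrableD measurableT i1 i2)).
  by apply/measurable_EFinP; exact: measurableT_comp.
move=> o _; rewrite -EFinD !abse_EFin lee_fin normr_id [leRHS]ger0_norm ?addr_ge0 ?sqr_ge0//=.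
have := sqr_ge0 (`|L0 (xi o)| - 1); rewrite sqrrB expr1n -normrX.
rewrite [X in X - _]ger0_norm ?sqr_ge0//.
have := normr_ge0 (L0 (xi o)); lra.
Qed.

(** [L0 \o xi] is integrable because a number is at most one plus its square. The
    factor [d%:R] comes from comparing the Euclidean norm with the sup norm. *)
Lemma expected_loss_lip : exists2 K, 0 <= K & lip K f.
Proof.
exists (d%:R * \int[P]_o `|L0 (xi o)|).
  by rewrite mulr_ge0// /Rintegral fine_ge0// integral_ge0// => o _; rewrite lee_fin.
have iF v : P.-integrable setT (fun o => (F v (xi o))%:E).
  apply: integrable_of_fin_num => //; first by apply/measurable_EFinP; exact: measurableT_comp.
  by have := fE v; rewrite unlock => ->.
have fR v : f v = \int[P]_o F v (xi o) by have := fE v; rewrite unlock /Rintegral => ->.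
move=> v v'; rewrite !fR -RintegralB //; [|exact: iF|exact: iF].
have iFF : P.-integrable setT (fun o => (F v (xi o) - F v' (xi o))%:E).
  by have := integrableB measurableT (iF v) (iF v'); exact.
apply: (le_trans (le_normr_Rintegral measurableT iFF)).
rewrite mulrAC -lee_fin EFinM /Rintegral fineK; last first.
  by apply: (integrable_fin_num measurableT); have := integrable_norm iFF; exact.
rewrite fineK; last exact: integrable_fin_num.
rewrite -integralZl//; apply: ae_ge0_le_integral => //.
- apply/measurable_EFinP; apply: (@measurableT_comp _ _ _ _ _ _ (fun y : R => `|y|)) => //.
  by apply: measurable_funB; exact: measurableT_comp.
- by apply: emeasurable_funM => //; exact: measurable_int iL0.
have [N [mN N0 HN]] := ae_distribution F_lip.
exists N; split=> // o no; apply: HN => H; apply: no => _; rewrite -EFinM lee_fin.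
apply: (le_trans (H v v')); rewrite mulrC; apply: (@le_trans _ _ (norm2 (v - v') * `|L0 (xi o)|)).
  by rewrite ler_wpM2l ?norm2_ge0 ?ler_norm.
by rewrite ler_wpM2r// norm2_le.
Qed.

End expected_loss.

Section filtration.
Context {dO : measure_display} {O : measurableType dO} {R : realType}.
Context {P : probability O R} {d n s M : nat}.
Variables (u : nat -> {RV P >-> 'rV[R]_d}).
Variables (xis : nat -> 'I_M -> {RV P >-> 'rV[R]_n}).
Variables (bs : nat -> 'I_M -> {RV P >-> 'rV[R]_s}).
Variables (psi : nat -> {RV P >-> R}) (e : nat -> {RV P >-> 'rV[R]_d}).
Local Notation past := (past u xis bs psi e).
Local Notation current := (current u xis bs psi).

Lemma preimage_sub_measurable d' (T : measurableType d') (X : {RV P >-> T}) :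
  g_sigma_algebra_preimage X `<=` measurable.
Proof. by move=> _ [B mB <-]; exact: measurable_funPT. Qed.

Lemma current_sub_measurable k : current k `<=` measurable.
Proof.
apply: smallest_sub; first exact: sigma_algebra_measurable.
rewrite !subUset; split; last exact: preimage_sub_measurable.
split; last by apply: bigcup_sub => i _; exact: preimage_sub_measurable.
split; last by apply: bigcup_sub => i _; exact: preimage_sub_measurable.
exact: preimage_sub_measurable.
Qed.

Lemma past_sub_measurable k : past k `<=` measurable.
Proof.
apply: smallest_sub; first exact: sigma_algebra_measurable.
apply: bigcup_sub => j _; rewrite subUset; split.
  exact: current_sub_measurable.
exact: preimage_sub_measurable.
Qed.

Lemma past_mono j k : (j <= k)%N -> past j `<=` past k.
Proof.
move=> jk; apply: smallest_sub; first exact: smallest_sigma_algebra.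
move=> A [i /= /andP[i1 ij] Ai]; apply: sub_sigma_algebra; exists i => //=.
by rewrite i1 (leq_trans ij).
Qed.

Lemma current_sub_past j k : (1 <= j <= k)%N ->
  current j `|` g_sigma_algebra_preimage (e j) `<=` past k.
Proof. by move=> jk A Aj; apply: sub_sigma_algebra; exists j. Qed.

Lemma measurable_wrt_sub (G G' : set (set O)) d' (T : measurableType d') (X : O -> T) :
  G `<=` G' -> measurable_wrt G X -> measurable_wrt G' X.
Proof. by move=> GG' GX; exact: subset_trans GG'. Qed.

Section sampled.
Variables (j k : nat).
Hypothesis jk : (1 <= j <= k)%N.

Let cur : current j `<=` past k.
Proof. by move=> A Aj; apply: (current_sub_past jk); left. Qed.

Lemma past_direction : measurable_wrt (past k) (u j).
Proof.
apply: (measurable_wrt_sub cur) => A uA; apply: sub_sigma_algebra.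
by left; left; left.
Qed.

Lemma past_sample i : measurable_wrt (past k) (xis j i).
Proof.
apply: (measurable_wrt_sub cur) => A uA; apply: sub_sigma_algebra.
by left; left; right; exists i.
Qed.

Lemma past_discrete_sample i : measurable_wrt (past k) (bs j i).
Proof.
apply: (measurable_wrt_sub cur) => A uA; apply: sub_sigma_algebra.
by left; right; exists i.
Qed.

Lemma past_step_factor : measurable_wrt (past k) (psi j).
Proof.
apply: (measurable_wrt_sub cur) => A uA; apply: sub_sigma_algebra.
by right.
Qed.

Lemma past_arithmetic_error : measurable_wrt (past k) (e j).
Proof. by move=> A eA; apply: (current_sub_past jk); right. Qed.

End sampled.

Section iterates.
Variables (gF : 'rV[R]_d * 'rV[R]_n * 'rV[R]_s -> 'rV[R]_d) (gF_meas : measurable_fun setT gF).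
Variables (eta : nat -> R) (w1 : 'rV[R]_d) (w : nat -> O -> 'rV[R]_d).
Hypothesis w_init : forall o, w 1%N o = w1.
Hypothesis w_step : forall k, (0 < k)%N -> forall o,
  w k.+1 o = w k o
    - (eta k * psi k o / M%:R) *: (\sum_(i < M) gF (w k o + u k o, xis k i o, bs k i o)) + e k o.

Lemma iterate_past k : (0 < k)%N -> measurable_wrt (past k.-1) (w k).
Proof.
case: k => // k _; elim: k => [|k IH].
  apply/measurable_wrt_sigma; rewrite (_ : w 1%N = cst w1); first exact: measurable_cst.
  exact/funext.
have kk : (1 <= k.+1 <= k.+1)%N by rewrite leqnn.
have mw : measurable_wrt (past k.+1) (w k.+1).
  by apply: measurable_wrt_sub IH; exact: past_mono.
have := mw; move=> /measurable_wrt_sigma mw'.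
have /measurable_wrt_sigma mu := past_direction kk.
have /measurable_wrt_sigma mpsi := past_step_factor kk.
have /measurable_wrt_sigma/measurable_fun_mxP me := past_arithmetic_error kk.
apply/measurable_wrt_sigma/measurable_fun_mxP => i j.
have E (o : O) : w k.+2 o i j = w k.+1 o i j - (eta k.+1 * psi k.+1 o / M%:R) *
    (\sum_(l < M) gF (w k.+1 o + u k.+1 o, xis k.+1 l o, bs k.+1 l o) i j) + e k.+1 o i j.
  by rewrite w_step// !mxE summxE.
rewrite (funext E).
have /measurable_fun_mxP mw2 := mw'.
apply: measurable_funD => //; apply: measurable_funB => //; apply: measurable_funM.
  by apply: measurable_funM => //; apply: measurable_funM.
apply: measurable_sum => l.
have /measurable_wrt_sigma mx := past_sample kk (i := l).
have /measurable_wrt_sigma mb := past_discrete_sample kk (i := l).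
have mwu := measurable_rVD mw' mu.
have := measurableT_comp gF_meas (measurable_fun_pair (measurable_fun_pair mwu mx) mb).
by move/measurable_fun_mxP; exact.
Qed.

End iterates.

End filtration.

(** * Drawn samples against generic samples *)

Lemma nth_map_enum (T : Type) (x0 : T) M (F : 'I_M -> T) (i : 'I_M) :
  nth x0 [seq F j | j <- enum 'I_M] i = F i.
Proof. by rewrite (nth_map i) ?size_enum_ord// nth_ord_enum. Qed.

Lemma size_map_enum (T : Type) M (F : 'I_M -> T) : size [seq F j | j <- enum 'I_M] = M.
Proof. by rewrite size_map size_enum_ord. Qed.

Section sample_exchange.
Context {R : realType} {d n s M : nat} {dO : measure_display} {O : measurableType dO}.
Context (P : probability O R).
Variables (xi : {RV P >-> 'rV[R]_n}) (b : nat -> {RV P >-> 'rV[R]_s}).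
Variables (u : nat -> {RV P >-> 'rV[R]_d}).
Variables (xis : nat -> 'I_M -> {RV P >-> 'rV[R]_n}).
Variables (bs : nat -> 'I_M -> {RV P >-> 'rV[R]_s}).
Variables (psi : nat -> {RV P >-> R}) (e : nat -> {RV P >-> 'rV[R]_d}).
Local Notation past := (past u xis bs psi e).
Variables (k : nat) (W : O -> 'rV[R]_d).
Hypothesis pastW : measurable_wrt (past k) W.
Hypothesis xis_law : forall i, same_law (xis k.+1 i) xi.
Hypothesis bs_law : forall i, same_law (bs k.+1 i) (b k.+1).
Hypothesis samples_indep : independent P
     ([:: past k; g_sigma_algebra_preimage (u k.+1)]
      ++ [seq g_sigma_algebra_preimage (xis k.+1 i) | i <- enum 'I_M]
      ++ [seq g_sigma_algebra_preimage (bs k.+1 i) | i <- enum 'I_M]).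
Hypothesis generic_indep : independent P
     [:: past k; g_sigma_algebra_preimage (u k.+1);
         g_sigma_algebra_preimage xi; g_sigma_algebra_preimage (b k.+1)].
Variables (gF : 'rV[R]_d * 'rV[R]_n * 'rV[R]_s -> 'rV[R]_d) (gF_meas : measurable_fun setT gF).

Let pre d' (T : measurableType d') (X : {RV P >-> T}) B :
  measurable B -> g_sigma_algebra_preimage X (X @^-1` B).
Proof. by move=> mB; exists B => //; rewrite setTI. Qed.

Let samples_law i A B C D : past k A -> measurable B -> measurable C -> measurable D ->
  P (A `&` u k.+1 @^-1` B `&` xis k.+1 i @^-1` C `&` bs k.+1 i @^-1` D) =
  P (A `&` u k.+1 @^-1` B `&` xi @^-1` C `&` b k.+1 @^-1` D).
Proof.
move=> pA mB mC mD.
have iM := ltn_ord i.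
rewrite [RHS](@independent4 _ _ _ _ _ 0 1 2 3 _ _ _ _ generic_indep)//; [|exact: pre|exact: pre|exact: pre].
(* the list holds the past and the direction, then the samples [xis], then [bs] *)
rewrite [LHS](@independent4 _ _ _ _ _ 0 1 (2 + i) (2 + (M + i)) _ _ _ _ samples_indep)//.
- by congr (_ * _ * _ * _)%E; [exact: xis_law|exact: bs_law].
- rewrite /= !inE eqn_add2l -{1}[val i]add0n eqn_add2r eq_sym -lt0n andbT.
  by rewrite /= (leq_ltn_trans _ iM).
- rewrite !size_cat !size_map_enum /= !addSn !ltnS !add0n ltn_add2l iM andbT.
  by rewrite ltn_addr.
- exact: pre.
- rewrite nth_cat /= addKn nth_cat size_map_enum iM.
  by rewrite nth_map_enum; exact: pre.
- rewrite nth_cat /= addKn nth_cat size_map_enum.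
  by rewrite ltnNge leq_addr/= addKn nth_map_enum; exact: pre.
Qed.

Let mW : measurable_fun setT W.
Proof.
move=> _ B mB; apply: (@past_sub_measurable _ _ _ _ _ _ _ _ u xis bs psi e k).
by apply: pastW; exists B.
Qed.

Lemma measurable_gF (X : O -> 'rV[R]_n) (Y : O -> 'rV[R]_s) :
  measurable_fun setT X -> measurable_fun setT Y ->
  measurable_fun setT (fun o => gF (W o + u k.+1 o, X o, Y o)).
Proof.
move=> mX mY; have mWU := measurable_rVD mW (@measurable_funPT _ _ _ _ (u k.+1)).
exact: (measurableT_comp gF_meas (measurable_fun_pair (measurable_fun_pair mWU mX) mY)).
Qed.

(** Independence and equality of laws identify the joint law of [W], the direction
    and the drawn samples on the events of the past with that of [W], the
    direction and the generic samples. What is known of the latter thus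
    transfers to the former. *)
Lemma sample_exchange i A (l : 'rV[R]_d -> \bar R) : past k A -> measurable_fun setT l ->
  (\int[P]_(o in A) l (gF ((W o + u k.+1 o)%R, xis k.+1 i o, bs k.+1 i o)) =
   \int[P]_(o in A) l (gF ((W o + u k.+1 o)%R, xi o, b k.+1 o)))%E.
Proof.
move=> pA ml.
apply: (@eq_law_integral _ _ _ P _ _ A (fun o => gF (W o + u k.+1 o, xis k.+1 i o, bs k.+1 i o))
  (fun o => gF (W o + u k.+1 o, xi o, b k.+1 o)) l) => //.
- exact: past_sub_measurable pA.
- exact: measurable_gF.
- exact: measurable_gF.
move=> B mB.
pose Phi (p : 'rV[R]_d * 'rV[R]_d * 'rV[R]_n * 'rV[R]_s) := gF (p.1.1.1 + p.1.1.2, p.1.2, p.2).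
have mPhi : measurable_fun setT Phi.
  have m11 := measurableT_comp (@measurable_fst _ _ 'rV[R]_d 'rV[R]_d)
    (measurableT_comp (@measurable_fst _ _ _ 'rV[R]_n) (@measurable_fst _ _ _ 'rV[R]_s)).
  have m12 := measurableT_comp (@measurable_snd _ _ 'rV[R]_d 'rV[R]_d)
    (measurableT_comp (@measurable_fst _ _ _ 'rV[R]_n) (@measurable_fst _ _ _ 'rV[R]_s)).
  have mx := measurableT_comp (@measurable_snd _ _ ('rV[R]_d * 'rV[R]_d)%type 'rV[R]_n)
    (@measurable_fst _ _ _ 'rV[R]_s).
  exact: (measurableT_comp gF_meas (measurable_fun_pair
    (measurable_fun_pair (measurable_rVD m11 m12) mx) measurable_snd)).
have mS : measurable (Phi @^-1` B) by rewrite -[Y in measurable Y]setTI; exact: mPhi.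
apply: (@exchange_law _ _ _ P _ _ _ _ _ _ _ _ (past k) W (u k.+1) (xis k.+1 i) xi
  (bs k.+1 i) (b k.+1)) pA mS => //.
- exact: past_sub_measurable.
- move=> A' B' pA' mB'.
  apply: (@measurableI _ (g_sigma_algebraType _) A' (W @^-1` B')) => //.
  by apply: pastW; exists B' => //; rewrite setTI.
- exact: samples_law.
Qed.

End sample_exchange.

(** * One iteration of the algorithm *)

Lemma ae_of_full_measure {dO : measure_display} {O : measurableType dO} {R : realType}
    (P : probability O R) (S : set O) :
  measurable S -> P S = 1%E -> {ae P, forall o, S o}.
Proof.
move=> mS S1; exists (~` S); split => //; first exact: measurableC.
by rewrite probability_setC// S1 subee.
Qed.

Section iteration.
Context {R : realType} {d n s M : nat} (d0 : (0 < d)%N) (M0 : (0 < M)%N).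
Context {dO : measure_display} {O : measurableType dO}.
Context (P : probability O R).
Variables (f : 'rV[R]_d -> R) (K : R).
Hypotheses (K0 : 0 <= K) (fK : lip K f) (f0 : forall v, 0 <= f v).
Variables (xi : {RV P >-> 'rV[R]_n}) (b : nat -> {RV P >-> 'rV[R]_s}).
Variables (u : nat -> {RV P >-> 'rV[R]_d}).
Variables (xis : nat -> 'I_M -> {RV P >-> 'rV[R]_n}).
Variables (bs : nat -> 'I_M -> {RV P >-> 'rV[R]_s}).
Variables (psi : nat -> {RV P >-> R}) (e : nat -> {RV P >-> 'rV[R]_d}).
Local Notation past := (past u xis bs psi e).
Local Notation current := (current u xis bs psi).
Variables (k : nat) (W W' : O -> 'rV[R]_d).
Hypothesis pastW : measurable_wrt (past k) W.
Hypothesis xis_law : forall i, same_law (xis k.+1 i) xi.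
Hypothesis bs_law : forall i, same_law (bs k.+1 i) (b k.+1).
Hypothesis samples_indep : independent P
     ([:: past k; g_sigma_algebra_preimage (u k.+1)]
      ++ [seq g_sigma_algebra_preimage (xis k.+1 i) | i <- enum 'I_M]
      ++ [seq g_sigma_algebra_preimage (bs k.+1 i) | i <- enum 'I_M]).
Hypothesis generic_indep : independent P
     [:: past k; g_sigma_algebra_preimage (u k.+1);
         g_sigma_algebra_preimage xi; g_sigma_algebra_preimage (b k.+1)].
Variables (gF : 'rV[R]_d * 'rV[R]_n * 'rV[R]_s -> 'rV[R]_d) (gF_meas : measurable_fun setT gF).
Variables (alpha eta c1 c2 c3 c4 Q Psi_inf Psi_sup : R).
Hypotheses (alpha0 : 0 < alpha) (eta0 : 0 <= eta) (c10 : 0 <= c1) (c20 : 0 <= c2) (c30 : 0 <= c3)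
  (c40 : 0 <= c4) (Q0 : 0 <= Q) (Psi_inf0 : 0 <= Psi_inf) (Psi_inf_sup : Psi_inf <= Psi_sup).
Local Notation gradf := (grad (smoothing alpha f)).
Variables (g : O -> 'rV[R]_d) (q : O -> \bar R).
Hypothesis g_mean : is_cond_exp_rV P (past k) (fun o => gF (W o + u k.+1 o, xi o, b k.+1 o)) g.
Hypothesis q_mean : is_cond_exp P (past k)
  (fun o => (norm2 (gF (W o + u k.+1 o, xi o, b k.+1 o)) ^+ 2)%:E) q.
Hypothesis g_ae : {ae P, forall o, c1 * norm2 (gradf (W o)) ^+ 2 <= dotv (g o) (gradf (W o))}.
Hypothesis q_ae : {ae P, forall o, (q o <= (c2 * Q)%:E)%E}.
Variables (PsiL PsiU : O -> R).
Hypotheses (PsiL_meas : measurable_wrt (past k) PsiL) (PsiU_meas : measurable_wrt (past k) PsiU)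
  (PsiLU : forall o, 0 <= PsiL o <= PsiU o).
Hypothesis psi_bounds : is_cond_exp P (past k)
  (fun o => (\1_[set o' | PsiL o' <= psi k.+1 o' <= PsiU o'] o)%:E) (cst 1%E).
Hypothesis PsiU_bounds : P [set o | Psi_inf <= PsiU o <= Psi_sup] = 1%E.
Hypothesis Delta_ae : {ae P, forall o, PsiU o - PsiL o <= c4 * (eta / alpha)}.
Hypothesis e_mean : is_cond_exp_rV P <<s past k `|` current k.+1 >> (e k.+1) (cst 0).
Variables (qe : O -> \bar R).
Hypothesis qe_mean : is_cond_exp P (past k) (fun o => (norm2 (e k.+1 o) ^+ 2)%:E) qe.
Hypothesis qe_ae : {ae P, forall o, (qe o <= (c3 * eta ^+ 2)%:E)%E}.
Hypothesis W'E : forall o, W' o = W o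
  - (eta * psi k.+1 o / M%:R) *: (\sum_(i < M) gF (W o + u k.+1 o, xis k.+1 i o, bs k.+1 i o))
  + e k.+1 o.

Let gens := \bigcup_(j in [set j | (1 <= j <= k)%N])
  (current j `|` g_sigma_algebra_preimage (e j)).

Let z i o := gF (W o + u k.+1 o, xis k.+1 i o, bs k.+1 i o).

Let mG : <<s gens >> `<=` measurable.
Proof. exact: past_sub_measurable. Qed.

Let m_past d' (T : measurableType d') (X : O -> T) : measurable_wrt (past k) X -> measurable_fun setT X.
Proof.
by move=> pX _ B mB; apply: mG; apply: pX; exists B.
Qed.

Let mcoord0 j : measurable_fun setT (fun v : 'rV[R]_d => (v 0 j)%:E).
Proof. by apply/measurable_EFinP; exact: measurable_coord. Qed.

Let mzi i : measurable_fun setT (z i).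
Proof. exact: (measurable_gF pastW gF_meas). Qed.

Let exch i A l : past k A -> measurable_fun setT l ->
  (\int[P]_(o in A) l (z i o) = \int[P]_(o in A) l (gF ((W o + u k.+1 o)%R, xi o, b k.+1 o)))%E.
Proof.
move=> pA ml.
exact: (sample_exchange pastW xis_law bs_law samples_indep generic_indep gF_meas i pA ml).
Qed.

Let pastT : past k setT.
Proof. exact: (@measurableT _ (g_sigma_algebraType gens)). Qed.

Let z_zero_mean i j : zero_mean P gens (fun o => z i o 0 j - g o 0 j).
Proof.
have [ig gc] := g_mean j.
have iZ : P.-integrable setT (fun o => (z i o 0 j)%:E).
  apply/integrableP; split.
    by apply/measurable_EFinP; have /measurable_fun_mxP := mzi i; exact.
  rewrite (@exch i setT (fun v => `|(v 0 j)%:E|)%E)//; first by case/integrableP : ig.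
  exact: measurableT_comp.
have iG : P.-integrable setT (fun o => (g o 0 j)%:E).
  exact: (@cond_exp_integrable _ _ _ P gens mG (fun o => gF (W o + u k.+1 o, xi o, b k.+1 o) 0 j)).
split; first by have := integrableB measurableT iZ iG; exact.
move=> A GA; have mA := mG GA.
under eq_integral do rewrite EFinB.
rewrite integralB//; [|exact: (integrableS measurableT)|exact: (integrableS measurableT)].
rewrite (@exch i A (fun v => (v 0 j)%:E))//.
case: gc => _ ->//; rewrite subee//.
by apply: integrable_fin_num => //; exact: (integrableS measurableT).
Qed.

Let z_second_moment i A : past k A -> (\int[P]_(o in A) (norm2 (z i o) ^+ 2)%:E <= (c2 * Q)%:E)%E.
Proof.
move=> pA; rewrite (@exch i A (fun v => (norm2 v ^+ 2)%:E))//.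
  by apply: (@cond_exp_le _ _ _ P gens mG _ q) => //; rewrite mulr_ge0.
by apply/measurable_EFinP; exact: measurable_norm2_sqr.
Qed.

Let e_zero_mean j : zero_mean P gens (fun o => e k.+1 o 0 j).
Proof.
have [ie [_ ec]] := e_mean j; split => // A GA.
rewrite -ec; last by apply: sub_sigma_algebra; left.
by under eq_integral do rewrite mxE; rewrite integral0.
Qed.

Let Psi o := Num.min (PsiU o) Psi_sup.

Let psi_ae : {ae P, forall o,
  [/\ Psi_inf <= Psi o, 0 <= psi k.+1 o, psi k.+1 o <= Psi o & Psi o - psi k.+1 o <= c4 * (eta / alpha)]}.
Proof.
have mL := m_past PsiL_meas; have mU := m_past PsiU_meas.
have mp : measurable_fun setT (psi k.+1) by exact: measurable_funPT.
have mle (X Y : O -> R) : measurable_fun setT X -> measurable_fun setT Y ->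
    measurable [set o | X o <= Y o].
  by move=> mX mY; have := measurable_fun_ler mX mY => /(_ measurableT [set true]); rewrite setTI; exact.
have m1 : measurable [set o | PsiL o <= psi k.+1 o <= PsiU o].
  rewrite (_ : mkset _ = [set o | PsiL o <= psi k.+1 o] `&` [set o | psi k.+1 o <= PsiU o]).
    by apply: measurableI; exact: mle.
  by apply/seteqP; split=> o /=; [move/andP|move=> ?; exact/andP].
have m2 : measurable [set o | Psi_inf <= PsiU o <= Psi_sup].
  rewrite (_ : mkset _ = [set o | Psi_inf <= PsiU o] `&` [set o | PsiU o <= Psi_sup]).
    by apply: measurableI; apply: mle.
  by apply/seteqP; split=> o /=; [move/andP|move=> ?; exact/andP].
have P1 : P [set o | PsiL o <= psi k.+1 o <= PsiU o] = 1%E.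
  case: psi_bounds => _ /(_ _ pastT); rewrite integral_cst// mul1e => PT.
  rewrite -(probability_setT P); apply: esym; apply: (etrans PT).
  by rewrite integral_indic// setIT.
have := ae_of_full_measure m2 PsiU_bounds; have := ae_of_full_measure m1 P1.
move: Delta_ae => [N1 [mN1 N10 H1]] [N2 [mN2 N20 H2]] [N3 [mN3 N30 H3]].
exists (N1 `|` (N2 `|` N3)); split.
- by apply: measurableU => //; exact: measurableU.
- by apply: null_set_setU => //; [exact: measurableU|exact: null_set_setU].
move=> o no; apply: contrapT => /not_orP[n1 /not_orP[n2 n3]]; apply: no.
have {H1}D1 : PsiU o - PsiL o <= c4 * (eta / alpha) by apply: contrapT => nn; apply: n1; exact: H1.
have {H2}/andP[D2 D3] : PsiL o <= psi k.+1 o <= PsiU o by apply: contrapT => nn; apply: n2; exact: H2.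
have {H3}/andP[D4 D5] : Psi_inf <= PsiU o <= Psi_sup by apply: contrapT => nn; apply: n3; exact: H3.
have /andP[D6 _] := PsiLU o.
have PsiE : Psi o = PsiU o by exact/min_idPl.
split; rewrite ?PsiE//; first exact: le_trans D2.
by apply: le_trans D1; rewrite lerD2l lerN2.
Qed.

(** [descent_in_mean] for the smoothed loss. Its hypothesis on [Psi] asks for bounds
    everywhere, which the truncation [Psi] of [PsiU] satisfies; the two are
    equal almost surely. All the remainders are of order
    [alpha ^+ d.-1 * eta ^+ 2]. *)
Theorem iteration_descent A : past k A ->
  (\int[P]_(o in A) (alpha ^+ d * smoothing alpha f (W' o))%:E +
   \int[P]_(o in A) (alpha ^+ d * (eta * Psi_inf * c1 * norm2 (gradf (W o)) ^+ 2))%:E <=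
   \int[P]_(o in A) (alpha ^+ d * smoothing alpha f (W o))%:E +
   ((c4 * (d%:R * K) * (1 + c2 * Q) +
     d%:R * (d%:R + 2) * K * (2 * Psi_sup ^+ 2 * (c2 * Q) + 2 * c3)) *
    (alpha ^+ d.-1 * eta ^+ 2))%:E)%E.
Proof.
move=> pA.
have [hq hl] := smoothing_quadratic d0 K0 f0 fK alpha0.
have Psi_sup0 : 0 <= Psi_sup by exact: le_trans Psi_inf_sup.
have C0 : 0 <= d%:R * (d%:R + 2) * K / alpha by rewrite !mulr_ge0// ?addr_ge0// invr_ge0 ltW.
have gK x : `|gradf x| <= K.
  by apply/(box_coord _ K0) => j; exact: grad_smoothing_le.
have mg : measurable_fun setT gradf.
  by apply/measurable_fun_mxP => i j; rewrite (ord1 i); exact: lip_measurable (hl j).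
have me : measurable_fun setT (e k.+1) by exact: measurable_funPT.
have mp : measurable_fun setT (psi k.+1) by exact: measurable_funPT.
have GPsi : measurable_wrt (past k) Psi.
  apply/measurable_wrt_sigma; apply: measurable_minr => //; exact/measurable_wrt_sigma.
have e_sqr B : past k B -> (\int[P]_(o in B) (norm2 (e k.+1 o) ^+ 2)%:E <= (c3 * eta ^+ 2)%:E)%E.
  by apply: (@cond_exp_le _ _ _ P gens mG _ qe) => //; rewrite mulr_ge0// sqr_ge0.
have Psi_bounded o : 0 <= Psi o <= Psi_sup.
  have /andP[D6 D7] := PsiLU o.
  by rewrite /Psi le_min ge_min lexx orbT andbT Psi_sup0 (le_trans D6).
have D0 : 0 <= c4 * (eta / alpha) by rewrite mulr_ge0// divr_ge0// ltW.
have a0 : 0 <= alpha ^+ d by rewrite exprn_ge0// ltW.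
have := descent_in_mean mG M0 K0 C0 (smoothing_ge0 f0 alpha) (smoothing_lip K0 f0 fK alpha0)
  gK mg hq pastW mzi me mp GPsi z_zero_mean e_zero_mean D0 eta0 c10 a0 Psi_inf0
  z_second_moment e_sqr Psi_bounded psi_ae g_ae pA.
under eq_integral do rewrite -W'E.
move=> H; apply: (le_trans H); rewrite leeD2l// lee_fin le_eqVlt; apply/orP; left; apply/eqP.
have aE : alpha ^+ d = alpha ^+ d.-1 * alpha by rewrite -exprSr prednK.
by rewrite aE; field; rewrite gt_eqF.
Qed.

End iteration.

(** * Summability and stationary subsequences *)

Section summability.
Context {dO : measure_display} {O : measurableType dO} {R : realType}.
Context (P : probability O R).

(** [X 0] need not be integrable, so the inequalities are summed on the events
    [X 0 <= N], which exhaust the space. *)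
Lemma almost_sure_summability (X Y : nat -> O -> R) (t : nat -> R) (B : R) :
  (forall k, measurable_fun setT (X k)) -> (forall k, measurable_fun setT (Y k)) ->
  (forall k o, 0 <= X k o) -> (forall k o, 0 <= Y k o) ->
  (forall n, \sum_(k < n) t k <= B) ->
  (forall N : nat, let A := [set o | X 0%N o <= N%:R] in forall k,
    (\int[P]_(o in A) (X k.+1 o)%:E + \int[P]_(o in A) (Y k o)%:E <=
     \int[P]_(o in A) (X k o)%:E + (t k)%:E)%E) ->
  {ae P, forall o, exists c, forall n, \sum_(k < n) Y k o <= c}.
Proof.
move=> mX mY X0 Y0 tB H.
pose A (N : nat) := [set o | X 0%N o <= N%:R].
have mA N : measurable (A N).
  have := measurable_fun_ler (mX 0%N) (@measurable_cst _ _ O _ setT (N%:R : R)).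
  by move=> /(_ measurableT [set true]); rewrite setTI; exact.
have bnd N : {ae P, forall o, A N o -> exists c, forall n, \sum_(k < n) Y k o <= c}.
  apply: (@ae_bounded_sums _ _ _ P (A N) Y (N%:R + B)) => // n.
  have I0 k : (0 <= \int[P]_(o in A N) (X k o)%:E)%E by apply: integral_ge0 => o _; rewrite lee_fin.
  apply: (le_trans (telescope_sums I0 (H N) n)); rewrite EFinD; apply: leeD; last by rewrite lee_fin.
  apply: (@le_trans _ _ (\int[P]_(o in A N) (N%:R)%:E)%E).
    apply: ge0_le_integral => //.
    - by move=> o _; rewrite lee_fin.
    - by apply: measurable_funTS; exact/measurable_EFinP.
  rewrite (integral_cst P (mA N) (N%:R)%:E) -[leRHS]mule1 lee_wpmul2l ?lee_fin//; exact: probability_le1.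
have [S [mS S0 HS]] := ae_foralln bnd.
exists S; split=> // o no; apply: HS => Ho; apply: no.
apply: (Ho (Num.truncn (X 0%N o)).+1); rewrite /A/= ltW//; exact: truncnS_gt.
Qed.

End summability.

Section stationary.
Context {R : realType} {d : nat} (d0 : (0 < d)%N).
Variables (f : 'rV[R]_d -> R) (K : R).
Hypotheses (K0 : 0 <= K) (fK : lip K f) (f0 : forall v, 0 <= f v).

(** The weights [alpha k ^+ d * eta k] have an infinite sum, so the gradients are
    small infinitely often. *)
Lemma stationary_subsequence (alpha eta : nat -> R) (x : nat -> 'rV[R]_d) (c b : R) (k0 : nat) :
  (forall k, (0 < k)%N -> 0 < alpha k) -> (forall k, (0 < k)%N -> 0 < eta k) ->
  alpha @ \oo --> (0 : R) ->
  (\sum_(1 <= k <oo) (alpha k ^+ d * eta k)%:E = +oo)%E -> 0 < c ->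
  (forall n, \sum_(k < n) alpha (k0.+1 + k)%N ^+ d * eta (k0.+1 + k)%N *
     (c * norm2 (grad (smoothing (alpha (k0.+1 + k)%N) f) (x (k0.+1 + k)%N)) ^+ 2) <= b) ->
  exists phi : nat -> nat,
    [/\ (0 < phi 0)%N,
        forall i, (phi i < phi i.+1)%N,
        norm2 (grad (smoothing (alpha (phi i)) f) (x (phi i))) @[i --> \oo] --> (0 : R) &
        forall ws : 'rV[R]_d, cluster (x (phi i) @[i --> \oo]) ws ->
          dist2 0 (clarke f ws) = 0%E].
Proof.
move=> alpha0 eta0 alpha_cvg sum_oo c0 sum_b.
pose y k := norm2 (grad (smoothing (alpha k) f) (x k)).
have c_ge0 k : (0 < k)%N -> 0 <= alpha k ^+ d * eta k.
  by move=> k0'; rewrite mulr_ge0 ?exprn_ge0// ltW ?alpha0 ?eta0.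
have y_ge0 k : 0 <= y k by exact: norm2_ge0.
have cy_ge0 k : 0 <= c * y k ^+ 2 by rewrite mulr_ge0 ?sqr_ge0// ltW.
have small i N : exists2 k, (N <= k)%N & y k < i.+1%:R^-1.
  have eps0 : 0 < c * (i.+1%:R^-1) ^+ 2 :> R by rewrite mulr_gt0// exprn_gt0.
  have [k Nk] := frequently_small c_ge0 cy_ge0 sum_oo sum_b (ltn0Sn _) N eps0.
  by rewrite ltr_pM2l// ltr_sqr ?nnegrE ?invr_ge0// => ?; exists k.
have [phi [phi0 phi_inc phi_small]] := increasing_choice small.
have y_cvg : y (phi i) @[i --> \oo] --> (0 : R).
  apply: (@squeeze_cvgr _ _ _ _ (fun=> 0) (fun i => i.+1%:R^-1)).
  - by apply: nearW => i; rewrite y_ge0 ltW.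
  - exact: cvg_cst.
  - exact: cvg_harmonic.
have phi_gt0 i : (0 < phi i)%N.
  by case: i => // i; exact: leq_ltn_trans (phi_inc i).
have phi_ge i : (i <= phi i)%N.
  by elim: i => // i IH; exact: leq_ltn_trans (phi_inc i).
have phi_oo : phi i @[i --> \oo] --> \oo.
  move=> S [N _ NS]; exists N => // i Ni; apply: NS; exact: leq_trans (phi_ge i).
exists phi; split => // ws ws_cluster.
apply: (@clarke_stationary _ _ K f d0 K0 fK f0 (alpha \o phi) (x \o phi)) => //.
- by move=> i; exact: alpha0.
- exact: cvg_comp phi_oo alpha_cvg.
Qed.

End stationary.

(** * Convergence of perturbed iterate SGD *)

Theorem theorem5p10 (R : realType) (d n s M : nat)
  (d_gt0 : (0 < d)%N) (n_gt0 : (0 < n)%N) (s_gt0 : (0 < s)%N)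
  (M_gt0 : (0 < M)%N)
  (dO : measure_display) (O : measurableType dO) (P : probability O R)
  (* loss function *)
  (xi : {RV P >-> 'rV[R]_n})
  (F : 'rV[R]_d -> 'rV[R]_n -> R)
  (F_cont : forall x, continuous (F ^~ x))
  (F_meas : forall v, measurable_fun setT (F v))
  (L0 : 'rV[R]_n -> R) (L0_meas : measurable_fun setT L0)
  (F_lip : \forall x \ae distribution P xi,
     forall v v', `|F v x - F v' x| <= L0 x * norm2 (v - v'))
  (Q : R) (QE : ('E_P[fun o => (L0 (xi o) ^+ 2)%R] = Q%:E)%E)
  (f : 'rV[R]_d -> R)
  (fE : forall v, ('E_P[fun o => F v (xi o)] = (f v)%:E)%E)
  (f_ge0 : forall v, 0 <= f v)
  (* approximate stochastic gradient *)
  (gF : 'rV[R]_d * 'rV[R]_n * 'rV[R]_s -> 'rV[R]_d)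
  (gF_meas : measurable_fun setT gF)
  (* generic samples b^k, and samples used by the algorithm *)
  (Phat : nat -> probability 'rV[R]_d R)
  (V : nat -> 'I_s -> {fset R})
  (b : nat -> {RV P >-> 'rV[R]_s})
  (u : nat -> {RV P >-> 'rV[R]_d})
  (xis : nat -> 'I_M -> {RV P >-> 'rV[R]_n})
  (bs : nat -> 'I_M -> {RV P >-> 'rV[R]_s})
  (psi : nat -> {RV P >-> R})
  (e : nat -> {RV P >-> 'rV[R]_d})
  (b_unif : forall k, (0 < k)%N -> forall j,
     uniform_on P (V k j) (fun o => b k o 0 j))
  (u_law : forall k, (0 < k)%N -> forall A, measurable A ->
     distribution P (u k) A = Phat k A)
  (xis_law : forall k, (0 < k)%N -> forall i, same_law (xis k i) xi)
  (bs_law : forall k, (0 < k)%N -> forall i, same_law (bs k i) (b k))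
  (samples_indep : forall k, (0 < k)%N -> independent P
     ([:: past u xis bs psi e k.-1; g_sigma_algebra_preimage (u k)]
      ++ [seq g_sigma_algebra_preimage (xis k i) | i <- enum 'I_M]
      ++ [seq g_sigma_algebra_preimage (bs k i) | i <- enum 'I_M]))
  (generic_indep : forall k, (0 < k)%N -> independent P
     [:: past u xis bs psi e k.-1; g_sigma_algebra_preimage (u k);
         g_sigma_algebra_preimage xi; g_sigma_algebra_preimage (b k)])
  (* perturbed iterate SGD with numerical error *)
  (alpha eta : nat -> R)
  (alpha_gt0 : forall k, (0 < k)%N -> 0 < alpha k)
  (eta_gt0 : forall k, (0 < k)%N -> 0 < eta k)
  (psi_ge0 : forall k, (0 < k)%N -> forall o, 0 <= psi k o)
  (w1 : 'rV[R]_d) (w : nat -> O -> 'rV[R]_d)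
  (w_init : forall o, w 1%N o = w1)
  (w_step : forall k, (0 < k)%N -> forall o,
     w k.+1 o = w k o
       - (eta k * psi k o / M%:R) *:
           (\sum_(i < M) gF (w k o + u k o, xis k i o, bs k i o))
       + e k o)
  (* gradient error *)
  (c1 c2 : R) (c1_gt0 : 0 < c1) (c2_gt0 : 0 < c2)
  (gradient_error : \forall k \near \oo,
     exists (g : O -> 'rV[R]_d) (q : O -> \bar R),
     [/\ is_cond_exp_rV P (past u xis bs psi e k.-1)
           (fun o => gF (w k o + u k o, xi o, b k o)) g,
         is_cond_exp P (past u xis bs psi e k.-1)
           (fun o => (norm2 (gF (w k o + u k o, xi o, b k o)) ^+ 2)%:E) q,
         {ae P, forall o, c1 * norm2 (grad (smoothing (alpha k) f) (w k o)) ^+ 2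
           <= dotv (g o) (grad (smoothing (alpha k) f) (w k o))} &
         {ae P, forall o, (q o <= (c2 * Q)%:E)%E}])
  (* random factors of the step sizes *)
  (PsiL PsiU : nat -> O -> R)
  (PsiL_meas : forall k, (0 < k)%N ->
     measurable_wrt (past u xis bs psi e k.-1) (PsiL k))
  (PsiU_meas : forall k, (0 < k)%N ->
     measurable_wrt (past u xis bs psi e k.-1) (PsiU k))
  (PsiLU : forall k, (0 < k)%N -> forall o, 0 <= PsiL k o <= PsiU k o)
  (psi_bounds : forall k, (0 < k)%N ->
     is_cond_exp P (past u xis bs psi e k.-1)
       (fun o => (\1_[set o' | PsiL k o' <= psi k o' <= PsiU k o'] o)%:E)
       (cst 1%E))
  (Psi_inf Psi_sup : R) (Psi_inf_gt0 : 0 < Psi_inf)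
  (Psi_inf_sup : Psi_inf <= Psi_sup)
  (PsiU_bounds : forall k, (0 < k)%N ->
     P [set o | Psi_inf <= PsiU k o <= Psi_sup] = 1%E)
  (Delta_cvg0 : forall eps : R, 0 < eps -> \forall k \near \oo,
     {ae P, forall o, PsiU k o - PsiL k o <= eps})
  (* arithmetic error *)
  (c3 : R) (c3_gt0 : 0 < c3)
  (arithmetic_error : \forall k \near \oo,
     is_cond_exp_rV P
       <<s past u xis bs psi e k.-1 `|` current u xis bs psi k >>
       (e k) (cst 0) /\
     exists q : O -> \bar R,
       is_cond_exp P (past u xis bs psi e k.-1)
         (fun o => (norm2 (e k o) ^+ 2)%:E) q /\
       {ae P, forall o, (q o <= (c3 * eta k ^+ 2)%:E)%E})
  (* rate of PsiU - PsiL *)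
  (c4 : R) (c4_gt0 : 0 < c4)
  (Delta_rate : \forall k \near \oo,
     {ae P, forall o, PsiU k o - PsiL k o <= c4 * (eta k / alpha k)})
  (* deterministic step sizes and smoothing radii *)
  (alpha_noninc : forall k, (0 < k)%N -> alpha k.+1 <= alpha k)
  (alpha_cvg0 : alpha @ \oo --> (0 : R))
  (sum_diverges :
     (\sum_(1 <= k <oo) (alpha k ^+ d * eta k)%:E = +oo)%E)
  (sum_converges :
     (\sum_(1 <= k <oo) (alpha k ^+ d.-1 * eta k ^+ 2)%:E < +oo)%E) :
  {ae P, forall o, exists phi : nat -> nat,
    [/\ (0 < phi 0)%N,
        forall i, (phi i < phi i.+1)%N,
        norm2 (grad (smoothing (alpha (phi i)) f) (w (phi i) o))
          @[i --> \oo] --> (0 : R) &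
        forall ws : 'rV[R]_d, cluster (w (phi i) o @[i --> \oo]) ws ->
          dist2 0 (clarke f ws) = 0%E]}.
Proof.
have [K K0 fK] := expected_loss_lip F_meas L0_meas F_lip QE fE.
have Q0 := second_moment_ge0 QE.
have Psi_sup0 : 0 <= Psi_sup by rewrite (le_trans (ltW Psi_inf_gt0)).
(* from [k0] on, the hypotheses that hold for large [k] are all available *)
have [k0 step] : exists k0, forall k, (k0 <= k)%N -> forall A, past u xis bs psi e k A ->
    (\int[P]_(o in A) (alpha k.+1 ^+ d * smoothing (alpha k.+1) f (w k.+2 o))%:E +
     \int[P]_(o in A) (alpha k.+1 ^+ d * (eta k.+1 * Psi_inf * c1 *
       norm2 (grad (smoothing (alpha k.+1) f) (w k.+1 o)) ^+ 2))%:E <=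
     \int[P]_(o in A) (alpha k.+1 ^+ d * smoothing (alpha k.+1) f (w k.+1 o))%:E +
     ((c4 * (d%:R * K) * (1 + c2 * Q) +
       d%:R * (d%:R + 2) * K * (2 * Psi_sup ^+ 2 * (c2 * Q) + 2 * c3)) *
      (alpha k.+1 ^+ d.-1 * eta k.+1 ^+ 2))%:E)%E.
  have [k1 _ H1] := gradient_error; have [k2 _ H2] := arithmetic_error.
  have [k3 _ H3] := Delta_rate.
  exists (k1 + k2 + k3)%N => k kk A pA.
  have kk1 : (k1 <= k.+1)%N by apply: leqW; apply: leq_trans kk; rewrite -addnA leq_addr.
  have kk2 : (k2 <= k.+1)%N by apply: leqW; apply: leq_trans kk; rewrite addnAC leq_addl.
  have kk3 : (k3 <= k.+1)%N by apply: leqW; apply: leq_trans kk; rewrite leq_addl.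
  have [g [q [gm qm g_ae q_ae]]] := H1 _ kk1.
  have [em [qe [qem qe_ae]]] := H2 _ kk2.
  have pw := iterate_past gF_meas w_init w_step (ltn0Sn k).
  exact: (iteration_descent d_gt0 M_gt0 K0 fK f_ge0 pw (xis_law _ (ltn0Sn k)) (bs_law _ (ltn0Sn k))
    (samples_indep _ (ltn0Sn k)) (generic_indep _ (ltn0Sn k)) gF_meas (alpha_gt0 _ (ltn0Sn k))
    (ltW (eta_gt0 _ (ltn0Sn k))) (ltW c1_gt0) (ltW c2_gt0) (ltW c3_gt0) (ltW c4_gt0) Q0
    (ltW Psi_inf_gt0) Psi_inf_sup gm qm g_ae q_ae (PsiL_meas _ (ltn0Sn k)) (PsiU_meas _ (ltn0Sn k))
    (PsiLU _ (ltn0Sn k)) (psi_bounds _ (ltn0Sn k)) (PsiU_bounds _ (ltn0Sn k)) (H3 _ kk3)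
    em qem qe_ae (w_step _ (ltn0Sn k))).
set Cst := (_ + _) in step.
have Cst0 : 0 <= Cst.
  have D0 : 0 <= c4 * (d%:R * K) * (1 + c2 * Q).
    by rewrite !mulr_ge0// ?addr_ge0 ?mulr_ge0// ltW.
  rewrite addr_ge0// mulr_ge0 ?mulr_ge0 ?addr_ge0//.
    by rewrite !mulr_ge0 ?sqr_ge0// ltW.
  by rewrite mulr_ge0// ltW.
pose c := Psi_inf * c1.
have c0 : 0 < c by rewrite mulr_gt0.
pose X k o := alpha (k0.+1 + k)%N ^+ d * smoothing (alpha (k0.+1 + k)%N) f (w (k0.+1 + k)%N o).
pose Y k o := alpha (k0.+1 + k)%N ^+ d * eta (k0.+1 + k)%N *
  (c * norm2 (grad (smoothing (alpha (k0.+1 + k)%N) f) (w (k0.+1 + k)%N o)) ^+ 2).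
pose T k := alpha k ^+ d.-1 * eta k ^+ 2.
have T0 k : (0 < k)%N -> 0 <= T k by move=> kp; rewrite mulr_ge0 ?exprn_ge0// ltW ?alpha_gt0// eta_gt0.
have [S HS] : exists S, forall N, \sum_(k < N) T (k0.+1 + k)%N <= S.
  have fin : (\sum_(1 <= k <oo) (T k)%:E)%E \is a fin_num.
    rewrite ge0_fin_numE//; apply: nneseries_ge0 => k k1 _; rewrite lee_fin; exact: T0.
  exists (fine (\sum_(1 <= k <oo) (T k)%:E)%E) => N.
  rewrite -lee_fin fineK//.
  have bnd : ((\sum_(1 <= k < k0.+1 + N) T k)%:E <= \sum_(1 <= k <oo) (T k)%:E)%E.
    by rewrite -sumEFin; apply: nneseries_lim_ge => k k1 _; rewrite lee_fin; exact: T0.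
  apply: le_trans bnd; rewrite lee_fin.
  have -> : \sum_(k < N) T (k0.+1 + k)%N = \sum_(k0.+1 <= k < k0.+1 + N) T k.
    rewrite -{2}[k0.+1]add0n big_addn addKn big_mkord.
    by apply: eq_bigr => k _; rewrite addnC.
  rewrite (@big_cat_nat _ _ _ k0.+1 1 (k0.+1 + N))//=; last exact: leq_addr.
  rewrite lerDr big_nat_cond sumr_ge0// => k; rewrite andbT => /andP[k1 _]; exact: T0.
have mw k : measurable_fun setT (w k.+1).
  move=> _ B mB; apply: (@past_sub_measurable _ _ _ _ _ _ _ _ u xis bs psi e k).
  by apply: (iterate_past gF_meas w_init w_step (ltn0Sn k)); exists B.
have hlip k := smoothing_lip K0 f_ge0 fK (alpha_gt0 _ (ltn0Sn k)).
have mX k : measurable_fun setT (X k).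
  apply: measurable_funM => //; apply: measurableT_comp (mw (k0 + k)%N).
  exact: lip_measurable (hlip _).
have mY k : measurable_fun setT (Y k).
  apply: measurable_funM => //; apply: measurable_funM => //.
  apply: (measurableT_comp measurable_norm2_sqr).
  apply: measurableT_comp (mw (k0 + k)%N).
  have [_ hl] := smoothing_quadratic d_gt0 K0 f_ge0 fK (alpha_gt0 _ (ltn0Sn (k0 + k))).
  by apply/measurable_fun_mxP => i j; rewrite (ord1 i); exact: lip_measurable (hl j).
have X0 k o : 0 <= X k o by rewrite mulr_ge0 ?exprn_ge0 ?smoothing_ge0// ltW// alpha_gt0.
have Y0 k o : 0 <= Y k o.
  by rewrite !mulr_ge0 ?exprn_ge0 ?norm2_ge0// ltW ?alpha_gt0 ?eta_gt0.
have tB N : \sum_(k < N) Cst * T (k0.+1 + k)%N <= Cst * S by rewrite -mulr_sumr ler_wpM2l.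
have desc (N : nat) : let A := [set o | X 0%N o <= N%:R] in forall k,
    (\int[P]_(o in A) (X k.+1 o)%:E + \int[P]_(o in A) (Y k o)%:E <=
     \int[P]_(o in A) (X k o)%:E + (Cst * T (k0.+1 + k)%N)%:E)%E.
  move=> A k.
  have pA0 : past u xis bs psi e k0 A.
    have pX : measurable_wrt (past u xis bs psi e k0) (X 0%N).
      apply/measurable_wrt_sigma; rewrite /X addn0; apply: measurable_funM => //.
      have /measurable_wrt_sigma := iterate_past gF_meas w_init w_step (ltn0Sn k0).
      exact: measurableT_comp (lip_measurable (hlip k0)).
    apply: pX; exists [set` `]-oo, N%:R]] => //.
    by rewrite setTI; apply/seteqP; split=> o /=; rewrite in_itv.
  have pA : past u xis bs psi e (k0 + k) A by apply: past_mono pA0; exact: leq_addr.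
  have mA := past_sub_measurable pA.
  have mE (Z : O -> R) : measurable_fun setT Z -> measurable_fun A (fun o => (Z o)%:E).
    by move=> mZ; apply: measurable_funTS; exact/measurable_EFinP.
  have := step _ (leq_addr _ _) _ pA; apply: le_trans; apply: leeD.
    apply: ge0_le_integral => //.
    - by move=> o _; rewrite lee_fin X0.
    - exact: mE.
    - apply: mE; apply: measurable_funM => //; apply: measurableT_comp (mw (k0 + k).+1).
      exact: lip_measurable (hlip _).
    move=> o _; rewrite lee_fin /X addnS.
    apply: (smoothing_scaled_le f_ge0 fK); first exact: alpha_gt0.
    exact: alpha_noninc.
  rewrite le_eqVlt; apply/orP; left; apply/eqP; apply: eq_integral => o _.
  by rewrite /Y /c !addSn; congr EFin; ring.
have := almost_sure_summability mX mY X0 Y0 tB desc.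
move=> [N [mN N0 HN]]; exists N; split => // o no; apply: HN => -[b0 Hb]; apply: no.
exact: (stationary_subsequence (x := w^~ o) d_gt0 K0 fK f_ge0 alpha_gt0 eta_gt0 alpha_cvg0 sum_diverges c0 Hb).
Qed.
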